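(* Let $\alpha\in(1,2)$ and let $X=\{X(t)\}_{t\in[0,1]}$ be a symmetric $\alpha$-stable process given by $$X(t)=\int_S f(t,s)\,M(ds)\quad\text{a.s. for each }t\in[0,1],$$ where $M$ is an independently scattered symmetric $\alpha$-stable random measure on a measurable space $(S,\mathcal S)$ with finite control measure $m$ and $f(t,\cdot)\in L^\alpha(S,m)$ for all $t\in[0,1]$. Assume that there exist $\beta_1,\beta_2>1/2$, $p_1>\alpha$, $p_2>\alpha/2$ and increasing continuous functions $F_1,F_2:[0,1]\to\mathbb R$ such that for all $0\le t_1\le t\le t_2\le1$, $$\int|f(t_2,s)-f(t_1,s)|^{p_1}\,m(ds)\le|F_1(t_2)-F_1(t_1)|^{\beta_1},$$ $$\int\bigl|(f(t,s)-f(t_1,s))(f(t_2,s)-f(t,s))\bigr|^{p_2}\,m(ds)\le|F_2(t_2)-F_2(t_1)|^{2\beta_2}.$$ Then $X$ has a c\`adl\`ag modification.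
   Context: $M$ being an independently scattered symmetric $\alpha$-stable random measure with finite control measure $m$ means that $M$ is a ($\sigma$-additive) random measure, independent on disjoint sets, with $\mathbb E\exp\{i\theta M(A)\}=\exp\{-|\theta|^\alpha m(A)\}$ for all $A\in\mathcal S$ and $\theta\in\mathbb R$. $f$ is a real-valued deterministic function on $[0,1]\times S$, and $\int_S f(t,s)M(ds)$ is the usual stable stochastic integral. C\`adl\`ag means right-continuous with left-hand limits; a modification of $X$ is a process $\tilde X$ with $\mathbb P(\tilde X(t)=X(t))=1$ for each $t\in[0,1]$. *)

(* Defs.v *)
From HB Require Import structures.
From mathcomp Require Import all_boot all_order all_algebra.
From mathcomp Require Import all_classical all_reals all_analysis.
From mathcomp Require Import complex.
Set Implicit Arguments.
Unset Strict Implicit.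
Unset Printing Implicit Defensive.
Import Order.TTheory GRing.Theory Num.Theory.
Import numFieldNormedType.Exports.
Import HBSimple.
Local Open Scope classical_set_scope.
Local Open Scope ring_scope.

(* E exp(i theta Y), with exp(i x) = cos x + i sin x. *)
Definition char_fun (d : measure_display) (Omega : measurableType d)
    (R : realType) (P : probability Omega R) (Y : Omega -> R) (theta : R)
    : R[i] :=
  Complex (\int[P]_w cos (theta * Y w))%R (\int[P]_w sin (theta * Y w))%R.

(* Taking [B i = setT] for some of the indices gives the product rule for
   every subfamily. *)
Definition mutually_independent (d : measure_display) (Omega : measurableType d)
    (R : realType) (P : probability Omega R) (n : nat)
    (Y : 'I_n -> {RV P >-> R}) : Prop :=
  forall B : 'I_n -> set R, (forall i, measurable (B i)) ->
    P (\bigcap_(i in [set: 'I_n]) (Y i @^-1` B i))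
      = (\prod_(i < n) P (Y i @^-1` B i))%E.

(* [M A] is only meaningful for measurable [A]. *)
Record is_sas_random_measure (d d' : measure_display)
    (Omega : measurableType d) (S : measurableType d') (R : realType)
    (P : probability Omega R) (alpha : R)
    (m : {finite_measure set S -> \bar R})
    (M : set S -> {RV P >-> R}) : Prop := IsSaSRandomMeasure {
  sas_sigma_additive : forall A : nat -> set S,
    (forall k, measurable (A k)) -> trivIset setT A ->
    {ae P, forall w,
      series (fun k => M (A k) w) @ \oo --> M (\bigcup_k A k) w} ;
  sas_independently_scattered : forall (n : nat) (A : 'I_n -> set S),
    (forall i, measurable (A i)) -> trivIset setT A ->
    mutually_independent (fun i => M (A i)) ;
  sas_char_fun : forall (A : set S) (theta : R), measurable A ->
    char_fun P (M A) theta
      = (expR (- (`|theta| `^ alpha * fine (m A))))%:C%C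
}.

(* Every linear combination of the coordinates has a characteristic function
   exp(- sigma^alpha |theta|^alpha). *)
Definition is_sas_process (d : measure_display) (Omega : measurableType d)
    (R : realType) (P : probability Omega R) (alpha : R) (T : set R)
    (X : R -> {RV P >-> R}) : Prop :=
  forall (n : nat) (t : 'I_n -> R) (a : 'I_n -> R), (forall i, T (t i)) ->
    exists2 sigma : R, 0 <= sigma &
      forall theta : R,
        char_fun P (fun w => \sum_(i < n) a i * X (t i) w) theta
          = (expR (- (sigma `^ alpha * `|theta| `^ alpha)))%:C%C.

Definition cvg_in_probability (d : measure_display) (Omega : measurableType d)
    (R : realType) (P : probability Omega R)
    (Y : nat -> Omega -> R) (Z : Omega -> R) : Prop :=
  forall e : R, 0 < e ->
    P [set w | e < `|Y n w - Z w|] @[n --> \oo] --> 0%E.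

(* The sum is over [range g] rather than over all of [R] because [M set0] is
   only almost surely null. *)
Definition simple_stable_integral (d d' : measure_display)
    (Omega : measurableType d) (S : measurableType d') (R : realType)
    (P : probability Omega R) (M : set S -> {RV P >-> R})
    (g : {sfun S >-> R}) (w : Omega) : R :=
  \sum_(x \in range g) x * M (g @^-1` [set x]) w.

(* The integral of [g] in L^alpha(m) is the limit in probability of the
   integrals of simple functions converging to [g] in L^alpha(m); it is
   determined up to almost sure equality, whence a relation:
   [Y] is a version of the integral of [g]. *)
Definition is_stable_integral (d d' : measure_display)
    (Omega : measurableType d) (S : measurableType d') (R : realType)
    (P : probability Omega R) (alpha : R)
    (m : {finite_measure set S -> \bar R})
    (M : set S -> {RV P >-> R}) (g : S -> R) (Y : Omega -> R) : Prop :=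
  exists2 gn : nat -> {sfun S >-> R},
    (fun n => 'N[m]_(alpha%:E)[EFin \o (fun s => gn n s - g s)%R])%E @ \oo --> 0%E &
    cvg_in_probability P (fun n => simple_stable_integral M (gn n)) Y.

Definition cadlag01 (R : realType) (x : R -> R) : Prop :=
  (forall t, 0 <= t < 1 -> x u @[u --> t^'+] --> x t) /\
  (forall t, 0 < t <= 1 -> cvg (x u @[u --> t^'-])).

Definition is_modification (d : measure_display) (Omega : measurableType d)
    (R : realType) (P : probability Omega R) (T : set R)
    (X Y : R -> {RV P >-> R}) : Prop :=
  forall t, T t -> P [set w | Y t w = X t w] = 1%E.

(* Main.v *)
(* The marginals of M on disjoint cells A_i are independent stable variables
   xi_i = M(A_i). On the event that all |xi_i| are at most K, which has
   probability at least 1 - c K^-alpha, they may be truncated, and truncated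
   stable variables zeta satisfy the one-step inequality
   E|a + x zeta|^p <= (1 + C mu)|a|^p + C mu |x|^p  for p > alpha.
   Iterating it bounds moments of linear forms; splitting a product of two
   linear forms into its off-diagonal part (order p1) and its diagonal part
   (order p2) bounds the probability that two adjacent increments of X are
   both large by C_K (l^(-2 p1) Phi1^2 + l^(-2 p2) Phi2), apart from a single
   exceptional event whose probability does not grow with the number of
   increments considered. With the dyadic points of the time scale F1 + F2 + id
   and thresholds theta^n this is summable since beta1, beta2 > 1/2, so almost
   surely, at all fine levels, one of any two adjacent dyadic increments is at
   most theta^n. Chaining turns this into one-sided limits along the dyadic
   times, and the right limits form the cadlag modification, X being
   right-continuous in probability. *)
Require Import Defs.
From HB Require Import structures.
From mathcomp Require Import finmap.
From mathcomp Require Import all_boot all_order all_algebra.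
From mathcomp Require Import all_classical all_reals all_analysis.
From mathcomp Require Import complex ring lra measurable_realfun.
Set Implicit Arguments.
Unset Strict Implicit.
Unset Printing Implicit Defensive.
Import Order.TTheory GRing.Theory Num.Theory.
Import numFieldNormedType.Exports.
Import HBSimple.
Local Open Scope classical_set_scope.
Local Open Scope ring_scope.

(** Moments of [X] of orders [p1] and 2 p2 are in general infinite, both orders exceeding [alpha],
    so the hypotheses can be exploited only after truncation. The cost of truncating at K is of
    order K^-alpha and does not shrink with the mesh: paid once for every pair of increments it
    would make the sum over the levels diverge. All pairs of any finite range of levels are
    therefore realised over one finite partition of [S] and share the cost; the starting level then
    tends to infinity at fixed K, and K afterwards. Finiteness of [m] bounds the total mass of the
    truncated variables, hence the exponential factor produced by the iteration, uniformly in the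
    partition. The stable integrals are only limits in probability, so the values of [X] must first
    be replaced by step integrals. Closeness in L^alpha says nothing about moments of order [p1], so
    the step functions are built with pointwise control of increments and of products of
    increments. *)

(** * Elementary inequalities and truncation *)

Lemma expR_le_quad (R : realType) (z : R) : `|z| <= 2^-1 ->
  expR z <= 1 + z + 2 * z ^+ 2.
Proof.
rewrite ler_norml => /andP[z1 z2].
have h : 1 - z <= expR (- z) by exact: expR_ge1Dx.
have p : 0 < 1 - z by lra.
have : (expR z) * (1 - z) <= 1.
  by rewrite -[leRHS](expR0 R) -(subrr z) expRD ler_pM2l ?expR_gt0.
move=> h2; rewrite -(ler_pM2r p); apply: (le_trans h2).
by nra.
Qed.

Lemma sin_sub_le (R : realType) (x : R) : 0 <= x -> `|x - sin x| <= x ^+ 2.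
Proof.
rewrite le_eqVlt => /predU1P[<-|x0]; first by rewrite sin0 subrr normr0 sqr_ge0.
have [c cI] : exists2 c : R, c \in `]0, x[ & sin x - sin 0 = cos c * (x - 0).
  apply: MVT => //; apply: continuous_subspaceT => y; exact: continuous_sin.
rewrite sin0 !subr0 => ->.
move: cI; rewrite in_itv/= => /andP[c0 cx].
have [e eI] : exists2 e : R, e \in `]0, c[ & cos c - cos 0 = - sin e * (c - 0).
  apply: MVT => //; apply: continuous_subspaceT => y; exact: continuous_cos.
rewrite cos0 subr0 => h.
have h1 := sin_le1 e; have h2 := sin_geN1 e; have h3 := cos_le1 c.
have c1 : cos c = 1 - sin e * c by lra.
rewrite -[X in X - _]mul1r -mulrBl normrM (gtr0_norm x0) expr2 ler_pM2r//.
rewrite ger0_norm ?subr_ge0// c1.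
have : sin e * c <= 1 * c by rewrite ler_pM2r.
lra.
Qed.

Definition clamp (R : realType) (x : R) : R := Num.max (-1) (Num.min x 1).

Lemma clampE (R : realType) (x : R) : `|x| <= 1 -> clamp x = x.
Proof.
rewrite ler_norml => /andP[h1 h2]; rewrite /clamp (min_idPl h2).
exact/max_idPr.
Qed.

Lemma norm_clamp_le1 (R : realType) (x : R) : `|clamp x| <= 1.
Proof.
rewrite /clamp ler_norml le_max lexx/= ge_max ge_min lexx orbT andbT.
lra.
Qed.

Lemma norm_clamp (R : realType) (x : R) : `|clamp x| = Num.min `|x| 1.
Proof.
have [h|h] := leP `|x| 1; first by rewrite clampE.
have [x0|x0] := leP 0 x.
  rewrite ger0_norm// in h.
  by rewrite /clamp min_r ?(ltW h)// max_r ?normr1//; lra.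
rewrite ltr0_norm// in h.
by rewrite /clamp min_l ?max_l ?normrN1//; lra.
Qed.

(** The mean of the sine of a stable variable can be read off its characteristic function; this
    bound carries that information over to [clamp], up to a second moment. *)
Lemma clamp_sin_le (R : realType) (x : R) :
  `|clamp x - sin x| <= 2 * (clamp x) ^+ 2.
Proof.
have [h|h] := leP `|x| 1.
  rewrite clampE//; have [x0|x0] := leP 0 x.
    by have := sin_sub_le x0; have := sqr_ge0 x; lra.
  have x0' : 0 <= - x by lra.
  have := sin_sub_le x0'; rewrite sinN -opprD normrN sqrrN.
  by have := sqr_ge0 x; lra.
have -> : clamp x ^+ 2 = 1.
  by rewrite -real_normK ?num_real// norm_clamp min_r ?expr1n// ltW.
apply: (le_trans (ler_normB _ _)).
have := norm_clamp_le1 x.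
have : `|sin x| <= 1 by rewrite ler_norml sin_le1 sin_geN1.
lra.
Qed.

(** Two regimes. For 2p|y| <= 1, |1 + y|^p <= exp(p y), which is quadratic up to a factor; the y^2
    left over is absorbed by |y|^p when p <= 2, hence the conditional. For larger |y|, both |1 +
    y|^p and p|y| are dominated by multiples of |y|^p. In the constant, 2 p^2 comes from the first
    regime and the two powers from the second. *)
Lemma powR_add1_le (R : realType) (p : R) : 1 < p ->
  exists2 C : R, 0 <= C & forall y : R,
    `|1 + y| `^ p <= 1 + p * y
      + C * ((if 2 < p then y ^+ 2 else 0) + `|y| `^ p).
Proof.
move=> p1; have p0 : 0 < p by lra.
set c := (2 * p) `^ p + (2 * p + 1) `^ p + 2 * p ^+ 2.
have c1 : 0 <= (2 * p) `^ p by exact: powR_ge0.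
have c2 : 0 <= (2 * p + 1) `^ p by exact: powR_ge0.
have c3 : 0 <= 2 * p ^+ 2 by nra.
exists c; first by rewrite /c; lra.
move=> y.
have y20 : 0 <= (if 2 < p then y ^+ 2 else 0) by case: ifP => // _; exact: sqr_ge0.
have yp0 : 0 <= `|y| `^ p by exact: powR_ge0.
have n0 := normr_ge0 y.
have [h|h] := leP (2 * p * `|y|) 1.
  have py : `|p * y| <= 2^-1 by rewrite normrM (gtr0_norm p0); lra.
  have y1 : `|y| <= 1 by nra.
  have y2 : y ^+ 2 <= (if 2 < p then y ^+ 2 else 0) + `|y| `^ p.
    case: ltP => [_|p2]; first by rewrite lerDl.
    rewrite add0r -real_normK ?num_real//.
    have [->|yn0] := eqVneq `|y| 0; first by rewrite expr0n powR_ge0.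
    rewrite -powR_mulrn//; apply: ger_powR => //.
    by rewrite y1 andbT lt_neqAle eq_sym yn0.
  have y1' : 0 <= 1 + y.
    by move: py; rewrite normrM (gtr0_norm p0) => ?; have : - y <= `|y| by [rewrite -normrN ler_norm]; nra.
  apply: (@le_trans _ _ (expR (p * y))).
    rewrite ger0_norm// mulrC expRM; apply: ge0_ler_powR => //; first exact: ltW.
      by rewrite nnegrE expR_ge0.
    exact: expR_ge1Dx.
  apply: (le_trans (expR_le_quad py)).
  rewrite exprMn mulrA lerD2l.
  apply: ler_pM => //; first exact: sqr_ge0.
  by rewrite /c; lra.
have h1 : `|1 + y| `^ p <= (2 * p + 1) `^ p * `|y| `^ p.
  rewrite -powRM//; last lra.
  apply: ge0_ler_powR; rewrite ?nnegrE//; [lra|nra|].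
  by apply: (le_trans (ler_normD _ _)); rewrite normr1; nra.
have h2 : p * `|y| <= (2 * p) `^ p * `|y| `^ p.
  rewrite -powRM//; last lra.
  apply: (@le_trans _ _ (2 * p * `|y|)); first by nra.
  by apply: le1r_powR; lra.
have h3 : - `|y| <= y by rewrite lerNl -normrN ler_norm.
have h4 : - (p * `|y|) <= p * y by nra.
have h5 : (2 * p) `^ p * `|y| `^ p + (2 * p + 1) `^ p * `|y| `^ p <=
   c * ((if 2 < p then y ^+ 2 else 0) + `|y| `^ p).
  rewrite -mulrDl; apply: ler_pM => //; rewrite /c; lra.
lra.
Qed.

Lemma le_1DpowR (R : realType) (t q p : R) : 0 <= t -> 0 <= q -> q <= p ->
  t `^ q <= 1 + t `^ p.
Proof.
move=> t0 q0 qp; have [t1|t1] := leP t 1.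
  apply: (@le_trans _ _ 1); last by rewrite lerDl powR_ge0.
  rewrite -(powRr0 t); have [->|tn0] := eqVneq t 0.
    by rewrite powRr0 /powR eqxx; case: (q == 0).
  by apply: ger_powR => //; rewrite t1 andbT lt_neqAle eq_sym tn0.
apply: (@le_trans _ _ (t `^ p)); last by rewrite lerDr.
by apply: ler_powR => //; exact: ltW.
Qed.

(** * Bounded measurable functions *)

(** Every truncated variable lies in this class, on which expectations are finite and real-valued
    integrals can be added and compared freely. *)
Definition bounded_mfun (d : measure_display) (T : measurableType d) (R : realType)
    (f : T -> R) : Prop :=
  measurable_fun [set: T] f /\ exists K : R, forall w, `|f w| <= K.

Lemma bounded_mfun_integrable (d : measure_display) (T : measurableType d)
    (R : realType) (P : {finite_measure set T -> \bar R}) (f : T -> R) :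
  bounded_mfun f -> P.-integrable setT (EFin \o f).
Proof.
move=> [mf [K fK]]; apply: measurable_bounded_integrable => //.
  by have := fin_num_measure P _ measurableT; rewrite ge0_fin_numE.
exists K; split; first exact: num_real.
by move=> M KM x _ /=; apply: (le_trans (fK x)); exact: ltW.
Qed.

Lemma bounded_mfun_cst (d : measure_display) (T : measurableType d) (R : realType)
  (c : R) : bounded_mfun (fun _ : T => c).
Proof. by split=> //; exists `|c|. Qed.

Lemma bounded_mfunD (d : measure_display) (T : measurableType d) (R : realType)
  (f g : T -> R) : bounded_mfun f -> bounded_mfun g -> bounded_mfun (fun w => f w + g w).
Proof.
move=> [mf [K fK]] [mg [L gL]]; split; first exact: measurable_funD.
by exists (K + L) => w; apply: (le_trans (ler_normD _ _)); exact: lerD.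
Qed.

Lemma bounded_mfunM (d : measure_display) (T : measurableType d) (R : realType)
  (f g : T -> R) : bounded_mfun f -> bounded_mfun g -> bounded_mfun (fun w => f w * g w).
Proof.
move=> [mf [K fK]] [mg [L gL]]; split; first exact: measurable_funM.
by exists (K * L) => w; rewrite normrM ler_pM.
Qed.

Lemma bounded_mfunZ (d : measure_display) (T : measurableType d) (R : realType)
  (c : R) (f : T -> R) : bounded_mfun f -> bounded_mfun (fun w => c * f w).
Proof. by move=> bf; apply: bounded_mfunM => //; exact: bounded_mfun_cst. Qed.

Lemma bounded_mfun_powR (d : measure_display) (T : measurableType d) (R : realType)
  (p : R) (f : T -> R) : 0 <= p -> bounded_mfun f -> bounded_mfun (fun w => `|f w| `^ p).
Proof.
move=> p0 [mf [K fK]]; split.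
  apply: (measurableT_comp (measurable_powR p)); exact: measurableT_comp.
exists (K `^ p) => w; rewrite ger0_norm ?powR_ge0// ge0_ler_powR ?nnegrE//.
by apply: le_trans (fK w).
Qed.

Lemma bounded_mfun_sum (d : measure_display) (T : measurableType d) (R : realType)
  (I : Type) (s : seq I) (f : I -> T -> R) :
  (forall i, bounded_mfun (f i)) -> bounded_mfun (fun w => \sum_(i <- s) f i w).
Proof.
move=> bf; elim: s => [|i s IH].
  by under eq_fun do rewrite big_nil; exact: bounded_mfun_cst.
by under eq_fun do rewrite big_cons; exact: bounded_mfunD.
Qed.

Lemma bounded_mfun_clamp (d : measure_display) (T : measurableType d) (R : realType)
  (f : T -> R) : measurable_fun setT f -> bounded_mfun (fun w => clamp (f w)).
Proof.
move=> mf; split; last by exists 1 => w; exact: norm_clamp_le1.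
by apply: measurable_maxr => //; exact: measurable_minr.
Qed.

Lemma EFin_Rintegral_bounded_mfun (d : measure_display) (T : measurableType d)
    (R : realType) (P : {finite_measure set T -> \bar R}) (f : T -> R) :
  bounded_mfun f -> (\int[P]_w (f w)%:E)%E = (\int[P]_w f w)%:E.
Proof.
move=> bf; rewrite fineK//; apply: integrable_fin_num => //.
exact: bounded_mfun_integrable.
Qed.

(** * Tails and truncated moments of a symmetric stable variable *)

Lemma integral_1Bcos (R : realType) (y : R) : y != 0 ->
  (\int[@lebesgue_measure R]_(t in `[0%R, 1%R]) (1 - cos (t * y))%:E
    = (1 - sin y / y)%:E)%E.
Proof.
move=> y0; have dF (t : R) :
    is_derive t 1 (fun t : R => t - sin (t * y) / y) (1 - cos (t * y)).
  have h1 : is_derive t 1 (fun t : R => t * y) y.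
    by apply: is_derive_eq; rewrite scaler0 add0r /GRing.scale/= mulr1.
  have h2 : is_derive t 1 (fun t : R => sin (t * y)) (cos (t * y) * y).
    exact: (@is_derive1_comp _ sin (fun t : R => t * y)).
  have h3 : is_derive t 1 (fun t : R => sin (t * y) * y^-1) (cos (t * y)).
    by apply: is_derive_eq; rewrite scaler0 add0r /GRing.scale/= mulrC mulfK.
  exact: is_deriveB.
have cF : continuous (fun t : R => t - sin (t * y) / y).
  move=> t; apply/differentiable_continuous/derivable1_diffP.
  exact: (@ex_derive _ _ _ _ _ _ _ (dF t)).
rewrite (@continuous_FTC2 R _ (fun t : R => t - sin (t * y) / y))//.
- by rewrite !mul0r sin0 mul0r subr0 sube0 mul1r.
- apply: continuous_subspaceT => t; apply: cvgB; first exact: cvg_cst.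
  apply: (@continuous_comp _ _ _ (fun t : R => t * y) cos).
    by apply: cvgMl; exact: cvg_id.
  exact: continuous_cos.
- split.
  + by move=> t _; exact: (@ex_derive _ _ _ _ _ _ _ (dF t)).
  + exact/cvg_at_right_filter/cF.
  + exact/cvg_at_left_filter/cF.
- by move=> t _; rewrite derive1E derive_val.
Qed.

(** The characteristic function is split into real and imaginary parts. [mu] is the scale to the
    power [alpha]: for [xi] the value of the random measure on a cell, it is the control measure of
    that cell. *)
Record sas_var (d : measure_display) (T : measurableType d) (R : realType)
    (P : probability T R) (alpha : R) (xi : T -> R) (mu : R) : Prop := SasVar {
  sas_meas : measurable_fun [set: T] xi ;
  sas_ge0 : 0 <= mu ;
  sas_cos : forall t, \int[P]_w cos (t * xi w) = expR (- (`|t| `^ alpha * mu)) ;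
  sas_sin : forall t, \int[P]_w sin (t * xi w) = 0 }.

Lemma sas_varZ (d : measure_display) (T : measurableType d) (R : realType)
    (P : probability T R) (alpha : R) (xi : T -> R) (mu x : R) :
  sas_var P alpha xi mu -> sas_var P alpha (fun w => x * xi w) (`|x| `^ alpha * mu).
Proof.
move=> [h1 h2 h3 h4]; split.
- by apply: measurable_funM => //; exact: measurable_cst.
- by rewrite mulr_ge0// powR_ge0.
- by move=> t; under eq_Rintegral do rewrite mulrA; rewrite h3 normrM powRM// mulrA.
- by move=> t; under eq_Rintegral do rewrite mulrA; rewrite h4.
Qed.

Lemma measurable_cos (R : realType) : measurable_fun [set: R] (@cos R).
Proof. by apply: continuous_measurable_fun; exact: continuous_cos. Qed.

Lemma measurable_sin (R : realType) : measurable_fun [set: R] (@sin R).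
Proof. by apply: continuous_measurable_fun; exact: continuous_sin. Qed.

Lemma bounded_mfun_cos (d : measure_display) (T : measurableType d) (R : realType)
  (f : T -> R) : measurable_fun setT f -> bounded_mfun (fun w => cos (f w)).
Proof.
move=> mf; split; first by apply: (measurableT_comp (@measurable_cos R)).
by exists 1 => w; rewrite ler_norml cos_le1 cos_geN1.
Qed.

Lemma bounded_mfun_sin (d : measure_display) (T : measurableType d) (R : realType)
  (f : T -> R) : measurable_fun setT f -> bounded_mfun (fun w => sin (f w)).
Proof.
move=> mf; split; first by apply: (measurableT_comp (@measurable_sin R)).
by exists 1 => w; rewrite ler_norml sin_le1 sin_geN1.
Qed.

Lemma Rintegral_cst1 (d : measure_display) (T : measurableType d) (R : realType)
    (P : probability T R) (c : R) : \int[P]_w c = c.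
Proof. by rewrite Rintegral_cst//= probability_setT/= mulr1. Qed.

Lemma measurable_norm_ge (d : measure_display) (T : measurableType d)
    (R : realType) (f : T -> R) (c : R) :
  measurable_fun setT f -> measurable [set w | c <= `|f w|].
Proof.
move=> mf; rewrite -[X in measurable X]setTI.
apply: (@measurable_fun_ler _ _ _ setT (fun=> c) (fun w => `|f w|)) => //.
exact: measurableT_comp.
Qed.

(** Averaging 1 - cos(t xi) over t in [0, 1] gives 1 - sin(xi) / xi, which is at least 1/2 where
    |xi| >= 2. By Fubini the expectation of this average is the average of 1 - exp(-t^alpha mu),
    which is at most [mu]. *)
Lemma sas_tail2 (d : measure_display) (T : measurableType d) (R : realType)
    (P : probability T R) (alpha : R) (xi : T -> R) (mu : R) :
  0 < alpha -> sas_var P alpha xi mu ->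
  (P [set w | (2 <= `|xi w|)%R] <= (2 * mu)%:E)%E.
Proof.
move=> a0 [mxi mu0 hcos hsin].
pose D : set R := `[0, 1]%classic.
pose f (z : T * R) : \bar R := ((1 - cos (z.2 * xi z.1)) * \1_D z.2)%:E.
have mD : measurable D by exact: measurable_itv.
have mf : measurable_fun setT f.
  apply/measurable_EFinP; apply: measurable_funM.
    apply: measurable_funB; first exact: measurable_cst.
    apply: (measurableT_comp (@measurable_cos R)).
    apply: measurable_funM; first exact: measurable_snd.
    apply: (measurableT_comp mxi); exact: measurable_fst.
  have mI : measurable_fun [set: R] (\1_D : R -> R) by exact: measurable_indic.
  apply: (measurableT_comp mI); exact: measurable_snd.
have f0 z : (0 <= f z)%E.
  by rewrite lee_fin mulr_ge0// ?subr_ge0 ?cos_le1// indicE ler0n.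
have := fubini_tonelli1 (m1 := P) (m2 := @lebesgue_measure R) f mf f0.
rewrite (fubini_tonelli2 (m1 := P) (m2 := @lebesgue_measure R) f mf f0) => E.
have mA : measurable [set w | 2 <= `|xi w|] by exact: measurable_norm_ge.
have L : ((2^-1)%:E * P [set w | (2 <= `|xi w|)%R] <=
    \int[P]_x fubini_F (@lebesgue_measure R) f x)%E.
  rewrite -[X in (_ * P X)%E]setIT -integral_indic// -ge0_integralZl//; last first.
    by apply/measurable_EFinP; exact: measurable_indic.
  apply: ge0_le_integral => //.
  - apply: measurable_funeM; apply/measurable_EFinP; exact: measurable_indic.
  - exact: measurable_fun_fubini_tonelli_F.
  move=> w _; rewrite indicE; case: (boolP (w \in _)) => [|_]; last first.
    by rewrite mule0; apply: integral_ge0.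
  rewrite inE/= => h2; rewrite mule1 /fubini_F/=.
  have y0 : xi w != 0 by rewrite -normr_gt0; lra.
  have -> : (\int[@lebesgue_measure R]_y f (w, y) =
      \int[@lebesgue_measure R]_(t in D) (1 - cos (t * xi w))%:E)%E.
    rewrite [RHS]integral_mkcond; apply: eq_integral => t _.
    by rewrite /f/= patchE indicE; case: ifP; rewrite ?mulr1 ?mulr0.
  rewrite integral_1Bcos// lee_fin.
  have : `|sin (xi w) / xi w| <= 2^-1.
    rewrite normrM normfV ler_pdivrMr ?normr_gt0//.
    have : `|sin (xi w)| <= 1 by rewrite ler_norml sin_le1 sin_geN1.
    lra.
  by rewrite ler_norml => /andP[? ?]; lra.
have U : (\int[@lebesgue_measure R]_y fubini_G P f y <= mu%:E)%E.
  apply: (@le_trans _ _ (\int[@lebesgue_measure R]_(y in D) mu%:E)%E); last first.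
    rewrite integral_cst// /D/= lebesgue_measure_itv/= lte_fin ltr01 -EFinD subr0.
    by rewrite mule1.
  rewrite [leRHS]integral_mkcond.
  apply: ge0_le_integral => //.
  - by move=> w _; apply: integral_ge0.
  - exact: measurable_fun_fubini_tonelli_G.
  - by apply/(measurable_restrictT _ mD).
  move=> t _; rewrite /fubini_G /f/= patchE.
  under eq_integral do rewrite indicE.
  case: ifPn => [|tD]; last first.
    by under eq_integral do rewrite mulr0; rewrite integral0.
  rewrite inE /D/= in_itv/= => /andP[t0 t1].
  under eq_integral do rewrite mulr1.
  have bc : bounded_mfun (fun w => cos (t * xi w)).
    by apply: bounded_mfun_cos; apply: measurable_funM => //; exact: measurable_cst.
  have b1 : bounded_mfun (fun w : T => 1 - cos (t * xi w)).
    have -> : (fun w => 1 - cos (t * xi w)) = (fun w => 1 + (-1) * cos (t * xi w)).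
      by apply/funext => w; rewrite mulN1r.
    by apply: bounded_mfunD; [exact: bounded_mfun_cst|exact: bounded_mfunZ].
  rewrite (EFin_Rintegral_bounded_mfun P b1) lee_fin RintegralB//; last 2 first.
    exact: (bounded_mfun_integrable P (bounded_mfun_cst T 1)).
    exact: (bounded_mfun_integrable P bc).
  rewrite Rintegral_cst1 hcos.
  have := expR_ge1Dx (- (`|t| `^ alpha * mu)).
  have : `|t| `^ alpha * mu <= 1 * mu.
    rewrite ler_wpM2r// ger0_norm//.
    rewrite -[leRHS](powRr0 t); have [->|tn0] := eqVneq t 0.
      by rewrite powRr0 powR0 ?gt_eqF.
    by apply: ger_powR; rewrite ?t1 ?lt_neqAle ?t0 ?andbT 1?eq_sym//; exact: ltW.
  lra.
have : ((2^-1)%:E * P [set w | (2 <= `|xi w|)%R] <= mu%:E)%E.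
  by apply: (le_trans L); rewrite -E.
have : P [set w | 2 <= `|xi w|] \is a fin_num by exact: fin_num_measure.
move=> /fineK <-; rewrite -EFinM !lee_fin; lra.
Qed.

Lemma sas_tail (d : measure_display) (T : measurableType d) (R : realType)
    (P : probability T R) (alpha : R) (xi : T -> R) (mu r : R) :
  0 < alpha -> sas_var P alpha xi mu -> 0 < r ->
  (P [set w | (r <= `|xi w|)%R] <= (2 * (2 / r) `^ alpha * mu)%:E)%E.
Proof.
move=> a0 hxi r0.
have r2 : 0 <= 2 / r by rewrite divr_ge0// ltW.
have := sas_tail2 a0 (sas_varZ (2 / r) hxi); rewrite mulrA (ger0_norm r2).
have -> // : [set w | 2 <= `|2 / r * xi w|] = [set w | r <= `|xi w|].
by apply/seteqP; split => w /=;
  rewrite normrM (ger0_norm r2) mulrAC ler_pdivlMr// ler_pM2l.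
Qed.

Lemma powR_le1 (R : realType) (x q : R) : 0 <= x <= 1 -> 0 <= q -> x `^ q <= 1.
Proof.
move=> /andP[x0 x1] q0; have := ge0_ler_powR q0 x0 (ler01 : 1 \in Num.nneg) x1.
by rewrite powR1.
Qed.

Lemma powR2_lt1 (R : realType) (x : R) : x < 0 -> 2 `^ x < 1.
Proof.
by move=> x0; rewrite /powR pnatr_eq0/= expR_lt1 nmulr_rlt0// ln_gt0// ltr1n.
Qed.

(** Self-similarity: where |xi| < 1/2, truncating 2 xi instead of xi multiplies the integrand by 2^q
    exactly, and elsewhere the integrand is at most 1. Hence the moment of xi is at most P(|xi| >=
    1/2) plus 2^-q times the moment of 2 xi, whose parameter is 2^alpha mu. The recursion contracts
    because [alpha] < [q]. *)
Lemma sas_clamp_moment (d : measure_display) (T : measurableType d)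
    (R : realType) (P : probability T R) (alpha q : R) :
  0 < alpha -> alpha < q ->
  exists2 C : R, 0 <= C & forall xi mu, sas_var P alpha xi mu ->
    \int[P]_w (`|clamp (xi w)| `^ q) <= C * mu.
Proof.
move=> a0 aq; have q0 : 0 < q by lra.
(* [r] is the ratio of the recursion and [c] the tail constant at level 1/2; c / (1 - r) is the
   solution of A = c + r A. *)
pose r : R := 2 `^ (alpha - q); pose c : R := 2 * 4 `^ alpha.
have c0 : 0 <= c by rewrite mulr_ge0// powR_ge0.
have r0 : 0 < r by exact: powR_gt0.
have r1 : r < 1.
  by apply: powR2_lt1; lra.
have r1' : 0 < 1 - r by lra.
exists (c / (1 - r)); first by rewrite divr_ge0// ltW.
(* After n doublings the remaining expectation is bounded by 1 and carries the weight 2^(-q n). *)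
have main n : forall xi mu, sas_var P alpha xi mu ->
    \int[P]_w (`|clamp (xi w)| `^ q) <= c / (1 - r) * mu + (2 `^ (- q)) ^+ n.
  elim: n => [|n IH] xi mu hxi; have [mxi mu0 _ _] := hxi.
    rewrite expr0 -[leLHS]add0r lerD//; first by rewrite mulr_ge0// divr_ge0// ltW.
    rewrite -[leRHS](Rintegral_cst1 P); apply: le_Rintegral => //.
    - by apply: bounded_mfun_integrable; apply: bounded_mfun_powR; [exact: ltW|exact: bounded_mfun_clamp].
    - exact: (bounded_mfun_integrable P (bounded_mfun_cst T 1)).
    by move=> w _; rewrite powR_le1 ?norm_clamp_le1 ?normr_ge0// ltW.
  pose A := [set w | 2^-1 <= `|xi w|].
  have mA : measurable A by exact: measurable_norm_ge.
  have bA : bounded_mfun (fun w => \1_A w : R).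
    split; first exact: measurable_indic.
    by exists 1 => w; rewrite indicE; case: (_ \in _); rewrite ?normr1 ?normr0.
  have hxi2 := sas_varZ 2 hxi.
  have b2 : bounded_mfun (fun w => `|clamp (2 * xi w)| `^ q).
    apply: bounded_mfun_powR; first exact: ltW.
    by apply: bounded_mfun_clamp; have [] := hxi2.
  have step : \int[P]_w (`|clamp (xi w)| `^ q) <=
      \int[P]_w (\1_A w + 2 `^ (- q) * `|clamp (2 * xi w)| `^ q).
    apply: le_Rintegral => //.
    - by apply: bounded_mfun_integrable; apply: bounded_mfun_powR; [exact: ltW|exact: bounded_mfun_clamp].
    - by apply: bounded_mfun_integrable; apply: bounded_mfunD => //; exact: bounded_mfunZ.
    move=> w _; rewrite indicE; case: (boolP (w \in A)) => wA.
      apply: (@le_trans _ _ 1); last first.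
        by rewrite lerDl mulr_ge0// powR_ge0.
      by rewrite powR_le1 ?norm_clamp_le1 ?normr_ge0// ltW.
    have {}wA : `|xi w| < 2^-1 by rewrite ltNge; apply/negP => h; case/negP: wA; rewrite inE.
    rewrite add0r !clampE ?normrM ?(@ger0_norm _ 2)//; [|lra..].
    by rewrite powRM// mulrA -powRD ?addNr ?powRr0 ?mul1r// pnatr_eq0 implybT.
  apply: (le_trans step); rewrite RintegralD//; last 2 first.
    exact: bounded_mfun_integrable.
    by apply: bounded_mfun_integrable; exact: bounded_mfunZ.
  rewrite RintegralZl//; last exact: bounded_mfun_integrable.
  have e1 : \int[P]_w \1_A w <= c * mu.
    rewrite -lee_fin -EFin_Rintegral_bounded_mfun// integral_indic// setIT.
    have h : (0 : R) < 2^-1 by [].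
    apply: (le_trans (sas_tail a0 hxi h)); rewrite lee_fin /c.
    by have -> : (2 : R) / 2^-1 = 4 by rewrite invrK -natrM.
  have e2 := IH _ _ hxi2.
  rewrite (@ger0_norm _ 2)// in e2.
  have p0 : 0 < 2 `^ (- q) :> R by exact: powR_gt0.
  have e3 : 2 `^ (- q) * 2 `^ alpha = r :> R.
    by rewrite -powRD ?pnatr_eq0 ?implybT// addrC.
  apply: (@le_trans _ _ (c * mu + 2 `^ (- q) *
    (c / (1 - r) * (2 `^ alpha * mu) + (2 `^ (- q)) ^+ n))).
    by rewrite lerD// ler_pM2l.
  rewrite mulrDr -exprS addrA lerD2r.
  have -> : 2 `^ (- q) * (c / (1 - r) * (2 `^ alpha * mu)) =
     (2 `^ (- q) * 2 `^ alpha) * (c / (1 - r)) * mu by ring.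
  rewrite e3 le_eqVlt; apply/orP; left; apply/eqP.
  by field; rewrite gt_eqF.
move=> xi mu hxi; apply/ler_addgt0Pr => e e0.
have /cvgrPdist_lt /(_ e e0) [N _ hN] : (2 `^ (- q)) ^+ n @[n --> \oo] --> (0 : R).
  apply: cvg_expr; rewrite ger0_norm ?powR_ge0//.
  by apply: powR2_lt1; lra.
apply: (le_trans (main N _ _ hxi)); rewrite lerD2l ltW//.
have := hN N (leqnn N); rewrite /= sub0r normrN; apply: le_lt_trans.
exact: ler_norm.
Qed.

(** Symmetry of the law is available only through the characteristic function: sin(xi) has mean 0,
    so the mean of the truncation is that of clamp(xi) - sin(xi), which is controlled by the
    truncated second moment since [alpha] < 2. *)
Lemma sas_clamp_mean (d : measure_display) (T : measurableType d)
    (R : realType) (P : probability T R) (alpha : R) :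
  0 < alpha < 2 ->
  exists2 C : R, 0 <= C & forall xi mu, sas_var P alpha xi mu ->
    `|\int[P]_w clamp (xi w)| <= C * mu.
Proof.
move=> /andP[a0 a2]; have [C C0 hC] := sas_clamp_moment P a0 a2.
exists (2 * C); first by rewrite mulr_ge0.
move=> xi mu hxi; have [mxi mu0 _ hsin] := hxi.
have bc : bounded_mfun (fun w => clamp (xi w)) by exact: bounded_mfun_clamp.
have bs : bounded_mfun (fun w => sin (xi w)) by exact: bounded_mfun_sin.
have b2 : bounded_mfun (fun w => `|clamp (xi w)| `^ 2) by exact: bounded_mfun_powR.
have bd : bounded_mfun (fun w => clamp (xi w) - sin (xi w)).
  have -> : (fun w => clamp (xi w) - sin (xi w)) =
            (fun w => clamp (xi w) + (-1) * sin (xi w)).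
    by apply/funext => w; rewrite mulN1r.
  by apply: bounded_mfunD => //; exact: bounded_mfunZ.
have -> : \int[P]_w clamp (xi w) = \int[P]_w (clamp (xi w) - sin (xi w)).
  rewrite RintegralB//; [|exact: bounded_mfun_integrable..].
  have := hsin 1; under eq_Rintegral do rewrite mul1r.
  by move=> ->; rewrite subr0.
apply: (le_trans (le_normr_Rintegral _ _)) => //; first exact: bounded_mfun_integrable.
apply: (@le_trans _ _ (\int[P]_w (2 * `|clamp (xi w)| `^ 2))).
  apply: le_Rintegral => //.
  - apply: (bounded_mfun_integrable P (f := fun w => `|clamp (xi w) - sin (xi w)|)).
    case: bd => md [K hK]; split; first exact: measurableT_comp.
    by exists K => w; rewrite normr_id.
  - by apply: bounded_mfun_integrable; exact: bounded_mfunZ.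
  move=> w _; rewrite powR_mulrn// real_normK ?num_real//.
  exact: clamp_sin_le.
rewrite RintegralZl//; last exact: bounded_mfun_integrable.
by rewrite -mulrA ler_pM2l// hC.
Qed.

(** * The one-step inequality *)

(** Stated for constants [a] and [x]; independence will allow functions of the past in their
    place. *)
Definition one_step (d : measure_display) (T : measurableType d)
    (R : realType) (P : probability T R) (p C mu : R) (zeta : T -> R) : Prop :=
  forall a x, \int[P]_w (`|a + x * zeta w| `^ p)
    <= (1 + C * mu) * `|a| `^ p + C * mu * `|x| `^ p.

(** By homogeneity [a] becomes 1. The first order term of the expansion enters only through the mean
    of [zeta], so a mean of order [mu] makes every correction proportional to [mu], as the iteration
    requires. Powers of |t| up to p are absorbed into 1 + |t|^p. The constant collects p from the
    linear term and [C0] from each of the two remainders. *)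
Lemma one_step_moments (d : measure_display) (T : measurableType d)
    (R : realType) (P : probability T R) (p c : R) :
  1 < p -> 0 <= c ->
  exists2 C : R, 0 <= C & forall zeta mu, bounded_mfun zeta -> 0 <= mu ->
    `|\int[P]_w zeta w| <= c * mu ->
    (2 < p -> \int[P]_w (`|zeta w| `^ 2) <= c * mu) ->
    \int[P]_w (`|zeta w| `^ p) <= c * mu ->
    one_step P p C mu zeta.
Proof.
move=> p1 c0; have [C0 C00 hC0] := powR_add1_le p1.
have p0 : 0 <= p by lra.
have C'0 : 0 <= (p + 2 * C0) * c by rewrite mulr_ge0// addr_ge0// mulr_ge0.
exists ((p + 2 * C0) * c) => // zeta mu bz mu0 h1 h2 hp a x.
set C := (p + 2 * C0) * c in C'0 *.
have bp := bounded_mfun_powR p0 bz.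
have [->|a0] := eqVneq a 0.
  rewrite normr0 powR0; last by rewrite gt_eqF//; lra.
  rewrite mulr0 add0r.
  under eq_Rintegral do rewrite add0r normrM powRM//.
  rewrite RintegralZl//; last exact: bounded_mfun_integrable.
  rewrite mulrC ler_wpM2r ?powR_ge0//; apply: (le_trans hp).
  rewrite ler_wpM2r// /C -[leLHS]mul1r ler_wpM2r//; lra.
pose t := x / a.
have bD : bounded_mfun (fun w => `|1 + t * zeta w| `^ p).
  by apply: bounded_mfun_powR => //; apply: bounded_mfunD; [exact: bounded_mfun_cst|exact: bounded_mfunZ].
have -> : \int[P]_w (`|a + x * zeta w| `^ p) =
    `|a| `^ p * \int[P]_w (`|1 + t * zeta w| `^ p).
  rewrite -RintegralZl//; last exact: bounded_mfun_integrable.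
  apply: eq_Rintegral => w _; rewrite -powRM// -normrM; congr (`|_| `^ _).
  by rewrite /t; field.
have -> : `|x| `^ p = `|a| `^ p * `|t| `^ p.
  by rewrite -powRM// -normrM /t mulrCA mulfV// mulr1.
have ap : 0 < `|a| `^ p by rewrite powR_gt0// normr_gt0.
suff : \int[P]_w (`|1 + t * zeta w| `^ p) <= 1 + C * mu * (1 + `|t| `^ p).
  by move=> h; rewrite -(ler_pM2l ap) in h; apply: (le_trans h); rewrite le_eqVlt; apply/orP; left; apply/eqP; ring.
pose g2 w := if 2 < p then (t * zeta w) ^+ 2 else 0.
have bg2 : bounded_mfun g2.
  rewrite /g2; case: (2 < p); last exact: bounded_mfun_cst.
  by under eq_fun do rewrite expr2; apply: bounded_mfunM; exact: bounded_mfunZ.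
have bp' : bounded_mfun (fun w => `|t * zeta w| `^ p) by apply: bounded_mfun_powR => //; exact: bounded_mfunZ.
have bptz : bounded_mfun (fun w => p * (t * zeta w)) by do 2 apply: bounded_mfunZ.
have t0 := normr_ge0 t.
have tp0 : 0 <= `|t| `^ p by exact: powR_ge0.
apply: (@le_trans _ _ (\int[P]_w (1 + p * (t * zeta w) + C0 * (g2 w + `|t * zeta w| `^ p)))).
  apply: le_Rintegral => //.
    exact: bounded_mfun_integrable.
    apply: bounded_mfun_integrable; apply: bounded_mfunD; first by apply: bounded_mfunD => //; exact: bounded_mfun_cst.
    by apply: bounded_mfunZ; exact: bounded_mfunD.
rewrite RintegralD//; last 2 first.
  by apply: bounded_mfun_integrable; apply: bounded_mfunD => //; exact: bounded_mfun_cst.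
  by apply: bounded_mfun_integrable; apply: bounded_mfunZ; exact: bounded_mfunD.
rewrite RintegralD//; last 2 first.
  exact: (bounded_mfun_integrable P (bounded_mfun_cst T 1)).
  exact: bounded_mfun_integrable.
rewrite Rintegral_cst1 RintegralZl//; last by apply: bounded_mfun_integrable; exact: bounded_mfunZ.
rewrite RintegralZl//; last exact: bounded_mfun_integrable.
rewrite RintegralZl//; last by apply: bounded_mfun_integrable; exact: bounded_mfunD.
rewrite RintegralD//; [|exact: bounded_mfun_integrable..].
have e1 : p * (t * \int[P]_w zeta w) <= p * c * mu * (1 + `|t| `^ p).
  rewrite -(mulrA p c mu) -(mulrA p (c * mu)) ler_wpM2l//.
  apply: (le_trans (ler_norm _)); rewrite normrM [leRHS]mulrC; apply: ler_pM => //.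
  by have := le_1DpowR t0 ler01 (ltW p1); rewrite powRr1.
have e2 : \int[P]_w g2 w <= c * mu * (1 + `|t| `^ p).
  rewrite /g2; case: (ltP 2 p) => p2; last first.
    by rewrite Rintegral_cst1 mulr_ge0 ?mulr_ge0// addr_ge0.
  have -> : \int[P]_w (t * zeta w) ^+ 2 = `|t| `^ 2 * \int[P]_w (`|zeta w| `^ 2).
    rewrite -RintegralZl//; last by apply: bounded_mfun_integrable; exact: bounded_mfun_powR.
    apply: eq_Rintegral => w _.
    by rewrite -powRM// -normrM powR_mulrn// real_normK ?num_real.
  rewrite mulrC; apply: ler_pM => //; first exact: Rintegral_ge0.
  - exact: h2.
  - by apply: le_1DpowR => //; exact: ltW.
have e3 : \int[P]_w (`|t * zeta w| `^ p) <= c * mu * (1 + `|t| `^ p).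
  under eq_Rintegral do rewrite normrM powRM//.
  rewrite RintegralZl//; last exact: bounded_mfun_integrable.
  rewrite mulrC; apply: ler_pM => //; first by apply: Rintegral_ge0 => w _; exact: powR_ge0.
  by rewrite lerDr.
have e4 := ler_wpM2l C00 (lerD e2 e3).
rewrite -addrA lerD2l; apply: (le_trans (lerD e1 e4)).
by rewrite /C le_eqVlt; apply/orP; left; apply/eqP; ring.
Qed.

Lemma one_step_clamp (d : measure_display) (T : measurableType d)
    (R : realType) (P : probability T R) (alpha p : R) :
  0 < alpha < 2 -> alpha < p -> 1 < p ->
  exists2 C : R, 0 <= C & forall xi mu, sas_var P alpha xi mu ->
    one_step P p C mu (fun w => clamp (xi w)).
Proof.
move=> a02 ap p1; have /andP[a0 a2] := a02.
have [c1 c10 h1] := sas_clamp_mean P a02.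
have [c2 c20 h2] := sas_clamp_moment P a0 a2.
have [c3 c30 h3] := sas_clamp_moment P a0 ap.
have c0 : 0 <= c1 + c2 + c3 by rewrite !addr_ge0.
have [C C0 hC] := one_step_moments P p1 c0.
exists C => // xi mu hxi; have [mxi mu0 _ _] := hxi.
apply: hC => //; first exact: bounded_mfun_clamp.
- by apply: (le_trans (h1 _ _ hxi)); rewrite ler_wpM2r//; lra.
- by move=> _; apply: (le_trans (h2 _ _ hxi)); rewrite ler_wpM2r//; lra.
- by apply: (le_trans (h3 _ _ hxi)); rewrite ler_wpM2r//; lra.
Qed.

(** The square has tails of index alpha / 2, so the moment of order p of the square is one of order
    2p > alpha of the variable. For p <= 1, subadditivity of the power suffices and the mean plays
    no part; for p > 1 the mean is itself a truncated second moment, hence of order [mu] without any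
    cancellation. *)
Lemma one_step_clamp_sqr (d : measure_display) (T : measurableType d)
    (R : realType) (P : probability T R) (alpha p : R) :
  0 < alpha < 2 -> alpha / 2 < p ->
  exists2 C : R, 0 <= C & forall xi mu, sas_var P alpha xi mu ->
    one_step P p C mu (fun w => (clamp (xi w)) ^+ 2).
Proof.
move=> /andP[a0 a2] ap.
have ap2 : alpha < 2 * p by lra.
have p0 : 0 <= p by lra.
have [c3 c30 h3] := sas_clamp_moment P a0 ap2.
have sqrE (w : R) : `|w ^+ 2| `^ p = `|w| `^ (2 * p).
  by rewrite powRrM powR_mulrn// normrX.
have bsq (xi : T -> R) : measurable_fun setT xi -> bounded_mfun (fun w => clamp (xi w) ^+ 2).
  move=> mxi; under eq_fun do rewrite expr2.
  by apply: bounded_mfunM; exact: bounded_mfun_clamp.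
have [p1|p1] := ltP 1 p; last first.
  exists c3 => // xi mu hxi a x; have [mxi mu0 _ _] := hxi.
  have bb := bounded_mfun_powR p0 (bsq _ mxi).
  apply: (@le_trans _ _ (\int[P]_w (`|a| `^ p + `|x| `^ p * `|clamp (xi w) ^+ 2| `^ p))).
    apply: le_Rintegral => //.
    - apply: bounded_mfun_integrable; apply: bounded_mfun_powR => //; apply: bounded_mfunD; first exact: bounded_mfun_cst.
      exact/bounded_mfunZ/bsq.
    - by apply: bounded_mfun_integrable; apply: bounded_mfunD; [exact: bounded_mfun_cst|exact: bounded_mfunZ].
    move=> w _; rewrite -powRM// -normrM.
    apply: (@le_trans _ _ ((`|a| + `|x * clamp (xi w) ^+ 2|) `^ p)).
      by apply: ge0_ler_powR; rewrite ?nnegrE ?addr_ge0// ler_normD.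
    set u := `|a|; set v := `|_|.
    have u0 : 0 <= u by exact: normr_ge0.
    have v0 : 0 <= v by exact: normr_ge0.
    have [uv0|uv] := eqVneq (u + v) 0.
      have -> : u = 0 by lra.
      have -> : v = 0 by lra.
      by rewrite addr0 lerDl powR_ge0.
    have uvp : 0 < u + v by rewrite lt_neqAle eq_sym uv addr_ge0.
    (* Subadditivity of s^p for p <= 1: divided by u + v, both terms lie in [0, 1], where s <=
       s^p. *)
    have key s : 0 <= s <= u + v -> s / (u + v) <= (s / (u + v)) `^ p.
      move=> /andP[s0 s1]; have [->|sn0] := eqVneq s 0; first by rewrite mul0r powR_ge0.
      apply: ger1_powR => //; rewrite ler_pdivrMr// mul1r s1 andbT divr_gt0//.
      by rewrite lt_neqAle eq_sym sn0.
    have split s : 0 <= s -> s `^ p = (s / (u + v)) `^ p * (u + v) `^ p.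
      move=> s0; rewrite -powRM ?divr_ge0// ?ltW//; congr (_ `^ _).
      by rewrite mulfVK.
    rewrite (split u)// (split v)// -mulrDl -[leLHS]mul1r ler_wpM2r ?powR_ge0//.
    have ku := key u; have kv := key v.
    apply: (@le_trans _ _ (u / (u + v) + v / (u + v))).
      by rewrite -mulrDl mulfV.
    by apply: lerD; [apply: ku|apply: kv]; lra.
  rewrite RintegralD//; last 2 first.
    exact: (bounded_mfun_integrable P (bounded_mfun_cst T _)).
    by apply: bounded_mfun_integrable; exact: bounded_mfunZ.
  rewrite Rintegral_cst1 RintegralZl//; last exact: bounded_mfun_integrable.
  apply: lerD.
    by rewrite -[leLHS]mul1r ler_wpM2r ?powR_ge0// lerDl mulr_ge0.
  rewrite mulrC ler_wpM2r ?powR_ge0//; under eq_Rintegral do rewrite sqrE.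
  exact: h3.
have a4 : alpha < 4 by lra.
have [c2 c20 h2] := sas_clamp_moment P a0 a2.
have [c4 c40 h4] := sas_clamp_moment P a0 a4.
have c0 : 0 <= c4 + c2 + c3 by rewrite !addr_ge0.
have [C C0 hC] := one_step_moments P p1 c0.
exists C => // xi mu hxi; have [mxi mu0 _ _] := hxi.
apply: hC => //; first exact: bsq.
- rewrite ger0_norm; last by apply: Rintegral_ge0 => w _; exact: sqr_ge0.
  under eq_Rintegral do rewrite -real_normK ?num_real// -powR_mulrn//.
  by apply: (le_trans (h2 _ _ hxi)); rewrite ler_wpM2r//; lra.
- move=> _.
  have e4 (w : R) : `|w ^+ 2| `^ 2 = `|w| `^ 4.
    by rewrite !powR_mulrn// normrX -exprM.
  under eq_Rintegral do rewrite e4.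
  by apply: (le_trans (h4 _ _ hxi)); rewrite ler_wpM2r//; lra.
- under eq_Rintegral do rewrite sqrE.
  by apply: (le_trans (h3 _ _ hxi)); rewrite ler_wpM2r//; lra.
Qed.

(** * Independence and sums with predictable coefficients *)

(** The product rule of [mutually_independent] for bare functions, so that truncated and rescaled
    families need not be bundled as random variables. *)
Definition indep_fun (d : measure_display) (T : measurableType d)
    (R : realType) (P : probability T R) (n : nat) (Y : 'I_n -> T -> R) : Prop :=
  forall B : 'I_n -> set R, (forall i, measurable (B i)) ->
    P (\bigcap_(i in [set: 'I_n]) (Y i @^-1` B i))
      = (\prod_(i < n) P (Y i @^-1` B i))%E.

Lemma indep_fun_comp (d : measure_display) (T : measurableType d)
    (R : realType) (P : probability T R) (n : nat) (Y : 'I_n -> T -> R)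
    (h : 'I_n -> R -> R) :
  (forall i, measurable_fun [set: R] (h i)) ->
  indep_fun P Y -> indep_fun P (fun i w => h i (Y i w)).
Proof.
move=> mh iY B mB; have := iY (fun i => h i @^-1` B i); apply.
by move=> i; rewrite -[X in measurable X]setTI; exact: mh.
Qed.

(* The pi-system generating the sigma-algebra of the variables [Y i] with [i < k]. *)
Definition past (d : measure_display) (T : measurableType d)
    (R : realType) (n : nat) (Y : 'I_n -> T -> R) (k : nat) : set (set T) :=
  [set A | exists B : 'I_n -> set R,
    [/\ forall i, measurable (B i), forall i : 'I_n, (k <= i)%N -> B i = setT &
        A = \bigcap_(i in [set: 'I_n]) (Y i @^-1` B i)]].

Definition past_measurable (d : measure_display) (T : measurableType d)
    (R : realType) (n : nat) (Y : 'I_n -> T -> R) (k : nat) (f : T -> R) :=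
  @measurable_fun _ _ (g_sigma_algebraType (past Y k)) R setT f.

Lemma past_sub (d : measure_display) (T : measurableType d) (R : realType)
    (n : nat) (Y : 'I_n -> T -> R) (k : nat) :
  (forall i, measurable_fun setT (Y i)) ->
  <<s past Y k>> `<=` @measurable _ T.
Proof.
move=> mY; apply: smallest_sub; first exact: sigma_algebra_measurable.
move=> _ [B [mB _ ->]]; apply: fin_bigcap_measurable => // i _.
by rewrite -[X in measurable X]setTI; exact: mY.
Qed.

Lemma past_measurable_le (d : measure_display) (T : measurableType d)
    (R : realType) (n : nat) (Y : 'I_n -> T -> R) (k l : nat) (f : T -> R) :
  (k <= l)%N -> past_measurable Y k f -> past_measurable Y l f.
Proof.
move=> kl mf mT B mB; have := mf measurableT B mB.
apply: sub_smallest2r; first exact: smallest_sigma_algebra.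
move=> A [C [mC CT ->]]; exists C; split=> // i li.
by apply: CT; exact: leq_trans li.
Qed.

Lemma past_measurable_coord (d : measure_display) (T : measurableType d)
    (R : realType) (n : nat) (Y : 'I_n -> T -> R) (k : nat) (i : 'I_n) :
  (i < k)%N -> past_measurable Y k (Y i).
Proof.
move=> ik _ B mB; apply: sub_sigma_algebra; rewrite setTI.
exists (fun j => if j == i then B else setT); split.
- by move=> j; case: ifP.
- by move=> j kj; case: eqP => // ji; move: kj; rewrite ji leqNgt ik.
apply/seteqP; split=> w /=.
  by move=> BY j _; case: eqP => [->|].
by move=> /(_ i Logic.I); rewrite /= eqxx.
Qed.

(** As functions of [A], both sides are finite measures that agree on the pi-system [past Y k],
    which contains the whole space; uniqueness of measures extends the equality to the generated
    sigma-algebra. *)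
Lemma past_indep (d : measure_display) (T : measurableType d) (R : realType)
    (P : probability T R) (n : nat) (Y : 'I_n -> T -> R) (k : 'I_n)
    (A : set T) (C : set R) :
  (forall i, measurable_fun setT (Y i)) -> indep_fun P Y ->
  <<s past Y k>> A -> measurable C ->
  P (A `&` Y k @^-1` C) = (P A * P (Y k @^-1` C))%E.
Proof.
move=> mY iY sA mC.
have mE : measurable (Y k @^-1` C) by rewrite -[X in measurable X]setTI; exact: mY.
have fE : P (Y k @^-1` C) \is a fin_num by exact: fin_num_measure.
have r0 : 0 <= fine (P (Y k @^-1` C)) by exact: fine_ge0.
pose m1 : measure T R := mrestr P mE.
pose m2 : measure T R := mscale (NngNum r0) P.
have gT : past Y k setT.
  exists (fun=> setT); split=> //; apply/seteqP; split=> w //.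
suff : m1 A = m2 A.
  by rewrite /m1 /m2 /= /mrestr /mscale/= fineK// muleC.
apply: (g_sigma_algebra_measure_unique (past Y k) _ (fun=> setT)) => //.
- by apply: subset_trans (past_sub mY); exact: sub_sigma_algebra.
- by rewrite bigcup_const.
- move=> _ _ [B [mB BT ->]] [B' [mB' BT' ->]]; exists (fun i => B i `&` B' i); split.
  + by move=> i; exact: measurableI.
  + by move=> i ki; rewrite BT// BT'// setIT.
  + by rewrite -bigcapI; apply: eq_bigcap => // i _.
- move=> _ [B [mB BT ->]].
  rewrite /m1 /m2 /= /mrestr /mscale/= fineK//.
  (* Slot [k] of a member of the pi-system is the whole line, so [C] can be inserted there and the
     product rule applies to [B] and to [B']. *)
  pose B' i := if i == k then C else B i.
  have -> : (\bigcap_(i in [set: 'I_n]) (Y i @^-1` B i)) `&` Y k @^-1` C =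
     \bigcap_(i in [set: 'I_n]) (Y i @^-1` B' i).
    apply/seteqP; split=> w /=.
      move=> [h Cw] i _; rewrite /B'; case: eqP => [->//|_]; exact: h.
    move=> h; split; last by have := h k Logic.I; rewrite /B' /= eqxx.
    move=> i _; have := h i Logic.I; rewrite /B' /=; case: eqP => [->|//].
    by rewrite BT.
  rewrite !iY//; last by move=> i; rewrite /B'; case: ifP.
  rewrite (bigD1 k)//= [in RHS](bigD1 k)//= BT// preimage_setT probability_setT mul1e.
  rewrite {1}/B' eqxx; congr (_ * _)%E.
  by apply: eq_bigr => i /negbTE ik; rewrite /B' ik.
- by move=> _; rewrite /m1 /= /mrestr setTI ltey_eq fE.
Qed.

(** [Z] and [W] are functions of the past, so the joint law of ((Z, W), Y k) is a product. Fubini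
    then integrates the one-step inequality with [Z] and [W] in place of its constants. *)
Lemma one_step_indep (d : measure_display) (T : measurableType d)
    (R : realType) (P : probability T R) (n : nat) (Y : 'I_n -> T -> R)
    (k : 'I_n) (Z W : T -> R) (p C mu : R) :
  0 <= p -> 0 <= C -> 0 <= mu ->
  (forall i, bounded_mfun (Y i)) -> indep_fun P Y ->
  past_measurable Y k Z -> past_measurable Y k W -> bounded_mfun Z -> bounded_mfun W ->
  one_step P p C mu (Y k) ->
  \int[P]_w (`|Z w + W w * Y k w| `^ p)
    <= (1 + C * mu) * \int[P]_w (`|Z w| `^ p) + C * mu * \int[P]_w (`|W w| `^ p).
Proof.
move=> p0 C0 mu0 bY iY pZ pW bZ bW os.
have mY i : measurable_fun setT (Y i) by have [] := bY i.
have mU : measurable_fun setT (fun w => (Z w, W w)).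
  by apply/measurable_fun_pairP; split; [have [] := bZ|have [] := bW].
have mUV : measurable_fun setT (fun w => ((Z w, W w), Y k w)).
  by apply/measurable_fun_pairP; split; [exact: mU|exact: mY].
pose U : {mfun T >-> (R * R)%type} := mfun_Sub (mem_set mU).
pose V : {mfun T >-> R} := mfun_Sub (mem_set (mY k)).
pose UV : {mfun T >-> ((R * R) * R)%type} := mfun_Sub (mem_set mUV).
pose g (z : (R * R) * R) : \bar R := (`|z.1.1 + z.1.2 * z.2| `^ p)%:E.
have mg : measurable_fun setT g.
  apply/measurable_EFinP; apply: (measurableT_comp (measurable_powR p)).
  apply: measurableT_comp => //; apply: measurable_funD.
    by apply: measurableT_comp; [exact: measurable_fst|exact: measurable_fst].
  apply: measurable_funM; last exact: measurable_snd.
  by apply: measurableT_comp; [exact: measurable_snd|exact: measurable_fst].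
have g0 z : (0 <= g z)%E by rewrite lee_fin powR_ge0.
have prodE A : measurable A ->
    (distribution P U \x distribution P V)%E A = distribution P UV A.
  move=> mA; apply: (product_measure_unique (m' := distribution P UV)) => // B D mB mD.
  change (P ((fun w => ((Z w, W w), Y k w)) @^-1` (B `*` D)) =
    P ((fun w => (Z w, W w)) @^-1` B) * P (Y k @^-1` D))%E.
  rewrite -past_indep//; last first.
    have h1 := pZ measurableT; have h2 := pW measurableT.
    have : @measurable_fun _ _ (g_sigma_algebraType (past Y k)) _ setT
       (fun w => (Z w, W w)).
      by apply/measurable_fun_pairP; split.
    by move=> /(_ measurableT B mB); rewrite setTI.
have bbp : bounded_mfun (fun w => `|Z w + W w * Y k w| `^ p).
  by apply: bounded_mfun_powR => //; apply: bounded_mfunD => //; exact: bounded_mfunM.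
have bZp := bounded_mfun_powR p0 bZ; have bWp := bounded_mfun_powR p0 bW.
have Cm : 0 <= C * mu by rewrite mulr_ge0.
rewrite -lee_fin -EFin_Rintegral_bounded_mfun//.
have -> : (\int[P]_w (`|Z w + W w * Y k w| `^ p)%:E =
    \int[distribution P UV]_z g z)%E.
  by rewrite ge0_integral_pushforward.
rewrite (eq_measure_integral (distribution P U \x distribution P V)%E); last first.
  by move=> A mA _; rewrite /= -prodE.
rewrite fubini_tonelli1//.
pose b (z : R * R) := (1 + C * mu) * `|z.1| `^ p + C * mu * `|z.2| `^ p.
apply: (@le_trans _ _ (\int[distribution P U]_z (b z)%:E)%E).
  apply: ge0_le_integral => //.
  - by move=> z _; apply: integral_ge0.
  - exact: measurable_fun_fubini_tonelli_F.
  - apply/measurable_EFinP; apply: measurable_funD; apply: measurable_funM => //;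
    (apply: (measurableT_comp (measurable_powR p)); apply: measurableT_comp => //).
  - move=> [a x] _; rewrite /fubini_F /g /=.
    have -> : (\int[distribution P V]_y (`|(a, x, y).1.1 + (a, x, y).1.2 * (a, x, y).2| `^ p)%:E =
       \int[P]_w (`|a + x * Y k w| `^ p)%:E)%E.
      rewrite ge0_integral_pushforward//.
        apply/measurable_EFinP; apply: (measurableT_comp (measurable_powR p)).
        apply: measurableT_comp => //; apply: measurable_funD => //.
        exact: (measurable_funM (measurable_cst x) (@measurable_id _ R setT)).
    rewrite EFin_Rintegral_bounded_mfun; first by rewrite lee_fin; exact: os.
    by apply: bounded_mfun_powR => //; apply: bounded_mfunD; [exact: bounded_mfun_cst|exact: bounded_mfunZ].
rewrite ge0_integral_pushforward//; last 2 first.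
  apply/measurable_EFinP; apply: measurable_funD; apply: measurable_funM => //;
    (apply: (measurableT_comp (measurable_powR p)); apply: measurableT_comp => //).
  move=> z _; rewrite lee_fin /b addr_ge0 ?mulr_ge0 ?powR_ge0// addr_ge0//.
rewrite /= preimage_setT EFin_Rintegral_bounded_mfun; last first.
  by apply: bounded_mfunD; exact: bounded_mfunZ.
rewrite lee_fin RintegralD//; last 2 first.
  by apply: bounded_mfun_integrable; exact: bounded_mfunZ.
  by apply: bounded_mfun_integrable; exact: bounded_mfunZ.
by rewrite !RintegralZl//; exact: bounded_mfun_integrable.
Qed.

(** A discrete Gronwall argument: the term of index i multiplies the moment of the partial sum by at
    most 1 + C mu_i <= exp(C mu_i) and adds C mu_i E|W_i|^p. The factor depends on the total mass of
    [mu] alone, not on the number of terms. *)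
Lemma predictable_moment (d : measure_display) (T : measurableType d)
    (R : realType) (P : probability T R) (n : nat) (Y W : 'I_n -> T -> R)
    (mu : 'I_n -> R) (p C : R) :
  0 < p -> 0 <= C -> (forall i, 0 <= mu i) ->
  (forall i, bounded_mfun (Y i)) -> indep_fun P Y ->
  (forall i : 'I_n, past_measurable Y i (W i)) -> (forall i, bounded_mfun (W i)) ->
  (forall i, one_step P p C (mu i) (Y i)) ->
  \int[P]_w (`|\sum_(i < n) W i w * Y i w| `^ p)
    <= expR (C * \sum_(i < n) mu i) * (C * \sum_(i < n) mu i * \int[P]_w (`|W i w| `^ p)).
Proof.
move=> p0 C0 mu0 bY iY pW bW os.
pose S k w := \sum_(i < n | (i < k)%N) W i w * Y i w.
pose s k := \sum_(i < n | (i < k)%N) mu i.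
pose t k := \sum_(i < n | (i < k)%N) mu i * \int[P]_w (`|W i w| `^ p).
have I0 i : 0 <= \int[P]_w (`|W i w| `^ p).
  by apply: Rintegral_ge0 => w _; exact: powR_ge0.
have bS k : bounded_mfun (S k).
  rewrite /S; under eq_fun do rewrite big_mkcond/=.
  by apply: bounded_mfun_sum => i; case: (i < k)%N; [exact: bounded_mfunM|exact: bounded_mfun_cst].
have pS k : past_measurable Y k (S k).
  rewrite /S /past_measurable; under eq_fun do rewrite big_mkcond/=.
  apply: measurable_sum => i; case: ltnP => ik; last exact: measurable_cst.
  apply: measurable_funM; last exact: past_measurable_coord.
  by apply: past_measurable_le (pW i); exact: ltnW.
have recl (F : 'I_n -> R) (k : 'I_n) :
    \sum_(i < n | (i < k.+1)%N) F i = \sum_(i < n | (i < k)%N) F i + F k.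
  rewrite (bigD1 k)//= addrC; congr (_ + _); apply: eq_bigl => i.
  by rewrite ltnS ltn_neqAle andbC -(inj_eq val_inj).
have main k : (k <= n)%N -> \int[P]_w (`|S k w| `^ p) <= expR (C * s k) * (C * t k).
  elim: k => [|k IH] kn.
    rewrite /S /t; under eq_Rintegral do rewrite big_pred0_eq normr0 powR0 ?gt_eqF//.
    by rewrite big_pred0_eq !mulr0 Rintegral_cst1.
  pose k' := Ordinal kn.
  have -> : \int[P]_w (`|S k.+1 w| `^ p) = \int[P]_w (`|S k w + W k' w * Y k' w| `^ p).
    by apply: eq_Rintegral => w _; rewrite /S (recl _ k').
  apply: (le_trans (one_step_indep (ltW p0) C0 (mu0 k') bY iY (pS k') (pW k') _ _ (os k'))) => //.
  rewrite /s /t !(recl _ k').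
  set e := expR (C * _).
  have IH' := IH (ltnW kn).
  have sk0 : 0 <= s k by apply: sumr_ge0.
  have tk0 : 0 <= t k by apply: sumr_ge0 => i _; rewrite mulr_ge0.
  have cm : 0 <= C * mu k' by rewrite mulr_ge0.
  have e1 : 1 + C * mu k' <= expR (C * mu k') by exact: expR_ge1Dx.
  have e2 : 1 <= e.
    apply: le_trans (expR_ge1Dx _); rewrite lerDl mulr_ge0// addr_ge0//.
  rewrite mulrDr mulrDr; apply: lerD.
    rewrite /e mulrDr expRD -mulrA mulrCA; apply: ler_pM => //.
    - by rewrite addr_ge0.
    - by apply: Rintegral_ge0 => w _; exact: powR_ge0.
  by rewrite (mulrA C (mu k')) -[leLHS]mul1r ler_wpM2r// mulr_ge0.
have := main n (leqnn n).
have tr (F : 'I_n -> R) : \sum_(i < n | (i < n)%N) F i = \sum_(i < n) F i.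
  by apply: eq_bigl => i; rewrite ltn_ord.
rewrite /s /t !tr; apply: le_trans; rewrite le_eqVlt; apply/orP; left; apply/eqP.
by apply: eq_Rintegral => w _; rewrite /S tr.
Qed.

(** * Tails of linear and bilinear forms in truncated variables *)

Lemma markov_powR (d : measure_display) (T : measurableType d)
    (R : realType) (P : probability T R) (f : T -> R) (r p : R) :
  0 < r -> 0 <= p -> bounded_mfun f ->
  (P [set w | (r <= `|f w|)%R] <= (r `^ (- p) * \int[P]_w (`|f w| `^ p))%:E)%E.
Proof.
move=> r0 p0 bf; set A := [set w | _].
have mA : measurable A by apply: measurable_norm_ge; have [] := bf.
have rp : 0 < r `^ p by exact: powR_gt0.
have bp := bounded_mfun_powR p0 bf.
rewrite -[X in P X]setIT -integral_indic//.
have bA : bounded_mfun (fun w => \1_A w : R).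
  split; first exact: measurable_indic.
  by exists 1 => w; rewrite indicE; case: (_ \in _); rewrite ?normr1 ?normr0.
rewrite EFin_Rintegral_bounded_mfun// lee_fin -RintegralZl//; last exact: bounded_mfun_integrable.
apply: le_Rintegral => //; first exact: bounded_mfun_integrable.
  by apply: bounded_mfun_integrable; exact: bounded_mfunZ.
move=> w _; rewrite indicE; case: (boolP (w \in A)) => wA; last first.
  by rewrite mulr_ge0// powR_ge0.
move: wA; rewrite inE /A /= => h.
rewrite powRN mulrC ler_pdivlMr// mul1r; apply: ge0_ler_powR; rewrite ?nnegrE//.
exact: ltW.
Qed.

Lemma measure_exists_le (d : measure_display) (T : measurableType d)
    (R : realType) (P : {measure set T -> \bar R}) (I : eqType) (s : seq I)
    (A : I -> set T) : (forall i, measurable (A i)) ->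
  (P [set w | exists2 i, i \in s & A i w] <= \sum_(i <- s) P (A i))%E.
Proof.
move=> mA; have E (r : seq I) : [set w | exists2 i, i \in r & A i w] =
    \big[setU/set0]_(i <- r) A i.
  elim: r => [|i r IH].
    by rewrite big_nil; apply/seteqP; split => w //= [].
  rewrite big_cons -IH; apply/seteqP; split => w /=.
    by move=> [j]; rewrite inE => /orP[/eqP ->|jr] Aw; [left|right; exists j].
  move=> [Aw|[j jr Aw]]; first by exists i; rewrite ?mem_head.
  by exists j => //; rewrite inE jr orbT.
rewrite E; elim: s => [|i s IH]; first by rewrite !big_nil measure0.
rewrite !big_cons; apply: le_trans (measureU2 _ _ _) _ => //.
  exact: bigsetU_measurable.
by rewrite leeD2l.
Qed.

(** Sorting the off-diagonal terms by the larger of the two indices makes each half a sum whose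
    coefficients depend only on earlier variables. *)
Lemma mul_sum_split (R : comNzRingType) (n : nat) (a b : 'I_n -> R) :
  (\sum_i a i) * (\sum_i b i) = \sum_i a i * b i
    + \sum_(i < n) (\sum_(j < n | (j < i)%N) a j) * b i
    + \sum_(i < n) (\sum_(j < n | (j < i)%N) b j) * a i.
Proof.
rewrite big_distrlr/=.
have -> : \sum_(i < n) (\sum_(j < n | (j < i)%N) a j) * b i =
    \sum_(i < n) \sum_(j < n | (i < j)%N) a i * b j.
  under eq_bigr do rewrite mulr_suml big_mkcond/=.
  by rewrite exchange_big/=; apply: eq_bigr => i _; rewrite [RHS]big_mkcond.
have -> : \sum_(i < n) (\sum_(j < n | (j < i)%N) b j) * a i =
    \sum_(i < n) \sum_(j < n | (j < i)%N) a i * b j.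
  apply: eq_bigr => i _; rewrite mulr_suml.
  by apply: eq_bigr => j _; rewrite mulrC.
rewrite -!big_split/=; apply: eq_bigr => i _.
rewrite (bigD1 i)//= -addrA; congr (_ + _).
rewrite (bigID (fun j : 'I_n => (i < j)%N))/=; congr (_ + _); apply: eq_bigl => j.
  by rewrite -(inj_eq val_inj) /=; case: ltngtP.
by rewrite -(inj_eq val_inj) /=; case: ltngtP.
Qed.

(** The cutoff [k] is there because the partial sums themselves serve as predictable coefficients of
    the off-diagonal part. *)
Lemma linear_moment (d : measure_display) (T : measurableType d)
    (R : realType) (P : probability T R) (n : nat) (Y : 'I_n -> T -> R)
    (mu x : 'I_n -> R) (p C : R) (k : nat) :
  0 < p -> 0 <= C -> (forall i, 0 <= mu i) ->
  (forall i, bounded_mfun (Y i)) -> indep_fun P Y ->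
  (forall i, one_step P p C (mu i) (Y i)) ->
  \int[P]_w (`|\sum_(i < n | (i < k)%N) x i * Y i w| `^ p)
    <= expR (C * \sum_(i < n) mu i) * (C * \sum_(i < n) mu i * `|x i| `^ p).
Proof.
move=> p0 C0 mu0 bY iY os.
pose W (i : 'I_n) (w : T) := if (i < k)%N then x i else 0.
have bW i : bounded_mfun (W i) by exact: bounded_mfun_cst.
have pW (i : 'I_n) : past_measurable Y i (W i) by exact: measurable_cst.
have -> : \int[P]_w (`|\sum_(i < n | (i < k)%N) x i * Y i w| `^ p) =
    \int[P]_w (`|\sum_(i < n) W i w * Y i w| `^ p).
  apply: eq_Rintegral => w _; rewrite big_mkcond/=; congr (`|_| `^ _).
  by apply: eq_bigr => i _; rewrite /W; case: ifP; rewrite ?mul0r.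
apply: (le_trans (predictable_moment p0 C0 mu0 bY iY pW bW os)).
rewrite ler_pM2l ?expR_gt0// ler_wpM2l//; apply: ler_sum => i _.
rewrite ler_wpM2l// /W Rintegral_cst1; case: ifP => // _.
by rewrite normr0 powR0 ?gt_eqF ?powR_ge0.
Qed.

(** The moment bound is used twice: for the outer sum, with partial sums of the [x] form as
    coefficients, and for these partial sums, whose moments are bounded uniformly in the outer
    index. Hence the squared constant and the product of two sums. *)
Lemma offdiagonal_moment (d : measure_display) (T : measurableType d)
    (R : realType) (P : probability T R) (n : nat) (Y : 'I_n -> T -> R)
    (mu x y : 'I_n -> R) (p C : R) :
  0 < p -> 0 <= C -> (forall i, 0 <= mu i) ->
  (forall i, bounded_mfun (Y i)) -> indep_fun P Y ->
  (forall i, one_step P p C (mu i) (Y i)) ->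
  \int[P]_w (`|\sum_(i < n)
      (\sum_(j < n | (j < i)%N) x j * Y j w) * (y i * Y i w)| `^ p)
    <= (expR (C * \sum_(i < n) mu i) * C) ^+ 2 *
       ((\sum_(i < n) mu i * `|x i| `^ p) * (\sum_(i < n) mu i * `|y i| `^ p)).
Proof.
move=> p0 C0 mu0 bY iY os.
pose S (i : 'I_n) w := \sum_(j < n | (j < i)%N) x j * Y j w.
pose W (i : 'I_n) w := y i * S i w.
have bS i : bounded_mfun (S i).
  rewrite /S; under eq_fun do rewrite big_mkcond/=.
  by apply: bounded_mfun_sum => j; case: (j < i)%N; [exact: bounded_mfunZ|exact: bounded_mfun_cst].
have bW i : bounded_mfun (W i) by exact: bounded_mfunZ.
have pW (i : 'I_n) : past_measurable Y i (W i).
  apply: measurable_funM; first exact: measurable_cst.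
  rewrite /S; under eq_fun do rewrite big_mkcond/=.
  apply: measurable_sum => j; case: ltnP => ij; last exact: measurable_cst.
  apply: measurable_funM; first exact: measurable_cst.
  exact: past_measurable_coord.
have -> : \int[P]_w (`|\sum_(i < n)
      (\sum_(j < n | (j < i)%N) x j * Y j w) * (y i * Y i w)| `^ p) =
    \int[P]_w (`|\sum_(i < n) W i w * Y i w| `^ p).
  apply: eq_Rintegral => w _; congr (`|_| `^ _); apply: eq_bigr => i _.
  by rewrite /W /S; ring.
apply: (le_trans (predictable_moment p0 C0 mu0 bY iY pW bW os)).
set E := expR _; set X := \sum_(i < n) mu i * `|x i| `^ p.
have -> : (E * C) ^+ 2 * (X * (\sum_(i < n) mu i * `|y i| `^ p)) =
  E * (C * ((E * (C * X)) * \sum_(i < n) mu i * `|y i| `^ p)) by ring.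
rewrite ler_pM2l ?expR_gt0// ler_wpM2l// mulr_sumr; apply: ler_sum => i _.
rewrite mulrCA ler_wpM2l//.
have -> : \int[P]_w (`|W i w| `^ p) = `|y i| `^ p * \int[P]_w (`|S i w| `^ p).
  rewrite -RintegralZl//; last by apply: bounded_mfun_integrable; apply: bounded_mfun_powR => //; exact: ltW.
  by apply: eq_Rintegral => w _; rewrite normrM powRM.
rewrite mulrC ler_wpM2r ?powR_ge0//; exact: linear_moment.
Qed.

Lemma indep_fun_measurable_comp (d : measure_display) (T : measurableType d)
    (R : realType) (P : probability T R) (n : nat) (Y : 'I_n -> T -> R)
    (h : R -> R) :
  measurable_fun [set: R] h ->
  indep_fun P Y -> indep_fun P (fun i w => h (Y i w)).
Proof. by move=> mh; apply: (indep_fun_comp (h := fun=> h)). Qed.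

Lemma measurable_clamp (R : realType) : measurable_fun [set: R] (@clamp R).
Proof. by have [] := bounded_mfun_clamp (@measurable_id _ R setT). Qed.

(** If both forms exceed l, their product exceeds l^2 and one of its three parts reaches l^2 / 3.
    Markov's inequality is used with order [p2] for the diagonal part, a linear form in the squares,
    and with order [p1] for the two others. [L] enters through the exponential factors, so [C] is
    independent of the number of variables. *)
Lemma joint_tail (d : measure_display) (T : measurableType d)
    (R : realType) (P : probability T R) (alpha p1 p2 L : R) :
  0 < alpha < 2 -> alpha < p1 -> 1 < p1 -> alpha / 2 < p2 -> 0 <= L ->
  exists2 C : R, 0 <= C & forall (n : nat) (xi : 'I_n -> T -> R)
      (mu x y : 'I_n -> R) (l : R),
    (forall i, sas_var P alpha (xi i) (mu i)) -> indep_fun P xi ->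
    \sum_i mu i <= L -> 0 < l ->
    (P [set w | (l < `|(\sum_i x i * clamp (xi i w))|)%R /\
                (l < `|(\sum_i y i * clamp (xi i w))|)%R]
     <= (C * (l `^ (- (2 * p1)) * ((\sum_i mu i * `|x i| `^ p1) *
                                    (\sum_i mu i * `|y i| `^ p1))
            + l `^ (- (2 * p2)) * \sum_i mu i * `|x i * y i| `^ p2))%:E)%E.
Proof.
move=> a02 ap1 p11 ap2 L0; have /andP[a0 a2] := a02.
have p10 : 0 < p1 by lra.
have p20 : 0 < p2 by lra.
have [c1 c10 h1] := one_step_clamp P a02 ap1 p11.
have [c2 c20 h2] := one_step_clamp_sqr P a02 ap2.
pose C1 := 3 `^ p1 * (2 * (expR (c1 * L) * c1) ^+ 2).
pose C2 := 3 `^ p2 * (expR (c2 * L) * c2).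
have C10 : 0 <= C1 by rewrite !mulr_ge0 ?powR_ge0 ?exprn_ge0 ?mulr_ge0 ?expR_ge0.
have C20 : 0 <= C2 by rewrite !mulr_ge0 ?powR_ge0 ?expR_ge0.
exists (C1 + C2); first exact: addr_ge0.
move=> n xi mu x y l hxi ixi muL l0.
have mu0 i : 0 <= mu i by have [] := hxi i.
have mxi i : measurable_fun setT (xi i) by have [] := hxi i.
pose Y i w := clamp (xi i w); pose Y2 i w := clamp (xi i w) ^+ 2.
have bY i : bounded_mfun (Y i) by exact: bounded_mfun_clamp.
have bY2 i : bounded_mfun (Y2 i).
  have -> : Y2 i = (fun w => Y i w * Y i w) by apply/funext => w; rewrite /Y2 expr2.
  exact: bounded_mfunM.
have iY : indep_fun P Y.
  by apply: indep_fun_measurable_comp ixi; exact: measurable_clamp.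
have iY2 : indep_fun P Y2.
  apply: (indep_fun_measurable_comp (h := fun z => z ^+ 2)) iY.
  exact: exprn_measurable.
have os1 i : one_step P p1 c1 (mu i) (Y i) by exact: h1.
have os2 i : one_step P p2 c2 (mu i) (Y2 i) by exact: h2.
pose X1 := \sum_i mu i * `|x i| `^ p1; pose X2 := \sum_i mu i * `|y i| `^ p1.
pose X3 := \sum_i mu i * `|x i * y i| `^ p2.
have X10 : 0 <= X1 by apply: sumr_ge0 => i _; rewrite mulr_ge0 ?powR_ge0.
have X20 : 0 <= X2 by apply: sumr_ge0 => i _; rewrite mulr_ge0 ?powR_ge0.
have X30 : 0 <= X3 by apply: sumr_ge0 => i _; rewrite mulr_ge0 ?powR_ge0.
rewrite -/X1 -/X2 -/X3.
pose D w := \sum_i (x i * y i) * Y2 i w.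
pose O1 w := \sum_(i < n) (\sum_(j < n | (j < i)%N) x j * Y j w) * (y i * Y i w).
pose O2 w := \sum_(i < n) (\sum_(j < n | (j < i)%N) y j * Y j w) * (x i * Y i w).
have bD : bounded_mfun D by apply: bounded_mfun_sum => i; exact: bounded_mfunZ.
have bO (u v : 'I_n -> R) : bounded_mfun (fun w =>
    \sum_(i < n) (\sum_(j < n | (j < i)%N) u j * Y j w) * (v i * Y i w)).
  apply: bounded_mfun_sum => i; apply: bounded_mfunM; last exact: bounded_mfunZ.
  under eq_fun do rewrite big_mkcond/=.
  by apply: bounded_mfun_sum => j; case: (j < i)%N; [exact: bounded_mfunZ|exact: bounded_mfun_cst].
have bO1 : bounded_mfun O1 by exact: bO.
have bO2 : bounded_mfun O2 by exact: bO.
pose r := l ^+ 2 / 3.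
have r0 : 0 < r by rewrite divr_gt0// exprn_gt0.
have rE p : r `^ (- p) = 3 `^ p * l `^ (- (2 * p)).
  rewrite /r powRM ?sqr_ge0 ?invr_ge0// mulrC -powR_inv1//.
  rewrite -powR_mulrn ?ltW// -!powRrM mulN1r opprK; congr (_ * _ `^ _); lra.
have mA (f : T -> R) : bounded_mfun f -> measurable [set w | r <= `|f w|].
  by move=> [mf _]; exact: measurable_norm_ge.
have mlt (f : T -> R) : measurable_fun setT f -> measurable [set w | l < `|f w|].
  move=> mf; rewrite -[X in measurable X]setTI.
  apply: (@measurable_fun_ltr _ _ _ setT (fun=> l) (fun w => `|f w|)) => //.
  exact: measurableT_comp.
have bS (u : 'I_n -> R) : bounded_mfun (fun w => \sum_i u i * clamp (xi i w)).
  by apply: bounded_mfun_sum => i; exact: (bounded_mfunZ _ (bY i)).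
apply: (@le_trans _ _ (P ([set w | r <= `|D w|] `|` ([set w | r <= `|O1 w|] `|`
    [set w | r <= `|O2 w|])))).
  apply: le_measure; rewrite ?inE.
  - by apply: measurableI; apply: mlt; have [] := bS x; have [] := bS y.
  - by apply: measurableU; [|apply: measurableU]; exact: mA.
  move=> w /= [lx ly].
  have E : (\sum_i x i * clamp (xi i w)) * (\sum_i y i * clamp (xi i w)) =
      D w + O1 w + O2 w.
    rewrite mul_sum_split; congr (_ + _ + _).
    by apply: eq_bigr => i _; rewrite /Y2; ring.
  have : l ^+ 2 < `|D w + O1 w + O2 w|.
    by rewrite -E normrM expr2; apply: ltr_pM => //; exact: ltW.
  move=> h; apply: contrapT => /not_orP[/negP]; rewrite -ltNge => hD.
  move=> /not_orP[/negP + /negP]; rewrite -!ltNge => hO1 hO2.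
  have := ler_normD (D w + O1 w) (O2 w); have := ler_normD (D w) (O1 w).
  move: h hD hO1 hO2; rewrite /r; lra.
apply: le_trans (measureU2 _ _ _) _; [exact: mA|by apply: measurableU; exact: mA|].
apply: (@le_trans _ _ (P [set w | (r <= `|D w|)%R] +
   (P [set w | (r <= `|O1 w|)%R] + P [set w | (r <= `|O2 w|)%R]))%E).
  by rewrite leeD2l//; apply: measureU2; exact: mA.
have eL c : 0 <= c -> expR (c * \sum_i mu i) <= expR (c * L).
  by move=> c0; rewrite ler_expR ler_wpM2l.
have hD : (P [set w | (r <= `|D w|)%R] <= (C2 * (l `^ (- (2 * p2)) * X3))%:E)%E.
  apply: (le_trans (markov_powR P r0 (ltW p20) bD)).
  rewrite lee_fin rE -mulrA /C2 -mulrA ler_wpM2l ?powR_ge0//.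
  rewrite [leRHS]mulrCA ler_wpM2l ?powR_ge0//.
  have -> : \int[P]_w (`|D w| `^ p2) =
     \int[P]_w (`|\sum_(i < n | (i < n)%N) (x i * y i) * Y2 i w| `^ p2).
    by apply: eq_Rintegral => w _; rewrite /D; congr (`|_| `^ _); apply: eq_bigl => i; rewrite ltn_ord.
  apply: (le_trans (linear_moment _ n p20 c20 mu0 bY2 iY2 os2)).
  rewrite mulrA ler_wpM2r// ler_wpM2r//; exact: eL.
have hO (u v : 'I_n -> R) : (P [set w | (r <=
   `|(\sum_(i < n) (\sum_(j < n | (j < i)%N) u j * Y j w) * (v i * Y i w))|)%R]
   <= (C1 / 2 * (l `^ (- (2 * p1)) * ((\sum_i mu i * `|u i| `^ p1) *
      (\sum_i mu i * `|v i| `^ p1))))%:E)%E.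
  apply: (le_trans (markov_powR P r0 (ltW p10) (bO u v))).
  rewrite lee_fin rE.
  have -> : C1 / 2 = 3 `^ p1 * (expR (c1 * L) * c1) ^+ 2 by rewrite /C1; field.
  rewrite -mulrA -[leRHS]mulrA ler_wpM2l ?powR_ge0//.
  rewrite [leRHS]mulrCA ler_wpM2l ?powR_ge0//.
  apply: (le_trans (offdiagonal_moment _ _ p10 c10 mu0 bY iY os1)).
  apply: ler_wpM2r.
    by apply: mulr_ge0; apply: sumr_ge0 => i _; rewrite mulr_ge0 ?powR_ge0.
  rewrite lerXn2r ?nnegrE ?mulr_ge0 ?expR_ge0//.
  by rewrite ler_wpM2r//; exact: eL.
apply: (le_trans (leeD hD (leeD (hO x y) (hO y x)))).
rewrite -/X1 -/X2 -!EFinD lee_fin (mulrC X2).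
set a := _ * (X1 * X2); set b := _ * X3.
have a'0 : 0 <= a by rewrite !mulr_ge0 ?powR_ge0.
have b'0 : 0 <= b by rewrite !mulr_ge0 ?powR_ge0.
have : 0 <= C1 * b by rewrite mulr_ge0.
have : 0 <= C2 * a by rewrite mulr_ge0.
lra.
Qed.

(** After scaling by u, the sum differs from its truncated version only if some term reaches 1, an
    event bounded by the individual tails; the truncated sum is bounded in second moment. The total
    mass being at most 1 keeps the exponential factor below exp(c). *)
Lemma linear_tail (d : measure_display) (T : measurableType d)
    (R : realType) (P : probability T R) (alpha : R) :
  0 < alpha < 2 ->
  exists2 C : R, 0 <= C & forall (n : nat) (xi : 'I_n -> T -> R)
      (mu x : 'I_n -> R) (u : R),
    (forall i, sas_var P alpha (xi i) (mu i)) -> indep_fun P xi -> 0 < u ->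
    \sum_i `|x i / u| `^ alpha * mu i <= 1 ->
    (P [set w | (u <= `|(\sum_i x i * xi i w)|)%R]
     <= (C * \sum_i `|x i / u| `^ alpha * mu i)%:E)%E.
Proof.
move=> a02; have /andP[a0 a2] := a02.
have [c c0 h] := one_step_clamp P a02 a2 (ltr1n R 2).
pose C := 2 * 2 `^ alpha + expR c * c.
have C'0 : 0 <= 2 * 2 `^ alpha :> R by rewrite mulr_ge0 ?powR_ge0.
have C''0 : 0 <= expR c * c by rewrite mulr_ge0 ?expR_ge0.
exists C; first by rewrite addr_ge0.
move=> n xi mu x u hxi ixi u0 s1.
pose z i w := x i / u * xi i w; pose nu i := `|x i / u| `^ alpha * mu i.
have hz i : sas_var P alpha (z i) (nu i) by exact: sas_varZ.
have mz i : measurable_fun setT (z i) by have [] := hz i.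
have nu0 i : 0 <= nu i by have [] := hz i.
have iz : indep_fun P z.
  apply: (indep_fun_comp (h := fun i v => x i / u * v)) ixi => i.
  exact: (measurable_funM (measurable_cst _) (@measurable_id _ R setT)).
pose Y i w := clamp (z i w).
have bY i : bounded_mfun (Y i) by exact: bounded_mfun_clamp.
have iY : indep_fun P Y.
  by apply: indep_fun_measurable_comp iz; exact: measurable_clamp.
have bS : bounded_mfun (fun w => \sum_i 1 * Y i w) by apply: bounded_mfun_sum => i; exact: bounded_mfunZ.
pose A i := [set w | 1 <= `|z i w|].
have mA i : measurable (A i) by exact: measurable_norm_ge.
pose B := [set w | exists2 i, i \in index_enum 'I_n & A i w].
have mB : measurable B.
  rewrite (_ : B = \bigcup_(i in [set: 'I_n]) A i); last first.
    apply/seteqP; split=> w /=; first by move=> [i _ Aw]; exists i.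
    by move=> [i _ Aw]; exists i => //; rewrite mem_index_enum.
  by apply: fin_bigcup_measurable.
have mC : measurable [set w | 1 <= `|(\sum_i 1 * Y i w)|].
  by apply: measurable_norm_ge; have [] := bS.
apply: (@le_trans _ _ (P (B `|` [set w | 1 <= `|(\sum_i 1 * Y i w)|]))).
  apply: le_measure; rewrite ?inE.
  - apply: measurable_norm_ge; apply: measurable_sum => i.
    by apply: measurable_funM => //; have [] := hxi i.
  - exact: measurableU.
  move=> w /= hw; have [wB|wB] := pselect (B w); [by left|right].
  have E : \sum_i 1 * Y i w = (\sum_i x i * xi i w) / u.
    rewrite mulr_suml; apply: eq_bigr => i _; rewrite mul1r /Y.
    have zi : `|z i w| <= 1.
      apply: contrapT => /negP; rewrite -ltNge => h1; apply: wB.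
      by exists i; rewrite ?mem_index_enum//; exact: ltW.
    by rewrite (clampE zi) /z mulrAC.
  by rewrite E normrM normfV (gtr0_norm u0) ler_pdivlMr// mul1r.
apply: le_trans (measureU2 _ mB mC) _.
rewrite /C mulrDl EFinD; apply: leeD.
  apply: (le_trans (measure_exists_le _ _ mA)).
  rewrite mulr_sumr -sumEFin; apply: lee_sum => i _.
  by have := sas_tail a0 (hz i) ltr01; rewrite divr1.
have r1 : (0 : R) < 1 by [].
apply: (le_trans (markov_powR P r1 (ler0n _ 2) bS)).
rewrite powR1 mul1r lee_fin.
have -> : \int[P]_w (`|(\sum_i 1 * Y i w)| `^ 2) =
    \int[P]_w (`|\sum_(i < n | (i < n)%N) 1 * Y i w| `^ 2).
  by apply: eq_Rintegral => w _; congr (`|_| `^ _); apply: eq_bigl => i; rewrite ltn_ord.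
apply: (le_trans (linear_moment _ n _ c0 nu0 bY iY (fun i => h _ _ (hz i)))) => //.
have -> : \sum_i nu i * `|1| `^ 2 = \sum_i nu i.
  by apply: eq_bigr => i _; rewrite normr1 powR1 mulr1.
rewrite mulrA ler_wpM2r//; first exact: sumr_ge0.
by rewrite ler_wpM2r// ler_expR -[leRHS]mulr1 ler_wpM2l.
Qed.

(** * The random measure on finite partitions *)

Lemma sas_var_measure (d d' : measure_display) (Omega : measurableType d)
    (S : measurableType d') (R : realType) (P : probability Omega R)
    (alpha : R) (m : {finite_measure set S -> \bar R})
    (M : set S -> {RV P >-> R}) (A : set S) :
  is_sas_random_measure alpha m M -> measurable A ->
  sas_var P alpha (M A) (fine (m A)).
Proof.
move=> hM mA; split.
- exact: measurable_funPT.
- by rewrite fine_ge0.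
- move=> t; have /(congr1 (@complex.Re R))/= <- := sas_char_fun hM t mA.
  by [].
- move=> t; have /(congr1 (@complex.Im R))/= -> := sas_char_fun hM t mA.
  by [].
Qed.

(** A series with constant term converges only if the term is 0; sigma-additivity is applied to a
    sequence of empty sets. *)
Lemma ae_measure_set0 (d d' : measure_display) (Omega : measurableType d)
    (S : measurableType d') (R : realType) (P : probability Omega R)
    (alpha : R) (m : {finite_measure set S -> \bar R})
    (M : set S -> {RV P >-> R}) :
  is_sas_random_measure alpha m M -> {ae P, forall w, M set0 w = 0}.
Proof.
move=> hM.
have t0 : trivIset [set: nat] (fun=> set0 : set S).
  by apply/trivIsetP => i j _ _ _; rewrite set0I.
have := sas_sigma_additive hM (fun k : nat => @measurable0 _ S) t0.
apply: filterS => w h; rewrite bigcup0// in h.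
have /cvg_series_cvg_0 h0 : cvgn (series (fun _ : nat => M set0 w)).
  by apply/cvg_ex; exists (M set0 w).
by have := cvg_unique _ h0 (cvg_cst (M set0 w)) => <-.
Qed.

(** Finite additivity from sigma-additivity: the index type is enumerated, and the sets excluded by
    [Q] as well as all later ones are replaced by the empty set, whose measure vanishes almost
    surely. *)
Lemma ae_measure_bigcup (d d' : measure_display) (Omega : measurableType d)
    (S : measurableType d') (R : realType) (P : probability Omega R)
    (alpha : R) (m : {finite_measure set S -> \bar R})
    (M : set S -> {RV P >-> R}) (I : finType) (Q : pred I) (A : I -> set S) :
  is_sas_random_measure alpha m M -> (forall i, measurable (A i)) ->
  trivIset setT A ->
  {ae P, forall w, M (\bigcup_(i in [set i | Q i]) A i) w = \sum_(i | Q i) M (A i) w}.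
Proof.
move=> hM mA tA.
pose B (o : 'I_#|I|) := if Q (enum_val o) then A (enum_val o) else set0.
pose A' (k : nat) : set S := if insub k is Some o then B o else set0.
have mA' k : measurable (A' k).
  by rewrite /A' /B; case: insub => // o; case: ifP.
have A'E (o : 'I_#|I|) : A' o = B o by rewrite /A' valK.
have tA' : trivIset setT A'.
  apply/trivIsetP => i j _ _ ij; rewrite /A'.
  case: insubP => [u _ ui|_]; last by rewrite set0I.
  case: insubP => [v _ vj|_]; last by rewrite setI0.
  rewrite /B; case: ifP => _; last by rewrite set0I.
  case: ifP => _; last by rewrite setI0.
  have /trivIsetP := tA; apply => //; apply: contra ij => /eqP /enum_val_inj uv.
  by rewrite -ui -vj uv.
have UE : \bigcup_k A' k = \bigcup_(i in [set i | Q i]) A i.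
  apply/seteqP; split=> s /=.
    move=> [k _]; rewrite /A'; case: insubP => // u _ _; rewrite /B.
    by case: ifP => // Qu Au; exists (enum_val u).
  move=> [i Qi Ai]; exists (enum_rank i : nat) => //.
  by rewrite A'E /B enum_rankK Qi.
have := sas_sigma_additive hM mA' tA'; rewrite UE.
have := ae_measure_set0 hM; apply: filterS2 => w h0 h.
have cE : \sum_(i | Q i) M (A i) w = \sum_(0 <= k < #|I|) M (A' k) w.
  rewrite big_mkord big_mkcond/=.
  rewrite (reindex_onto (enum_val : 'I_#|I| -> I) enum_rank)/=; last first.
    by move=> i _; rewrite enum_rankK.
  under [in RHS]eq_bigr do rewrite A'E.
  apply: eq_big => [k|k _]; first by rewrite enum_valK eqxx.
  by rewrite /B; case: ifP.
rewrite cE; apply: (@cvg_unique _ _ (series (fun k => M (A' k) w) @ \oo)) => //.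
apply: cvg_near_cst; exists #|I| => // N /= IN.
rewrite /series/= (@big_cat_nat _ _ _ #|I|)//=.
have -> : \sum_(#|I| <= k < N) M (A' k) w = 0; last by rewrite addr0.
rewrite big_nat_cond big1// => k /andP[/andP[Ik _] _].
by rewrite /A'; case: insubP => // u; rewrite ltnNge Ik.
Qed.

(* A finite measurable partition of [S] is encoded by its labelling [l : S -> I]. *)
Definition cell (S I : Type) (l : S -> I) (i : I) : set S := l @^-1` [set i].

Lemma trivIset_cell (S I : Type) (l : S -> I) : trivIset setT (cell l).
Proof. by move=> i j _ _ [s [/= <- <-]]. Qed.

(** The sum runs over labels, not over values, so that several step functions can share one
    partition. *)
Definition step_integral (d d' : measure_display) (Omega : measurableType d)
    (S : measurableType d') (R : realType) (P : probability Omega R)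
    (M : set S -> {RV P >-> R}) (I : finType) (l : S -> I) (x : I -> R)
    (w : Omega) : R :=
  \sum_i x i * M (cell l i) w.

(** Passage to a finer partition [l]: step integrals over different partitions become comparable
    over a common refinement. *)
Lemma ae_step_integral_comp (d d' : measure_display) (Omega : measurableType d)
    (S : measurableType d') (R : realType) (P : probability Omega R)
    (alpha : R) (m : {finite_measure set S -> \bar R})
    (M : set S -> {RV P >-> R}) (I J : finType) (l : S -> J) (h : J -> I)
    (x : I -> R) :
  is_sas_random_measure alpha m M -> (forall j, measurable (cell l j)) ->
  {ae P, forall w, step_integral M (fun s => h (l s)) x w
                 = step_integral M l (fun j => x (h j)) w}.
Proof.
move=> hM ml.
have H i : {ae P, forall w, M (cell (fun s => h (l s)) i) w =
    \sum_(j | h j == i) M (cell l j) w}.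
  have := ae_measure_bigcup (fun j => h j == i) hM ml (@trivIset_cell _ _ l).
  rewrite (_ : \bigcup_(_ in _) _ = cell (fun s => h (l s)) i)//.
  apply/seteqP; split => s /=; first by move=> [j /= /eqP <-]; rewrite /cell/= => ->.
  by rewrite /cell/= => <-; exists (l s) => //=.
have FF : Filter (almost_everywhere P) by exact _.
have := filter_forall FF H; apply: filterS => w Hw.
rewrite /step_integral (partition_big h predT)//=; apply: eq_bigr => i _.
rewrite Hw mulr_sumr; apply: eq_bigr => j /eqP <- //.
Qed.

Lemma step_integral_indep (d d' : measure_display) (Omega : measurableType d)
    (S : measurableType d') (R : realType) (P : probability Omega R)
    (alpha : R) (m : {finite_measure set S -> \bar R})
    (M : set S -> {RV P >-> R}) (I : finType) (l : S -> I) :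
  is_sas_random_measure alpha m M -> (forall i, measurable (cell l i)) ->
  indep_fun P (fun (o : 'I_#|I|) => M (cell l (enum_val o)) : Omega -> R).
Proof.
move=> hM ml; apply: (sas_independently_scattered hM) => //.
apply/trivIsetP => i j _ _ ij; have /trivIsetP := @trivIset_cell _ _ l; apply => //.
by apply: contra ij => /eqP/enum_val_inj ->.
Qed.

Lemma sum_enum_val (R : nmodType) (I : finType) (F : I -> R) :
  \sum_(o < #|I|) F (enum_val o) = \sum_i F i.
Proof.
rewrite [RHS](reindex_onto (enum_val : 'I_#|I| -> I) enum_rank)/=; last first.
  by move=> i _; rewrite enum_rankK.
by apply: eq_bigl => o; rewrite enum_valK eqxx.
Qed.

Lemma step_tail (d d' : measure_display) (Omega : measurableType d)
    (S : measurableType d') (R : realType) (P : probability Omega R)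
    (alpha : R) (m : {finite_measure set S -> \bar R})
    (M : set S -> {RV P >-> R}) :
  0 < alpha < 2 -> is_sas_random_measure alpha m M ->
  exists2 C : R, 0 <= C & forall (I : finType) (l : S -> I) (x : I -> R) (u : R),
    (forall i, measurable (cell l i)) -> 0 < u ->
    \sum_i `|x i / u| `^ alpha * fine (m (cell l i)) <= 1 ->
    (P [set w | (u <= `|step_integral M l x w|)%R] <=
      (C * \sum_i `|x i / u| `^ alpha * fine (m (cell l i)))%:E)%E.
Proof.
move=> a02 hM; have [C C0 hC] := linear_tail P a02.
exists C => // I l x u ml u0.
pose F i := `|x i / u| `^ alpha * fine (m (cell l i)).
rewrite -(sum_enum_val F) => s1.
have := hC _ _ _ (fun o => x (enum_val o)) u
  (fun o => sas_var_measure hM (ml (enum_val o))) (step_integral_indep hM ml) u0 s1.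
have -> // : [set w | u <= `|\sum_(o < #|I|) x (enum_val o) * M (cell l (enum_val o)) w|] =
   [set w | u <= `|step_integral M l x w|].
apply/funext => w /=.
by rewrite (sum_enum_val (fun i => x i * M (cell l i) w)).
Qed.

Lemma integral_step (d : measure_display) (S : measurableType d) (R : realType)
    (m : {finite_measure set S -> \bar R}) (I : finType) (l : S -> I) (h : I -> R) :
  (forall i, measurable (cell l i)) -> (forall i, 0 <= h i) ->
  (\int[m]_s (h (l s))%:E = (\sum_i h i * fine (m (cell l i)))%:E)%E.
Proof.
move=> ml h0.
have E s : ((h (l s))%:E = \sum_i (h i)%:E * (\1_(cell l i) s)%:E)%E.
  rewrite (bigD1 (l s))//= indicE mem_set// mule1 big1 ?adde0// => i ils.
  rewrite indicE memNset ?mule0//; rewrite /cell/= => /eqP; rewrite eq_sym.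
  by rewrite (negbTE ils).
under eq_integral do rewrite E.
rewrite ge0_integral_sum//; last 2 first.
  by move=> i; apply: measurable_funeM; apply/measurable_EFinP; exact: measurable_indic.
  by move=> i s _; rewrite mule_ge0// lee_fin.
rewrite -sumEFin; apply: eq_bigr => i _.
rewrite ge0_integralZl//; last 2 first.
  by apply/measurable_EFinP; exact: measurable_indic.
  by rewrite lee_fin.
by rewrite integral_indic// setIT EFinM fineK// fin_num_measure.
Qed.

Lemma measurable_step (d : measure_display) (S : measurableType d) (R : realType)
    (I : finType) (l : S -> I) (h : I -> R) :
  (forall i, measurable (cell l i)) -> measurable_fun setT (fun s => h (l s)).
Proof.
move=> ml _ B mB; rewrite setTI.
have -> : (fun s => h (l s)) @^-1` B = \bigcup_(i in [set i | B (h i)]) cell l i.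
  apply/seteqP; split=> s /=; first by exists (l s).
  by move=> [i /= Bi]; rewrite /cell/= => ->.
by apply: fin_bigcup_measurable.
Qed.

Lemma simple_stable_integralE (d d' : measure_display) (Omega : measurableType d)
    (S : measurableType d') (R : realType) (P : probability Omega R)
    (M : set S -> {RV P >-> R}) (g : {sfun S >-> R}) :
  exists (I : finType) (l : S -> I) (x : I -> R),
    [/\ forall i, measurable (cell l i), forall s, g s = x (l s) &
        simple_stable_integral M g = step_integral M l x].
Proof.
have fg : finite_set (range g) by exact: fimfunP.
pose F := fset_set (range g).
have gF s : g s \in F by rewrite /F in_fset_set//; apply/mem_set; exists s.
pose l s : F := [` gF s]%fset.
have lE (i : F) : cell l i = g @^-1` [set val i].
  apply/seteqP; split => s; rewrite /cell/=; first by move=> <-.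
  by move=> gi; apply: val_inj.
exists F, l, val; split=> //.
  by move=> i; rewrite lE; exact: measurable_sfunP.
apply/funext => w; rewrite /simple_stable_integral fsbig_finite//= -/F /step_integral.
rewrite big_seq_fsetE/=; apply: eq_bigr => i _.
by rewrite lE.
Qed.

(** * Approximation of stable integrals by step integrals *)

Lemma powRD_le (R : realType) (p a b : R) : 0 <= p ->
  `|a + b| `^ p <= 2 `^ p * (`|a| `^ p + `|b| `^ p).
Proof.
move=> p0; have a0 := powR_ge0 `|a| p; have b0 := powR_ge0 `|b| p.
have t0 := powR_ge0 (2 : R) p.
wlog ab : a b a0 b0 / `|a| <= `|b|.
  move=> H; have [ab|ab] := leP `|a| `|b|; first exact: H.
  by rewrite addrC [X in _ * X]addrC; apply: H => //; exact: ltW.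
apply: (@le_trans _ _ ((2 * `|b|) `^ p)).
  apply: ge0_ler_powR; rewrite ?nnegrE ?mulr_ge0//.
  by apply: (le_trans (ler_normD _ _)); lra.
by rewrite powRM// ler_wpM2l// lerDr.
Qed.

Lemma measure_le_ae (d : measure_display) (T : measurableType d)
    (R : realType) (P : {measure set T -> \bar R}) (A B : set T) :
  measurable A -> measurable B -> {ae P, forall w, A w -> B w} ->
  (P A <= P B)%E.
Proof.
move=> mA mB [N [mN N0 sN]].
apply: (@le_trans _ _ (P (B `|` N))).
  apply: le_measure; [exact: mem_set|exact/mem_set/measurableU|].
  move=> w Aw; have [Bw|Bw] := pselect (B w); [by left|right].
  by apply: sN => /= /(_ Aw).
apply: le_trans (measureU2 _ mB mN) _; rewrite -[leRHS]adde0 leeD2l//.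
by rewrite le_eqVlt; apply/orP; left; apply/eqP; exact: N0.
Qed.

Lemma cvge0_lt (R : realType) (u : nat -> \bar R) (e : R) : 0 < e ->
  u @ \oo --> 0%E -> \forall n \near \oo, (u n < e%:E)%E.
Proof.
move=> e0 /fine_cvgP[fu /cvgrPdist_lt/(_ _ e0)].
move: fu; apply: filterS2 => n /= fu; rewrite sub0r normrN => h.
rewrite -(fineK fu) lte_fin; apply: le_lt_trans h; exact: ler_norm.
Qed.

Lemma Lnorm_integral_le (d : measure_display) (S : measurableType d)
    (R : realType) (m : {measure set S -> \bar R}) (alpha c : R) (g : S -> R) :
  0 < alpha -> 0 < c -> ('N[m]_(alpha%:E)[EFin \o g] < c%:E)%E ->
  (\int[m]_s (`|g s| `^ alpha)%:E <= (c `^ alpha)%:E)%E.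
Proof.
move=> a0 c0 h.
have := powR_Lnorm m (EFin \o g) (lt0r_neq0 a0).
have -> : (\int[m]_x (`|(EFin \o g) x| `^ alpha)%E = \int[m]_s (`|g s| `^ alpha)%:E)%E.
  by apply: eq_integral => s _.
move=> <-; rewrite -poweR_EFin.
apply: gt0_ler_poweR => //; first exact: ltW.
- by rewrite in_itv/= Lnorm_ge0 leey.
- by rewrite in_itv/= lee_fin (ltW c0) leey.
- exact: ltW.
Qed.

Lemma finite_pos_lb (R : realType) (Q : finType) (g : Q -> R) :
  (forall q, 0 < g q) -> exists2 e : R, 0 < e & forall q, e <= g q.
Proof.
move=> g0; suff [e e0 h] : exists2 e : R, 0 < e & forall q, q \in enum Q -> e <= g q.
  by exists e => // q; apply: h; rewrite mem_enum.
elim: (enum Q) => [|q s [e e0 h]]; first by exists 1.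
exists (Num.min e (g q)); first by rewrite lt_min e0 g0.
move=> r; rewrite inE => /orP[/eqP ->|rs]; first by rewrite ge_min lexx orbT.
by rewrite ge_min h.
Qed.

(** One truncation level for a finite family: the sum of the |phi_t|^p is an integrable majorant,
    and its integral over the points where some |phi_t| exceeds n tends to 0 by dominated
    convergence. *)
Lemma uniform_integrability (d : measure_display) (S : measurableType d)
    (R : realType) (m : {measure set S -> \bar R}) (T0 : finType) (p : R)
    (phi : T0 -> S -> R) (eta : R) :
  0 <= p -> 0 < eta -> (forall t, measurable_fun setT (phi t)) ->
  (forall t, m.-integrable setT (fun s => (`|phi t s| `^ p)%:E)) ->
  exists2 b : R, 0 <= b & forall t,
    (\int[m]_(s in ~` [set s | forall t, (`|phi t s| <= b)%R]) (`|phi t s| `^ p)%:E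
      <= eta%:E)%E.
Proof.
move=> p0 eta0 mphi iphi.
pose B (n : nat) := [set s | forall t, `|phi t s| <= n%:R].
have mB n : measurable (B n).
  rewrite (_ : B n = \bigcap_(t in [set: T0]) [set s | `|phi t s| <= n%:R]).
    apply: fin_bigcap_measurable => // t _; rewrite -[X in measurable X]setTI.
    apply: (@measurable_fun_ler _ _ _ setT (fun s => `|phi t s|) (fun=> n%:R)) => //.
    exact: measurableT_comp.
  by apply/seteqP; split=> s /= h t; [move=> _; exact: h|exact: h].
pose G s := \sum_t `|phi t s| `^ p.
have iG : m.-integrable setT (EFin \o G).
  have -> : EFin \o G = (fun s => \sum_(t <- index_enum T0) (`|phi t s| `^ p)%:E)%E.
    by apply/funext => s; rewrite /= -sumEFin.
  by apply: integrable_sum => // t _; exact: iphi.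
pose h n := (EFin \o G) \_ (~` B n).
have mh n : measurable_fun setT (h n).
  apply/(measurable_restrictT _ (measurableC (mB n))).
  apply: measurable_funTS; exact: (measurable_int m).
have cvg0 s : [set: S] s -> h n s @[n --> \oo] --> 0%E.
  move=> _; apply: cvg_near_cst.
  exists (Num.trunc (\sum_t `|phi t s|)).+1 => // n /= nb.
  rewrite /h patchE memNset// => /=; apply => t.
  apply: (@le_trans _ _ (\sum_t `|phi t s|)).
    by rewrite (bigD1 t)//= lerDl sumr_ge0.
  apply: (le_trans (ltW (truncnS_gt _))).
  by rewrite ler_nat.
have dom n s : [set: S] s -> (`|h n s| <= (EFin \o G) s)%E.
  have G0 : 0 <= G s by apply: sumr_ge0 => t _; exact: powR_ge0.
  move=> _; rewrite /h patchE; case: ifP => _; last by rewrite abse0 lee_fin.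
  by rewrite /= ger0_norm.
have := dominated_cvg measurableT mh cvg0 _ iG dom.
rewrite integral0 => /(_ (fun _ _ => isT)) /(cvge0_lt eta0)[N _ /(_ N (leqnn N)) /= hN].
exists N%:R => // t; apply: le_trans (ltW hN).
rewrite [leLHS]integral_mkcond; apply: ge0_le_integral => //.
- by move=> s _; apply: erestrict_ge0 => ? _; rewrite lee_fin powR_ge0.
- apply/(measurable_restrictT _ (measurableC (mB N))); apply: measurable_funTS.
  exact: (measurable_int m (iphi t)).
move=> s _; rewrite /h !patchE; case: ifP => // _; rewrite lee_fin /G.
rewrite (bigD1 t)//= lerDl; apply: sumr_ge0 => ? _; exact: powR_ge0.
Qed.

(** All functions are rounded down at once on a grid of mesh [delta] starting at -b, so one
    labelling serves the whole family. The label [None] marks the points where some function exceeds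
    [b] in absolute value; there every step function takes the value 0. *)
Lemma quantize (d : measure_display) (S : measurableType d)
    (R : realType) (T0 : finType) (phi : T0 -> S -> R) (b delta : R) :
  (forall t, measurable_fun setT (phi t)) -> 0 <= b -> 0 < delta ->
  exists (I : finType) (l : S -> I) (x : T0 -> I -> R),
    [/\ forall i, measurable (cell l i),
        forall s, (forall t, `|phi t s| <= b) ->
          forall t, `|phi t s - x t (l s)| <= delta &
        forall s, ~ (forall t, `|phi t s| <= b) -> forall t, x t (l s) = 0].
Proof.
move=> mphi b0 d0.
pose N := Num.trunc (2 * b / delta).
pose B := [set s | forall t, `|phi t s| <= b].
pose y t s := (phi t s + b) / delta.
pose l s : option {ffun T0 -> 'I_N.+1} :=
  if `[< B s >] then Some [ffun t => inord (Num.trunc (y t s))] else None.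
pose x (t : T0) (i : option {ffun T0 -> 'I_N.+1}) : R :=
  if i is Some v then (v t)%:R * delta - b else 0.
have mB : measurable B.
  rewrite (_ : B = \bigcap_(t in [set: T0]) [set s | `|phi t s| <= b]).
    apply: fin_bigcap_measurable => // t _; rewrite -[X in measurable X]setTI.
    apply: (@measurable_fun_ler _ _ _ setT (fun s => `|phi t s|) (fun=> b)) => //.
    exact: measurableT_comp.
  by apply/seteqP; split=> s /= h t; [move=> _; exact: h|exact: h].
have my t : measurable_fun setT (y t).
  apply: measurable_funM => //; exact: measurable_funD.
have yB t s : B s -> 0 <= y t s /\ (Num.trunc (y t s) < N.+1)%N.
  move=> Bs; have := Bs t; rewrite ler_norml => /andP[h1 h2]; split.
    by rewrite divr_ge0 ?(ltW d0)//; lra.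
  rewrite ltnS; apply: le_truncn; rewrite ler_pM2r ?invr_gt0//; lra.
exists (option {ffun T0 -> 'I_N.+1}), l, x; split.
- case=> [v|].
    rewrite (_ : cell l (Some v) = B `&` \bigcap_(t in [set: T0])
      ([set s | (v t)%:R <= y t s] `&` [set s | y t s < (v t).+1%:R])).
      apply: measurableI => //; apply: fin_bigcap_measurable => // t _.
      apply: measurableI; rewrite -[X in measurable X]setTI.
        exact: (@measurable_fun_ler _ _ _ setT (fun=> (v t)%:R) (y t)).
      exact: (@measurable_fun_ltr _ _ _ setT (y t) (fun=> (v t).+1%:R)).
    apply/seteqP; split=> s; rewrite /cell/= /l.
      case: asboolP => // Bs [<-]; split=> // t _ /=.
      have [y0 yN] := yB t s Bs; rewrite ffunE inordK//.
      by have /andP[? ?] := truncn_itv y0; split.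
    move=> [Bs h]; rewrite asboolT//; congr Some; apply/ffunP => t.
    have [h1 h2] := h t Logic.I; rewrite ffunE; apply: val_inj.
    have [y0 yN] := yB t s Bs; rewrite /= inordK//.
    by apply: truncn_def; apply/andP; split.
  rewrite (_ : cell l None = ~` B); first exact: measurableC.
  by apply/seteqP; split=> s; rewrite /cell/= /l; case: asboolP.
- move=> s Bs t; have [y0 yN] := yB t s Bs.
  rewrite /x /l asboolT// ffunE inordK//.
  have /andP[h1 h2] := truncn_itv y0.
  set k := (Num.trunc (y t s))%:R in h1 *.
  have {}h2 : y t s < k + 1 by rewrite /k natr1.
  have E : phi t s = y t s * delta - b by rewrite /y; field; rewrite gt_eqF.
  rewrite E ler_norml; apply/andP; split; nra.
- by move=> s Bs t; rewrite /x /l asboolF.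
Qed.

Lemma measurable_step_integral (d d' : measure_display) (Omega : measurableType d)
    (S : measurableType d') (R : realType) (P : probability Omega R)
    (M : set S -> {RV P >-> R}) (I : finType) (l : S -> I) (x : I -> R) :
  measurable_fun setT (step_integral M l x).
Proof. by apply: measurable_sum => i; apply: measurable_funM. Qed.

Lemma measurable_norm_gt (d : measure_display) (T : measurableType d)
    (R : realType) (f : T -> R) (c : R) :
  measurable_fun setT f -> measurable [set w | c < `|f w|].
Proof.
move=> mf; rewrite -[X in measurable X]setTI.
apply: (@measurable_fun_ltr _ _ _ setT (fun=> c) (fun w => `|f w|)) => //.
exact: measurableT_comp.
Qed.

(** The definition of the integral supplies some approximating sequence of simple functions. A step
    function close to [g] in L^alpha is close to a late member of that sequence, and the difference
    of the two integrals, written over the product labelling, is controlled by the tail bound for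
    step integrals. *)
Lemma step_integral_close (d d' : measure_display) (Omega : measurableType d)
    (S : measurableType d') (R : realType) (P : probability Omega R)
    (alpha : R) (m : {finite_measure set S -> \bar R})
    (M : set S -> {RV P >-> R}) (e : R) :
  0 < alpha < 2 -> is_sas_random_measure alpha m M -> 0 < e ->
  exists2 eta : R, 0 < eta & forall (I : finType) (l : S -> I) (x : I -> R)
      (g : S -> R) (Z : {RV P >-> R}),
    measurable_fun setT g -> is_stable_integral alpha m M g Z ->
    (forall i, measurable (cell l i)) ->
    (\int[m]_s (`|g s - x (l s)| `^ alpha)%:E <= eta%:E)%E ->
    (P [set w | (e < `|Z w - step_integral M l x w|)%R] <= e%:E)%E.
Proof.
move=> a02 hM e0; have /andP[a0 a2] := a02.
have [C C0 hC] := step_tail a02 hM.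
(* The factor (2 / e)^alpha comes from the threshold e / 2 in the tail bound, and 2^alpha * 2 from
   splitting the L^alpha error into two errors [eta]. In the choice of [eta], the bound 1 meets the
   hypothesis of the tail estimate and e / 2 is the probability aimed at. *)
pose kappa := (2 / e) `^ alpha * (2 `^ alpha * 2).
have k0 : 0 < kappa by rewrite !mulr_gt0 ?powR_gt0// divr_gt0.
pose eta := Num.min 1 (e / 2) / (kappa * (C + 1)).
have C1 : 0 < C + 1 by lra.
have min0 : 0 < Num.min 1 (e / 2) by rewrite lt_min ltr01 divr_gt0.
have eta0 : 0 < eta by rewrite divr_gt0// mulr_gt0.
exists eta => // I l x g Z mg [gn gncvg gnZ] ml hint.
have e20 : 0 < e / 2 by rewrite divr_gt0.
have c0 : 0 < eta `^ alpha^-1 by exact: powR_gt0.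
have [n [hn1 hn2]] : exists n,
    ('N[m]_(alpha%:E)[EFin \o (fun s => gn n s - g s)%R] < (eta `^ alpha^-1)%:E)%E /\
    (P [set w | (e / 2 < `|simple_stable_integral M (gn n) w - Z w|)%R] < (e / 2)%:E)%E.
  have := filterI (cvge0_lt c0 gncvg) (cvge0_lt e20 (gnZ _ e20)).
  by move=> [n _ /(_ n (leqnn n))]; exists n.
have {hn1} hn1 : (\int[m]_s (`|gn n s - g s| `^ alpha)%:E <= eta%:E)%E.
  apply: (le_trans (Lnorm_integral_le a0 c0 hn1)).
  by rewrite -powRrM mulVf ?gt_eqF// powRr1// ltW.
have [I' [l' [x' [ml' gE IE]]]] := simple_stable_integralE M (gn n).
rewrite IE in hn2.
pose L s := (l' s, l s).
have mL k : measurable (cell L k).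
  rewrite (_ : cell L k = cell l' k.1 `&` cell l k.2); first exact: measurableI.
  apply/seteqP; split=> s; rewrite /cell/= /L; first by move=> <-.
  by case: k => k1 k2 /= [<- <-].
pose D (k : I' * I) := x' k.1 - x k.2.
have a1 := ae_step_integral_comp fst x' hM mL.
have a2' := ae_step_integral_comp snd x hM mL.
have mD := measurable_step_integral M L D.
pose A1 := [set w | e / 2 < `|step_integral M l' x' w - Z w|].
pose A2 := [set w | e / 2 <= `|step_integral M L D w|].
have mA1 : measurable A1.
  apply: measurable_norm_gt; apply: measurable_funB => //.
  exact: measurable_step_integral.
have mA2 : measurable A2 by exact: measurable_norm_ge.
apply: (@le_trans _ _ (P (A1 `|` A2))).
  apply: measure_le_ae.
  - apply: measurable_norm_gt; apply: measurable_funB => //.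
    exact: measurable_step_integral.
  - exact: measurableU.
  move: a1 a2'; apply: filterS2 => w E1 E2 hw.
  have DE : step_integral M L D w = step_integral M l' x' w - step_integral M l x w.
    rewrite [X in _ = X - _]E1 [X in _ = _ - X]E2 /step_integral -sumrB.
    by apply: eq_bigr => k _; rewrite mulrBl.
  have [h|h] := ltP (e / 2) `|step_integral M l' x' w - Z w|; [by left|right].
  rewrite /A2/= DE; have := ler_normB (step_integral M l' x' w - step_integral M l x w) (step_integral M l' x' w - Z w).
  have -> : step_integral M l' x' w - step_integral M l x w -
    (step_integral M l' x' w - Z w) = Z w - step_integral M l x w by ring.
  move: hw h; rewrite /=; set u := `|_|; set v := `|_|; set z := `|_|; lra.
apply: le_trans (measureU2 _ mA1 mA2) _.
have -> : e%:E = ((e / 2)%:E + (e / 2)%:E)%E by rewrite -EFinD; congr EFin; lra.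
apply: leeD; first exact: ltW.
have a10 : 0 <= alpha by exact: ltW.
have SE : ((\sum_k `|D k / (e / 2)| `^ alpha * fine (m (cell L k)))%:E =
    ((2 / e) `^ alpha)%:E * \int[m]_s (`|gn n s - x (l s)| `^ alpha)%:E)%E.
  have mi : measurable_fun setT (fun s => (`|D (L s)| `^ alpha)%:E).
    apply/measurable_EFinP.
    exact: (measurable_step (fun k => `|D k| `^ alpha) mL).
  have -> : (\int[m]_s (`|gn n s - x (l s)| `^ alpha)%:E =
      \int[m]_s (`|D (L s)| `^ alpha)%:E)%E.
    by apply: eq_integral => s _; rewrite gE.
  rewrite (integral_step m (h := fun k => `|D k| `^ alpha) mL)//.
  rewrite -EFinM mulr_sumr; congr EFin; apply: eq_bigr => k _.
  rewrite normrM powRM// mulrA; congr (_ * _); rewrite mulrC; congr (_ `^ _ * _).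
  by rewrite invf_div ger0_norm// divr_ge0// ltW.
have mgn : measurable_fun setT (gn n) by exact: measurable_funPT.
have mxl : measurable_fun setT (fun s => x (l s)) by exact: measurable_step.
have mpow (u : S -> R) : measurable_fun setT u -> measurable_fun setT (fun s => (`|u s| `^ alpha)%:E).
  move=> mu; apply/measurable_EFinP; apply: (measurableT_comp (measurable_powR alpha)).
  exact: measurableT_comp.
have bound : (\int[m]_s (`|gn n s - x (l s)| `^ alpha)%:E <= (2 `^ alpha * (eta + eta))%:E)%E.
  apply: (@le_trans _ _ (\int[m]_s ((2 `^ alpha)%:E * ((`|gn n s - g s| `^ alpha)%:E +
      (`|g s - x (l s)| `^ alpha)%:E)))%E).
    apply: ge0_le_integral => //.
    - by apply: mpow; exact: measurable_funB.
    - by apply: measurable_funeM; apply: emeasurable_funD; apply: mpow; exact: measurable_funB.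
    - move=> s _; rewrite -EFinD -EFinM lee_fin.
      have -> : gn n s - x (l s) = (gn n s - g s) + (g s - x (l s)) by rewrite addrA subrK.
      exact: powRD_le.
  rewrite ge0_integralZl//; last 2 first.
    by apply: emeasurable_funD; apply: mpow; exact: measurable_funB.
    by move=> s _; rewrite adde_ge0 ?lee_fin ?powR_ge0.
  rewrite EFinM; apply: lee_wpmul2l; first by rewrite lee_fin powR_ge0.
  rewrite ge0_integralD//; last 2 first.
    by apply: mpow; exact: measurable_funB.
    by apply: mpow; exact: measurable_funB.
  by rewrite EFinD; exact: leeD.
have S1 : \sum_k `|D k / (e / 2)| `^ alpha * fine (m (cell L k)) <= kappa * eta.
  rewrite -lee_fin SE.
  have -> : (kappa * eta)%:E = (((2 / e) `^ alpha)%:E * (2 `^ alpha * (eta + eta))%:E)%E.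
    by rewrite -EFinM; congr EFin; rewrite /kappa; ring.
  by apply: lee_wpmul2l => //; rewrite lee_fin powR_ge0.
have kE : kappa * eta = Num.min 1 (e / 2) / (C + 1).
  by rewrite /eta; field; rewrite !gt_eqF.
have S2 : \sum_k `|D k / (e / 2)| `^ alpha * fine (m (cell L k)) <= Num.min 1 (e / 2) / (C + 1).
  by rewrite -kE.
have m1 : Num.min 1 (e / 2) <= 1 by rewrite ge_min lexx.
have m2 : Num.min 1 (e / 2) <= e / 2 by rewrite ge_min lexx orbT.
apply: (le_trans (hC _ L D (e / 2) mL e20 _)).
  by apply: (le_trans S2); rewrite ler_pdivrMr//; lra.
rewrite lee_fin; apply: (@le_trans _ _ (C * (Num.min 1 (e / 2) / (C + 1)))).
  by rewrite ler_wpM2l.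
rewrite mulrA ler_pdivrMr//.
move: m2 min0; set z := Num.min _ _; move=> m2 z0; nra.
Qed.

(** The last two conclusions are pointwise since they must transfer integrability of orders [p1] and
    [p2], which L^alpha approximation does not preserve. Where the functions are bounded by b they
    follow from uniform rounding; elsewhere all step functions are 0 and so are their increments. *)
Lemma step_approx (d d' : measure_display) (Omega : measurableType d)
    (S : measurableType d') (R : realType) (P : probability Omega R)
    (alpha : R) (m : {finite_measure set S -> \bar R})
    (M : set S -> {RV P >-> R}) (T0 : finType) (phi : T0 -> S -> R)
    (Z : T0 -> {RV P >-> R}) (e : R) :
  1 < alpha < 2 -> is_sas_random_measure alpha m M ->
  (forall t, phi t \in Lfun m alpha%:E) ->
  (forall t, is_stable_integral alpha m M (phi t) (Z t)) -> 0 < e ->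
  exists (I : finType) (l : S -> I) (x : T0 -> I -> R),
    [/\ forall i, measurable (cell l i),
        forall t, (P [set w | (e < `|Z t w - step_integral M l (x t) w|)%R] <= e%:E)%E,
        forall t t' s, `|x t' (l s) - x t (l s)| <= `|phi t' s - phi t s| + e &
        forall t1 t2 t3 s,
          `|(x t2 (l s) - x t1 (l s)) * (x t3 (l s) - x t2 (l s))|
            <= `|(phi t2 s - phi t1 s) * (phi t3 s - phi t2 s)| + e].
Proof.
move=> /andP[a1 a2] hM hphi hZ e0.
have a02 : 0 < alpha < 2 by apply/andP; split=> //; lra.
have a0 : 0 < alpha by lra.
have [eta eta0 hclose] := step_integral_close a02 hM e0.
have mphi t : measurable_fun setT (phi t).
  have := hphi t; rewrite inE => /andP[+ _]; exact: set_mem.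
have iphi t : m.-integrable setT (fun s => (`|phi t s| `^ alpha)%:E).
  by apply: Lfun_integrable; [exact: ltW|exact: hphi].
have eta20 : 0 < eta / 2 by rewrite divr_gt0.
have [b b0 hb] := uniform_integrability (ltW a0) eta20 mphi iphi.
pose mS := fine (m setT).
have mS0 : 0 <= mS by rewrite fine_ge0.
have mSE : m setT = mS%:E by rewrite fineK// fin_num_measure.
pose d0 := (eta / 2 / (mS + 1)) `^ alpha^-1.
have d00 : 0 < d0 by rewrite powR_gt0// divr_gt0//; lra.
have b8 : 0 < 8 * b + 8 by lra.
(* [d0] limits the L^alpha error where the functions are bounded by b. The other two entries handle
   products: rounding changes a product of increments by at most 8 b delta + 4 delta^2, which is at
   most [e]. *)
pose delta := Num.min d0 (Num.min 1 (e / (8 * b + 8))).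
have delta0 : 0 < delta by rewrite !lt_min d00 ltr01 divr_gt0.
have delta1 : delta <= d0 by rewrite ge_min lexx.
have delta2 : delta <= 1 by rewrite !ge_min lexx orbT.
have delta3 : delta * (8 * b + 8) <= e.
  by rewrite -ler_pdivlMr// !ge_min lexx !orbT.
have [I [l [x [ml hB hB']]]] := quantize mphi b0 delta0.
exists I, l, x; split=> //.
- move=> t; apply: (hclose _ _ _ (phi t)) => //.
  pose B := [set s | forall t, `|phi t s| <= b].
  have mB : measurable B.
    rewrite (_ : B = \bigcap_(t in [set: T0]) [set s | `|phi t s| <= b]).
      apply: fin_bigcap_measurable => // t' _; rewrite -[X in measurable X]setTI.
      apply: (@measurable_fun_ler _ _ _ setT (fun s => `|phi t' s|) (fun=> b)) => //.
      exact: measurableT_comp.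
    by apply/seteqP; split=> s /= h t'; [move=> _; exact: h|exact: h].
  have mint : measurable_fun setT (fun s => (`|phi t s - x t (l s)| `^ alpha)%:E).
    apply/measurable_EFinP; apply: (measurableT_comp (measurable_powR alpha)).
    apply: measurableT_comp => //; apply: measurable_funB => //.
    exact: measurable_step.
  rewrite -(setUv B) ge0_integral_setU//; last 3 first.
    exact: measurableC.
    by rewrite setUv.
    by apply/disj_setPCl.
  have -> : eta%:E = ((eta / 2)%:E + (eta / 2)%:E)%E by rewrite -EFinD; congr EFin; lra.
  apply: leeD.
    apply: (@le_trans _ _ (\int[m]_(s in B) (delta `^ alpha)%:E)%E).
      apply: ge0_le_integral => //.
      - exact: measurable_funTS.
      - move=> s Bs; rewrite lee_fin; apply: ge0_ler_powR; rewrite ?nnegrE//.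
        + exact: ltW.
        + exact: ltW.
        + exact: hB.
    rewrite integral_cst//.
    apply: (@le_trans _ _ ((delta `^ alpha)%:E * mS%:E)%E).
      apply: lee_wpmul2l; first by rewrite lee_fin powR_ge0.
      by rewrite -mSE; apply: le_measure; [exact: mem_set|exact/mem_set/measurableT|exact: subsetT].
    rewrite -EFinM lee_fin.
    apply: (@le_trans _ _ ((eta / 2 / (mS + 1)) * mS)).
      rewrite ler_wpM2r//; apply: (@le_trans _ _ (d0 `^ alpha)).
        by apply: ge0_ler_powR; rewrite ?nnegrE// ltW.
      by rewrite /d0 -powRrM mulVf ?gt_eqF// powRr1// divr_ge0//; lra.
    rewrite mulrAC ler_pdivrMr; lra.
  apply: le_trans (hb t).
  rewrite le_eqVlt; apply/orP; left; apply/eqP; apply: eq_integral => s.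
  by move=> /set_mem Bs; rewrite hB' ?subr0.
- move=> t t' s; have [Bs|Bs] := pselect (forall t, `|phi t s| <= b); last first.
    by rewrite !hB'// subrr normr0 addr_ge0// ltW.
  have h1 := hB s Bs t; have h2 := hB s Bs t'.
  have -> : x t' (l s) - x t (l s) = (phi t' s - phi t s) +
    ((phi t s - x t (l s)) - (phi t' s - x t' (l s))) by ring.
  apply: (le_trans (ler_normD _ _)); rewrite lerD2l.
  apply: (le_trans (ler_normB _ _)); nra.
- move=> t1 t2 t3 s; have [Bs|Bs] := pselect (forall t, `|phi t s| <= b); last first.
    by rewrite !hB'// subrr mul0r normr0 addr_ge0// ltW.
  have h1 := hB s Bs t1; have h2 := hB s Bs t2; have h3 := hB s Bs t3.
  have b1 := Bs t1; have b2 := Bs t2; have b3 := Bs t3.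
  set u := phi t2 s - phi t1 s; set v := phi t3 s - phi t2 s.
  set r := (phi t1 s - x t1 (l s)) - (phi t2 s - x t2 (l s)).
  set r' := (phi t2 s - x t2 (l s)) - (phi t3 s - x t3 (l s)).
  have -> : x t2 (l s) - x t1 (l s) = u + r by rewrite /u /r; ring.
  have -> : x t3 (l s) - x t2 (l s) = v + r' by rewrite /v /r'; ring.
  have hu : `|u| <= 2 * b by apply: (le_trans (ler_normB _ _)); lra.
  have hv : `|v| <= 2 * b by apply: (le_trans (ler_normB _ _)); lra.
  have hr : `|r| <= 2 * delta by apply: (le_trans (ler_normB _ _)); lra.
  have hr' : `|r'| <= 2 * delta by apply: (le_trans (ler_normB _ _)); lra.
  have -> : (u + r) * (v + r') = u * v + (u * r' + r * v + r * r') by ring.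
  apply: (le_trans (ler_normD _ _)); rewrite lerD2l.
  apply: (le_trans (ler_normD _ _)); rewrite normrM.
  have : `|u * r' + r * v| <= `|u| * `|r'| + `|r| * `|v|.
    by apply: (le_trans (ler_normD _ _)); rewrite !normrM.
  have p1 : `|u| * `|r'| <= (2 * b) * (2 * delta) by apply: ler_pM.
  have p2 : `|r| * `|v| <= (2 * delta) * (2 * b) by apply: ler_pM.
  have p3 : `|r| * `|r'| <= (2 * delta) * (2 * delta) by apply: ler_pM.
  nra.
Qed.

(** * Joint tails of adjacent increments of X on a finite grid *)

(** The order of the quantifiers is the point: [c0] precedes K, and [C] depends on K but not on the
    grid [Q], the thresholds or the moment bounds. The term in K^-alpha thus occurs once for the
    whole grid. [Phi1] and [Phi2] are positive so that they can absorb the error of passing to step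
    functions. *)
Lemma grid_bound (d d' : measure_display) (Omega : measurableType d)
    (S : measurableType d') (R : realType) (P : probability Omega R)
    (alpha p1 p2 : R) (m : {finite_measure set S -> \bar R})
    (M : set S -> {RV P >-> R}) (X : R -> {RV P >-> R}) (f : R -> S -> R) :
  1 < alpha < 2 -> alpha < p1 -> alpha / 2 < p2 ->
  is_sas_random_measure alpha m M ->
  (forall t : R, 0 <= t <= 1 -> f t \in Lfun m alpha%:E) ->
  (forall t : R, 0 <= t <= 1 -> is_stable_integral alpha m M (f t) (X t)) ->
  exists2 c0 : R, 0 <= c0 & forall K : R, 0 < K -> exists2 C : R, 0 <= C &
    forall (Q : finType) (a b c l Phi1 Phi2 : Q -> R),
      (forall q, 0 <= a q <= 1) -> (forall q, 0 <= b q <= 1) ->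
      (forall q, 0 <= c q <= 1) -> (forall q, 0 < l q) ->
      (forall q, 0 < Phi1 q) -> (forall q, 0 < Phi2 q) ->
      (forall q, \int[m]_s (`|f (b q) s - f (a q) s| `^ p1)%:E <= (Phi1 q)%:E)%E ->
      (forall q, \int[m]_s (`|f (c q) s - f (b q) s| `^ p1)%:E <= (Phi1 q)%:E)%E ->
      (forall q, \int[m]_s (`|(f (b q) s - f (a q) s) * (f (c q) s - f (b q) s)| `^ p2)%:E
        <= (Phi2 q)%:E)%E ->
      (P [set w | exists q, (l q < `|X (b q) w - X (a q) w|)%R /\
                            (l q < `|X (c q) w - X (b q) w|)%R]
        <= (c0 * K `^ (- alpha) + \sum_q C *
           (l q `^ (- (2 * p1)) * Phi1 q ^+ 2 + l q `^ (- (2 * p2)) * Phi2 q))%:E)%E.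
Proof.
move=> a12 ap1 ap2 hM hf hXf; have /andP[a1 a2] := a12.
have a02 : 0 < alpha < 2 by apply/andP; split=> //; lra.
have a0 : 0 < alpha by lra.
have p11 : 1 < p1 by lra.
have p10 : 0 < p1 by lra.
have p20 : 0 < p2 by lra.
pose mS := fine (m setT).
have mS0 : 0 <= mS by rewrite fine_ge0.
have mSE : m setT = mS%:E by rewrite fineK// fin_num_measure.
have c00 : 0 <= 2 * 2 `^ alpha * mS by rewrite !mulr_ge0// powR_ge0.
exists (2 * 2 `^ alpha * mS + 1); first by lra.
move=> K K0.
pose k := K `^ (- alpha).
have k0 : 0 < k by exact: powR_gt0.
have [CJ CJ0 hJ] := joint_tail P a02 ap1 p11 ap2 (mulr_ge0 (ltW k0) mS0).
(* The coefficients are multiplied by K, which gives K^p1 and K^(2 p2); the rescaled masses give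
   K^-alpha; the last factor is the price of step functions. *)
pose E1 := K `^ p1 * k * (2 `^ p1 * 2).
pose E2 := K `^ (2 * p2) * k * (2 `^ p2 * 2).
have E10 : 0 <= E1 by rewrite !mulr_ge0 ?powR_ge0.
have E20 : 0 <= E2 by rewrite !mulr_ge0 ?powR_ge0.
pose C := CJ * (2 `^ (2 * p1) * E1 ^+ 2 + 2 `^ (2 * p2) * E2).
have C1 : 0 <= 2 `^ (2 * p1) * E1 ^+ 2 by rewrite mulr_ge0 ?powR_ge0// exprn_ge0.
have C2 : 0 <= 2 `^ (2 * p2) * E2 by rewrite mulr_ge0 ?powR_ge0.
exists C; first by rewrite mulr_ge0// addr_ge0.
move=> Q a b c l Phi1 Phi2 ha hb hc hl hP1 hP2 hi1 hi2 hi3.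
pose T0 := (Q * 'I_3)%type.
pose tm (t : T0) : R := nth 0 [:: a t.1; b t.1; c t.1] t.2.
have htm t : 0 <= tm t <= 1.
  by case: t => q [[|[|[|i]]] hi]; rewrite /tm/=.
have mS1 : 0 < mS + 1 by lra.
(* The accuracy required by one triple of times: l / 4 for the threshold, and the powers for which
   e^p1 m(S) <= Phi1 and e^p2 m(S) <= Phi2. *)
pose g1 q := Num.min (l q / 4) (Num.min ((Phi1 q / (mS + 1)) `^ p1^-1)
  ((Phi2 q / (mS + 1)) `^ p2^-1)).
have g10 q : 0 < g1 q by rewrite !lt_min divr_gt0 ?powR_gt0 ?divr_gt0.
have [e1 e10 he1] := finite_pos_lb g10.
pose n3 : R := #|{: T0}|%:R + 1.
have n30 : 0 < n3 by rewrite /n3 ltr_wpDl// ler0n.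
(* The second entry keeps the sum over all times of the probabilities of a bad approximation below
   K^-alpha. *)
pose e := Num.min e1 (k / n3).
have e0 : 0 < e by rewrite lt_min e10 divr_gt0.
have ee1 : e <= e1 by rewrite ge_min lexx.
have ek : e * n3 <= k by rewrite -ler_pdivlMr// ge_min lexx orbT.
have el q : e <= l q / 4.
  by apply: (le_trans ee1); apply: (le_trans (he1 q)); rewrite ge_min lexx.
have eP1 q : e `^ p1 * mS <= Phi1 q.
  apply: (@le_trans _ _ ((Phi1 q / (mS + 1)) * mS)); last first.
    rewrite mulrAC ler_pdivrMr// ler_pM2l//; lra.
  rewrite ler_wpM2r//; apply: (@le_trans _ _ (((Phi1 q / (mS + 1)) `^ p1^-1) `^ p1)).
    apply: ge0_ler_powR; rewrite ?nnegrE ?powR_ge0 ?(ltW e0) ?(ltW p10) ?(ltW p20)//.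
    by apply: (le_trans ee1); apply: (le_trans (he1 q)); rewrite !ge_min lexx orbT.
  by rewrite -powRrM mulVf ?gt_eqF// powRr1// divr_ge0// ltW.
have eP2 q : e `^ p2 * mS <= Phi2 q.
  apply: (@le_trans _ _ ((Phi2 q / (mS + 1)) * mS)); last first.
    rewrite mulrAC ler_pdivrMr// ler_pM2l//; lra.
  rewrite ler_wpM2r//; apply: (@le_trans _ _ (((Phi2 q / (mS + 1)) `^ p2^-1) `^ p2)).
    apply: ge0_ler_powR; rewrite ?nnegrE ?powR_ge0 ?(ltW e0) ?(ltW p10) ?(ltW p20)//.
    by apply: (le_trans ee1); apply: (le_trans (he1 q)); rewrite !ge_min lexx !orbT.
  by rewrite -powRrM mulVf ?gt_eqF// powRr1// divr_ge0// ltW.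
have [I [L [x [mL hcl hx1 hx2]]]] := step_approx (phi := fun t => f (tm t))
  (Z := fun t => X (tm t)) a12 hM (fun t => hf _ (htm t)) (fun t => hXf _ (htm t)) e0.
(* Division by K turns truncation at K into [clamp]; the parameters [mu] then add up to K^-alpha
   m(S). *)
pose mu (o : 'I_#|I|) := `|K^-1| `^ alpha * fine (m (cell L (enum_val o))).
pose xi (o : 'I_#|I|) w := K^-1 * M (cell L (enum_val o)) w.
have hxi o : sas_var P alpha (xi o) (mu o).
  by apply: sas_varZ; exact: sas_var_measure.
have ixi : indep_fun P xi.
  apply: (indep_fun_measurable_comp (h := fun v => K^-1 * v)).
    exact: (measurable_funM (measurable_cst _) (@measurable_id _ R setT)).
  exact: step_integral_indep hM mL.
have kE : `|K^-1| `^ alpha = k.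
  by rewrite ger0_norm ?invr_ge0 ?ltW// /k -powR_inv1 ?ltW// -powRrM mulN1r.
have sumI (h : I -> R) : \sum_o mu o * h (enum_val o) =
    k * \sum_i h i * fine (m (cell L i)).
  rewrite (sum_enum_val (fun i => `|K^-1| `^ alpha * fine (m (cell L i)) * h i)).
  by rewrite mulr_sumr; apply: eq_bigr => i _; rewrite kE -mulrA; congr (_ * _); rewrite mulrC.
have sum_mu : \sum_o mu o = k * mS.
  have := sumI (fun=> 1); under eq_bigr do rewrite mulr1.
  move=> ->; congr (_ * _); apply: EFin_inj.
  rewrite -(integral_step m (h := fun=> 1) mL)//.
  by rewrite integral_cst// mul1e; exact: mSE.
have mfx t : measurable_fun setT (f (tm t)).
  by have := hf _ (htm t); rewrite inE => /andP[+ _]; exact: set_mem.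
have mpow p (u : S -> R) : measurable_fun setT u -> measurable_fun setT (fun s => (`|u s| `^ p)%:E).
  move=> mu'; apply/measurable_EFinP; apply: (measurableT_comp (measurable_powR p)).
  exact: measurableT_comp.
have step_le p (u : S -> R) (h : I -> R) (Phi : R) : 0 < p ->
    measurable_fun setT u -> (forall s, `|h (L s)| <= `|u s| + e) ->
    e `^ p * mS <= Phi -> (\int[m]_s (`|u s| `^ p)%:E <= Phi%:E)%E ->
    \sum_i `|h i| `^ p * fine (m (cell L i)) <= 2 `^ p * 2 * Phi.
  move=> p0 mu' hh ePhi iPhi; rewrite -lee_fin.
  rewrite -(integral_step m (h := fun i => `|h i| `^ p) mL)//; last first.
  apply: (@le_trans _ _ (\int[m]_s ((2 `^ p)%:E * ((`|u s| `^ p)%:E + (e `^ p)%:E)))%E).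
    apply: ge0_le_integral => //.
    - apply/measurable_EFinP; exact: (measurable_step (fun k => `|h k| `^ p) mL).
    - by apply: measurable_funeM; apply: emeasurable_funD => //; apply: mpow.
    - move=> s _; rewrite -EFinD -EFinM lee_fin.
      apply: (@le_trans _ _ ((`|u s| + e) `^ p)).
        by apply: ge0_ler_powR; rewrite ?nnegrE ?addr_ge0 ?(ltW e0) ?(ltW p0).
      have := powRD_le `|u s| e (ltW p0).
      by rewrite normr_id (ger0_norm (ltW e0)) ger0_norm// addr_ge0// ltW.
  rewrite ge0_integralZl//; last 2 first.
    by apply: emeasurable_funD => //; exact: mpow.
    by move=> s _; rewrite adde_ge0 ?lee_fin ?powR_ge0.
  rewrite ge0_integralD//; last 2 first.
    exact: mpow.
    by move=> s _; rewrite lee_fin powR_ge0.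
  rewrite integral_cst// -mulrA EFinM; apply: lee_wpmul2l; first by rewrite lee_fin powR_ge0.
  have -> : (2 * Phi)%:E = (Phi%:E + Phi%:E)%E by rewrite -EFinD; congr EFin; ring.
  apply: leeD => //; rewrite -lee_fin EFinM -mSE in ePhi; exact: ePhi.
pose ta q : T0 := (q, inord 0). pose tb q : T0 := (q, inord 1). pose tc q : T0 := (q, inord 2).
have taE q : tm (ta q) = a q by rewrite /tm /ta/= inordK.
have tbE q : tm (tb q) = b q by rewrite /tm /tb/= inordK.
have tcE q : tm (tc q) = c q by rewrite /tm /tc/= inordK.
pose u1 q i := x (tb q) i - x (ta q) i.
pose u2 q i := x (tc q) i - x (tb q) i.
(* Outside all [A1 t] each value of [X] is within e of its step integral, and outside all [A2 o]
   truncation changes nothing. Increments above l then force the truncated forms above l / 2,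
   because 2 e <= l / 2; this is [A3]. *)
pose A1 t := [set w | e < `|X (tm t) w - step_integral M L (x t) w|].
pose A2 o := [set w | 1 <= `|xi o w|].
pose A3 q := [set w | l q / 2 < `|\sum_o (K * u1 q (enum_val o)) * clamp (xi o w)| /\
                      l q / 2 < `|\sum_o (K * u2 q (enum_val o)) * clamp (xi o w)|].
have mxi o : measurable_fun setT (xi o) by have [] := hxi o.
have mA1 t : measurable (A1 t).
  by apply: measurable_norm_gt; apply: measurable_funB => //; exact: measurable_step_integral.
have mA2 o : measurable (A2 o) by exact: measurable_norm_ge.
have mA3 q : measurable (A3 q).
  apply: measurableI; apply: measurable_norm_gt; apply: measurable_sum => o;
    apply: measurable_funM => //; apply: (measurableT_comp (@measurable_clamp R)); exact: mxi.
have mex (J : finType) (A : J -> set Omega) : (forall j, measurable (A j)) ->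
    measurable [set w | exists2 j, j \in index_enum J & A j w].
  move=> mA; rewrite (_ : [set w | _] = \bigcup_(j in [set: J]) A j).
    by apply: fin_bigcup_measurable.
  apply/seteqP; split=> w /=; first by move=> [j _ Aj]; exists j.
  by move=> [j _ Aj]; exists j => //; rewrite mem_index_enum.
apply: (@le_trans _ _ (P ([set w | exists2 t, t \in index_enum T0 & A1 t w] `|`
   ([set w | exists2 o, o \in index_enum 'I_#|I| & A2 o w] `|`
    [set w | exists2 q, q \in index_enum Q & A3 q w])))).
  apply: le_measure.
  - apply: mem_set; rewrite (_ : [set w | _] = \bigcup_(q in [set: Q])
      ([set w | l q < `|X (b q) w - X (a q) w|] `&` [set w | l q < `|X (c q) w - X (b q) w|])).
      by apply: fin_bigcup_measurable => // q _; apply: measurableI;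
        apply: measurable_norm_gt; exact: measurable_funB.
    apply/seteqP; split=> w /=; first by move=> [q [h1 h2]]; exists q.
    by move=> [q _ [h1 h2]]; exists q.
  - by apply/mem_set; apply: measurableU; [|apply: measurableU]; exact: mex.
  move=> w /= [q [h1 h2]].
  have [w1|w1] := pselect ([set w | exists2 t, t \in index_enum T0 & A1 t w] w); [by left|right].
  have [w2|w2] := pselect ([set w | exists2 o, o \in index_enum 'I_#|I| & A2 o w] w); [by left|right].
  exists q; first by rewrite mem_index_enum.
  have close t : `|X (tm t) w - step_integral M L (x t) w| <= e.
    apply: contrapT => /negP; rewrite -ltNge => h; apply: w1.
    by exists t => //; rewrite mem_index_enum.
  have small o : clamp (xi o w) = xi o w.
    apply: clampE; apply: contrapT => /negP; rewrite -ltNge => h; apply: w2.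
    by exists o; [rewrite mem_index_enum|exact: ltW].
  have JE t t' : \sum_(o < #|I|) (K * (x t' (enum_val o) - x t (enum_val o))) * clamp (xi o w) =
      step_integral M L (x t') w - step_integral M L (x t) w.
    rewrite /step_integral -sumrB -[RHS]sum_enum_val; apply: eq_bigr => o _.
    by rewrite small /xi; field; rewrite gt_eqF.
  have far t t' z : z < `|X (tm t') w - X (tm t) w| -> e <= z / 4 ->
      z / 2 < `|step_integral M L (x t') w - step_integral M L (x t) w|.
    move=> hz ez; have c1 := close t; have c2 := close t'.
    have := ler_normD (step_integral M L (x t') w - step_integral M L (x t) w)
      ((X (tm t') w - step_integral M L (x t') w) - (X (tm t) w - step_integral M L (x t) w)).
    have := ler_normB (X (tm t') w - step_integral M L (x t') w) (X (tm t) w - step_integral M L (x t) w).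
    have -> : step_integral M L (x t') w - step_integral M L (x t) w +
      (X (tm t') w - step_integral M L (x t') w - (X (tm t) w - step_integral M L (x t) w)) =
      X (tm t') w - X (tm t) w by ring.
    lra.
  split.
    by rewrite /u1 JE; apply: far => //; rewrite taE tbE.
  by rewrite /u2 JE; apply: far => //; rewrite tbE tcE.
apply: le_trans (measureU2 _ (mex _ _ mA1) (measurableU _ _ (mex _ _ mA2) (mex _ _ mA3))) _.
apply: (@le_trans _ _ (P [set w | exists2 t, t \in index_enum T0 & A1 t w] +
  (P [set w | exists2 o, o \in index_enum 'I_#|I| & A2 o w] +
   P [set w | exists2 q, q \in index_enum Q & A3 q w]))%E).
  by rewrite leeD2l//; apply: measureU2; exact: mex.
have -> : (2 * 2 `^ alpha * mS + 1) * K `^ (- alpha) = k + 2 * 2 `^ alpha * (k * mS).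
  by rewrite -/k; ring.
rewrite -addrA EFinD; apply: leeD.
  apply: (le_trans (measure_exists_le P _ mA1)).
  apply: (@le_trans _ _ (\sum_(t : T0) e%:E)%E); first by apply: lee_sum => t _; exact: hcl.
  rewrite sumEFin lee_fin sumr_const -mulr_natr; apply: le_trans ek.
  by apply: ler_wpM2l; [exact: ltW|rewrite /n3 lerDl].
rewrite EFinD; apply: leeD.
  apply: (le_trans (measure_exists_le P _ mA2)).
  rewrite -sum_mu mulr_sumr -sumEFin; apply: lee_sum => o _.
  by have := sas_tail a0 (hxi o) ltr01; rewrite divr1.
apply: (le_trans (measure_exists_le P _ mA3)).
rewrite -sumEFin; apply: lee_sum => q _.
have lq2 : 0 < l q / 2 by rewrite divr_gt0.
have muL : \sum_o mu o <= k * mS by rewrite sum_mu.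
apply: (le_trans (hJ _ xi mu _ _ _ hxi ixi muL lq2)).
have S1 (t t' : T0) : (\int[m]_s (`|f (tm t') s - f (tm t) s| `^ p1)%:E <= (Phi1 q)%:E)%E ->
    \sum_o mu o * `|K * (x t' (enum_val o) - x t (enum_val o))| `^ p1 <= E1 * Phi1 q.
  move=> hi; rewrite (sumI (fun i => `|K * (x t' i - x t i)| `^ p1)).
  have -> : \sum_i `|K * (x t' i - x t i)| `^ p1 * fine (m (cell L i)) =
      K `^ p1 * \sum_i `|x t' i - x t i| `^ p1 * fine (m (cell L i)).
    rewrite mulr_sumr; apply: eq_bigr => i _.
    by rewrite normrM powRM// (ger0_norm (ltW K0)) mulrA.
  have h := step_le p1 (fun s => f (tm t') s - f (tm t) s) (fun i => x t' i - x t i)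
    (Phi1 q) p10 (measurable_funB (mfx t') (mfx t)) (hx1 t t') (eP1 q) hi.
  rewrite mulrA (mulrC k) /E1 -[leRHS]mulrA ler_wpM2l// mulr_ge0 ?powR_ge0// ltW.
have S2 : \sum_o mu o * `|K * u1 q (enum_val o) * (K * u2 q (enum_val o))| `^ p2 <= E2 * Phi2 q.
  rewrite (sumI (fun i => `|K * u1 q i * (K * u2 q i)| `^ p2)).
  have -> : \sum_i `|K * u1 q i * (K * u2 q i)| `^ p2 * fine (m (cell L i)) =
      K `^ (2 * p2) * \sum_i `|u1 q i * u2 q i| `^ p2 * fine (m (cell L i)).
    rewrite mulr_sumr; apply: eq_bigr => i _.
    have -> : K * u1 q i * (K * u2 q i) = K ^+ 2 * (u1 q i * u2 q i) by ring.
    rewrite [in RHS]mulrA; congr (_ * _).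
    by rewrite normrM powRM// ger0_norm ?sqr_ge0// powRrM powR_mulrn// ltW.
  have mp : measurable_fun setT (fun s => (f (tm (tb q)) s - f (tm (ta q)) s) * (f (tm (tc q)) s - f (tm (tb q)) s)).
    by apply: measurable_funM; apply: measurable_funB.
  have hi : (\int[m]_s (`|(f (tm (tb q)) s - f (tm (ta q)) s) * (f (tm (tc q)) s - f (tm (tb q)) s)| `^ p2)%:E <= (Phi2 q)%:E)%E.
    by rewrite taE tbE tcE.
  have h := step_le p2 _ (fun i => u1 q i * u2 q i)
    (Phi2 q) p20 mp (hx2 (ta q) (tb q) (tc q)) (eP2 q) hi.
  rewrite mulrA (mulrC k) /E2 -[leRHS]mulrA ler_wpM2l// mulr_ge0 ?powR_ge0// ltW.
have S1a : \sum_o mu o * `|K * u1 q (enum_val o)| `^ p1 <= E1 * Phi1 q.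
  by apply: S1; rewrite taE tbE.
have S1b : \sum_o mu o * `|K * u2 q (enum_val o)| `^ p1 <= E1 * Phi1 q.
  by apply: S1; rewrite tbE tcE.
have lE p : (l q / 2) `^ (- p) = 2 `^ p * l q `^ (- p).
  rewrite powRM ?invr_ge0 ?ltW// mulrC; congr (_ * _).
  by rewrite -powR_inv1// -powRrM mulN1r opprK.
rewrite lee_fin !lE /C -[leRHS]mulrA ler_wpM2l//.
have mu0 o : 0 <= mu o by have [] := hxi o.
have SS : (\sum_o mu o * `|K * u1 q (enum_val o)| `^ p1) *
    (\sum_o mu o * `|K * u2 q (enum_val o)| `^ p1) <= E1 ^+ 2 * Phi1 q ^+ 2.
  rewrite -exprMn expr2; apply: ler_pM => //;
    by apply: sumr_ge0 => o _; rewrite mulr_ge0 ?powR_ge0.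
set z1 := l q `^ (- (2 * p1)); set z2 := l q `^ (- (2 * p2)).
have z10 : 0 <= z1 by exact: powR_ge0.
have z20 : 0 <= z2 by exact: powR_ge0.
have y1 : 2 `^ (2 * p1) * z1 * ((\sum_o mu o * `|K * u1 q (enum_val o)| `^ p1) *
    (\sum_o mu o * `|K * u2 q (enum_val o)| `^ p1)) <= (2 `^ (2 * p1) * E1 ^+ 2) * (z1 * Phi1 q ^+ 2).
  rewrite (_ : _ * E1 ^+ 2 * _ = 2 `^ (2 * p1) * z1 * (E1 ^+ 2 * Phi1 q ^+ 2)); last by ring.
  by rewrite ler_wpM2l// mulr_ge0 ?powR_ge0.
have y2 : 2 `^ (2 * p2) * z2 * (\sum_o mu o * `|K * u1 q (enum_val o) * (K * u2 q (enum_val o))| `^ p2)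
    <= (2 `^ (2 * p2) * E2) * (z2 * Phi2 q).
  rewrite (_ : _ * E2 * _ = 2 `^ (2 * p2) * z2 * (E2 * Phi2 q)); last by ring.
  by rewrite ler_wpM2l// mulr_ge0 ?powR_ge0.
apply: (le_trans (lerD y1 y2)).
have w1 : 0 <= z1 * Phi1 q ^+ 2 by rewrite mulr_ge0// exprn_ge0// ltW.
have w2 : 0 <= z2 * Phi2 q by rewrite mulr_ge0// ltW.
set B1 := 2 `^ (2 * p1) * E1 ^+ 2 in C1 *; set B2 := 2 `^ (2 * p2) * E2 in C2 *.
set v1 := z1 * _ in w1 *; set v2 := z2 * _ in w2 *.
have : 0 <= B1 * v2 by exact: mulr_ge0.
have : 0 <= B2 * v1 by exact: mulr_ge0.
lra.
Qed.

(** * Chaining along dyadic indices *)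

(** [rho] descends one level at a time. An odd index has both neighbours on the coarser level, and
    one of its two increments is small, so the step from level m costs at most theta^m. Every index
    moves to a neighbour, so the projection is monotone; this keeps three ordered times in order. *)
Lemma dyadic_chain (R : realType) (y : nat -> nat -> R) (theta : R) (n0 : nat) :
  (forall n k, y n.+1 k.*2 = y n k) ->
  (forall n k, (n0 <= n)%N -> (k.+2 <= 2 ^ n)%N ->
    `|y n k.+1 - y n k| <= theta ^+ n \/ `|y n k.+2 - y n k.+1| <= theta ^+ n) ->
  0 <= theta ->
  forall n d, (n0 <= n)%N -> exists rho : nat -> nat,
    [/\ {homo rho : k l / (k <= l)%N}, forall k, rho (k * 2 ^ d)%N = k &
        forall k, (k <= 2 ^ (n + d))%N ->
          `|y (n + d)%N k - y n (rho k)| <= \sum_(j < d) theta ^+ (n + j.+1)].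
Proof.
move=> yE small th0 n d nn0; elim: d => [|d [rho [rm rE rb]]].
  exists id; split=> // k; first by rewrite expn0 muln1.
  by rewrite addn0 subrr normr0 big_ord0.
pose m := (n + d).+1.
(* An odd point moves to the neighbour from which the increment is small. *)
pose pi k : nat := if odd k then
  (if `|y m k - y m k.-1| <= theta ^+ m then k./2 else k./2.+1) else k./2.
have pi_lb k : (k./2 <= pi k)%N by rewrite /pi; case: ifP => // _; case: ifP.
have pi_ub k : (pi k <= uphalf k)%N.
  by rewrite /pi uphalf_half; case: (odd k) => //; case: ifP.
exists (rho \o pi); split.
- move=> k l; rewrite leq_eqVlt => /orP[/eqP ->//|kl] /=; apply: rm.
  apply: (leq_trans (pi_ub k)); apply: leq_trans (pi_lb l).
  by rewrite -[uphalf k]/(k.+1./2); apply: half_leq.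
- move=> k /=; rewrite expnS mulnCA mul2n /pi odd_double doubleK; exact: rE.
- move=> k; rewrite addnS -/m => km /=.
  have [pk hk] : (pi k <= 2 ^ (n + d))%N /\ `|y m k - y (n + d)%N (pi k)| <= theta ^+ m.
    have km2 : (k <= (2 ^ (n + d)).*2)%N by rewrite -mul2n -expnS.
    split.
      apply: (leq_trans (pi_ub k)); rewrite -[uphalf k]/(k.+1./2).
      by rewrite leq_half_double ltnS.
    rewrite /pi; case: ifPn => [ok|ek]; last first.
      have kE : k = k./2.*2 by rewrite -[LHS]odd_double_half (negbTE ek).
      by rewrite {1}kE /m yE subrr normr0 exprn_ge0.
    have kE : k = k./2.*2.+1 by rewrite -[LHS]odd_double_half ok.
    have kp : k.-1 = k./2.*2 by rewrite {1}kE.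
    case: ifPn => [h|/negP h].
      by rewrite -(yE (n + d)%N k./2) -/m -kp.
    (* [k] is odd and 2^m is even, so the right neighbour of [k] is still in range. *)
    have k2 : (k./2.*2.+2 <= 2 ^ m)%N.
      rewrite /m expnS mul2n -doubleS leq_double -ltn_double (leq_trans _ km2)//.
      by rewrite {2}kE.
    have n0m : (n0 <= m)%N by rewrite /m (leq_trans nn0)// -addnS leq_addr.
    have := small m _ n0m k2; rewrite -kE => -[h'|].
      by exfalso; apply: h; rewrite kp.
    by rewrite -(yE (n + d)%N k./2.+1) -/m doubleS -kE distrC.
  rewrite big_ord_recr/= addnS -/m addrC.
  apply: le_trans (lerD hk (rb _ pk)).
  have -> : y m k - y n (rho (pi k)) = (y m k - y (n + d)%N (pi k)) + (y (n + d)%N (pi k) - y n (rho (pi k))) by ring.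
  exact: ler_normD.
Qed.

(** Indices spread over at most 2^d project into three consecutive indices j, j + 1, j + 2 of level
    n. If two successive projections coincide, the corresponding increment consists of two chains
    only; otherwise the projections are exactly j, j + 1, j + 2 and the alternative of level n
    applies. *)
Lemma dyadic_modulus (R : realType) (y : nat -> nat -> R) (theta : R) (n0 : nat) :
  (forall n k, y n.+1 k.*2 = y n k) ->
  (forall n k, (n0 <= n)%N -> (k.+2 <= 2 ^ n)%N ->
    `|y n k.+1 - y n k| <= theta ^+ n \/ `|y n k.+2 - y n k.+1| <= theta ^+ n) ->
  0 <= theta < 1 ->
  forall e : R, 0 < e -> exists n : nat, forall d k1 k2 k3,
    (k1 <= k2)%N -> (k2 <= k3)%N -> (k3 <= 2 ^ (n + d))%N -> (k3 <= k1 + 2 ^ d)%N ->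
    `|y (n + d)%N k2 - y (n + d)%N k1| <= e \/ `|y (n + d)%N k3 - y (n + d)%N k2| <= e.
Proof.
move=> yE small /andP[th0 th1] e e0.
have t1 : 0 < 1 - theta by lra.
(* One increment of level n plus two chains, each bounded by theta^n / (1 - theta). *)
pose c := 1 + 2 / (1 - theta).
have c0 : 0 < c by rewrite /c ltr_pwDl// ?divr_ge0// ltW.
have [n nn0 hn] : exists2 n, (n0 <= n)%N & c * theta ^+ n <= e.
  have /cvgrPdist_lt /(_ (e / c) (divr_gt0 e0 c0)) [N _ hN] :
      theta ^+ n @[n --> \oo] --> (0 : R) by apply: cvg_expr; rewrite ger0_norm.
  exists (maxn n0 N); first exact: leq_maxl.
  have := hN (maxn n0 N) (leq_maxr _ _); rewrite /= sub0r normrN => h.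
  rewrite mulrC -ler_pdivlMr//; apply: ltW; apply: le_lt_trans h; exact: ler_norm.
exists n => d k1 k2 k3 k12 k23 k3n k31.
have [rho [rm rE rb]] := dyadic_chain yE small th0 d nn0.
have sumE : \sum_(j < d) theta ^+ (n + j.+1) <= theta ^+ n / (1 - theta).
  rewrite ler_pdivlMr//.
  have -> : \sum_(j < d) theta ^+ (n + j.+1) = theta ^+ n.+1 * \sum_(j < d) theta ^+ j.
    by rewrite mulr_sumr; apply: eq_bigr => j _; rewrite -exprD addSnnS.
  have := subrX1 theta d; set G := \sum_(i < d) _ => hG.
  rewrite -mulrA (_ : G * (1 - theta) = 1 - theta ^+ d); last first.
    by rewrite (_ : G * _ = - ((theta - 1) * G)); [rewrite -hG; ring|ring].
  have : 0 <= theta ^+ d by exact: exprn_ge0.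
  have : theta ^+ n.+1 <= theta ^+ n by rewrite ler_wiXn2l// ltW.
  have : 0 <= theta ^+ n.+1 by exact: exprn_ge0.
  by nra.
set E := \sum_(j < d) _ in rb sumE.
have hE : theta ^+ n + 2 * E <= e.
  apply: le_trans hn.
  have -> : c * theta ^+ n = theta ^+ n + 2 * (theta ^+ n / (1 - theta)) by rewrite /c; ring.
  lra.
have E2 : 2 * E <= e by have := exprn_ge0 n th0; lra.
have k2n : (k2 <= 2 ^ (n + d))%N by exact: leq_trans k3n.
have k1n : (k1 <= 2 ^ (n + d))%N by exact: leq_trans k2n.
have b1 := rb _ k1n; have b2 := rb _ k2n; have b3 := rb _ k3n.
have close k k' z : `|y (n + d)%N k - y n (rho k)| <= E ->
    `|y (n + d)%N k' - y n (rho k')| <= E -> `|y n (rho k') - y n (rho k)| <= z ->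
    `|y (n + d)%N k' - y (n + d)%N k| <= z + 2 * E.
  move=> h1 h2 h3.
  have -> : y (n + d)%N k' - y (n + d)%N k = ((y (n + d)%N k' - y n (rho k'))
    - (y (n + d)%N k - y n (rho k))) + (y n (rho k') - y n (rho k)) by ring.
  apply: (le_trans (ler_normD _ _)).
  have := ler_normB (y (n + d)%N k' - y n (rho k')) (y (n + d)%N k - y n (rho k)).
  lra.
pose j := (k1 %/ 2 ^ d)%N.
have p2 : (0 < 2 ^ d)%N by rewrite expn_gt0.
have r1 : (j <= rho k1)%N by rewrite -{1}(rE j); apply: rm; exact: leq_trunc_div.
have r3 : (rho k3 <= j.+2)%N.
  rewrite -(rE j.+2); apply: rm; apply: (leq_trans k31).
  by rewrite mulSn addnC leq_add2l ltnW// -ltn_divLR.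
have r3n : (rho k3 <= 2 ^ n)%N by rewrite -(rE (2 ^ n)%N); apply: rm; rewrite -expnD.
have r12 := rm _ _ k12; have r23 := rm _ _ k23.
have [e12|n12] := eqVneq (rho k2) (rho k1).
  left; have := close k1 k2 0 b1 b2; rewrite e12 subrr normr0 add0r => /(_ (lexx _)).
  by move=> h; apply: (le_trans h).
have [e23|n23] := eqVneq (rho k3) (rho k2).
  right; have := close k2 k3 0 b2 b3; rewrite e23 subrr normr0 add0r => /(_ (lexx _)).
  by move=> h; apply: (le_trans h).
have l12 : (rho k1 < rho k2)%N by rewrite ltn_neqAle eq_sym n12.
have l23 : (rho k2 < rho k3)%N by rewrite ltn_neqAle eq_sym n23.
have e1 : rho k1 = j by apply/eqP; rewrite eqn_leq r1 andbT -ltnS -ltnS (leq_trans _ r3)// (leq_ltn_trans l12).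
have e2 : rho k2 = j.+1.
  by apply/eqP; rewrite eqn_leq -{2}e1 l12 andbT -ltnS (leq_trans l23).
have e3 : rho k3 = j.+2 by apply/eqP; rewrite eqn_leq r3 -e2 l23.
have j2 : (j.+2 <= 2 ^ n)%N by rewrite -e3.
case: (small n j nn0 j2) => h; [left|right].
  by apply: le_trans hE; apply: close => //; rewrite e1 e2.
by apply: le_trans hE; apply: close => //; rewrite e2 e3.
Qed.

(** * From the three-point modulus to one-sided limits *)

(** If some pair p0 < q0 to the right of t is more than e / 2 apart, every r in (t, p0) is within e
    / 2 of p0, as the second of the two increments is the large one; so the oscillation on (t, p0)
    is at most e. If no such pair exists there is nothing to do. *)
Lemma right_oscillation (R : realType) (x : R -> R) (D : set R) (t : R) :
  (forall e : R, 0 < e -> exists2 h : R, 0 < h & forall p q r, D p -> D q -> D r ->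
    t < p -> p < q -> q < r -> r < t + h -> `|x q - x p| <= e \/ `|x r - x q| <= e) ->
  forall e : R, 0 < e -> exists2 h : R, 0 < h & forall p q, D p -> D q ->
    t < p < t + h -> t < q < t + h -> `|x p - x q| <= e.
Proof.
move=> H e e0; have e20 : 0 < e / 2 by rewrite divr_gt0.
have [h h0 hH] := H _ e20.
have [[p0 [q0 [Dp [Dq [tp [pq [qt far]]]]]]]|no] := pselect (exists p q,
    D p /\ D q /\ t < p /\ p < q /\ q < t + h /\ e / 2 < `|x q - x p|).
  exists (p0 - t); first by rewrite subr_gt0.
  have near r : D r -> t < r < t + (p0 - t) -> `|x p0 - x r| <= e / 2.
    move=> Dr /andP[tr rp]; have rp' : r < p0 by lra.
    case: (hH r p0 q0 Dr Dp Dq tr rp' pq qt) => // bad.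
    by move: far; rewrite ltNge bad.
  move=> p q Dp' Dq' hp hq.
  have := near p Dp' hp; have := near q Dq' hq.
  have := ler_normB (x p0 - x q) (x p0 - x p).
  have -> : x p0 - x q - (x p0 - x p) = x p - x q by ring.
  lra.
exists h => // p q Dp Dq /andP[tp pt] /andP[tq qt].
have key a b : D a -> D b -> t < a -> a < b -> b < t + h -> `|x b - x a| <= e.
  move=> Da Db ta ab bt; apply: contrapT => /negP; rewrite -ltNge => far.
  by apply: no; exists a, b; do 5 split => //; lra.
have [pq|pq|->] := ltgtP p q.
- by rewrite distrC; exact: key.
- exact: key.
- by rewrite subrr normr0 ltW.
Qed.

(** By time reversal. *)
Lemma left_oscillation (R : realType) (x : R -> R) (D : set R) (t : R) :
  (forall e : R, 0 < e -> exists2 h : R, 0 < h & forall p q r, D p -> D q -> D r ->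
    t - h < p -> p < q -> q < r -> r < t -> `|x q - x p| <= e \/ `|x r - x q| <= e) ->
  forall e : R, 0 < e -> exists2 h : R, 0 < h & forall p q, D p -> D q ->
    t - h < p < t -> t - h < q < t -> `|x p - x q| <= e.
Proof.
move=> H e e0.
have H' e' : 0 < e' -> exists2 h : R, 0 < h & forall p q r, D (- p) -> D (- q) -> D (- r) ->
    - t < p -> p < q -> q < r -> r < - t + h ->
    `|x (- q) - x (- p)| <= e' \/ `|x (- r) - x (- q)| <= e'.
  move=> e'0; have [h h0 hH] := H _ e'0; exists h => // p q r Dp Dq Dr tp pq qr rt.
  case: (hH (- r) (- q) (- p)) => //; rewrite ?ltrN2//; try lra.
    by right; rewrite distrC.
  by left; rewrite distrC.
have [h h0 hh] := right_oscillation (x := fun u => x (- u)) (D := fun u => D (- u)) H' e0.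
exists h => // p q Dp Dq /andP[hp pt] /andP[hq qt].
have := hh (- p) (- q); rewrite !opprK; apply => //; apply/andP; split; lra.
Qed.

Lemma within_continuousP01 (R : realType) (H : R -> R) :
  {within `[0, 1], continuous H} -> forall t e : R, 0 <= t <= 1 -> 0 < e ->
  exists2 h : R, 0 < h & forall u, 0 <= u <= 1 -> `|t - u| < h -> `|H t - H u| < e.
Proof.
move=> /subspace_continuousP cH t e t01 e0.
have /cH /cvgrPdist_lt /(_ e e0) : `[0, 1]%classic t by rewrite /= in_itv.
rewrite near_withinE => -[h /= h0 hh].
by exists h => // u u01 tu; apply: hh => //=; rewrite in_itv.
Qed.

Lemma right_limit_cvg (R : realType) (x : R -> R) (D : set R) (t : R) (s : nat -> R) :
  (forall e : R, 0 < e -> exists2 h : R, 0 < h & forall p q, D p -> D q ->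
    t < p < t + h -> t < q < t + h -> `|x p - x q| <= e) ->
  (forall j, D (s j)) -> (forall j, t < s j < t + j.+1%:R^-1) ->
  cvgn (fun j => x (s j)).
Proof.
move=> H Ds hs; apply/cauchy_cvgP/cauchy_exP => e e0.
have [h h0 hh] := H _ (divr_gt0 e0 (ltr0Sn R 1)).
have [N _ hN] := near_infty_natSinv_lt (PosNum h0).
have near j : (N <= j)%N -> t < s j < t + h.
  move=> Nj; have /andP[-> h2] := hs j; apply: (lt_trans h2).
  by rewrite ltrD2l; exact: hN.
exists (x (s N)); exists N => // j /= Nj.
rewrite /ball/=; have := hh (s N) (s j) (Ds _) (Ds _) (near _ (leqnn N)) (near _ Nj).
lra.
Qed.

(** [y t] is a limit of [x] along a sequence in [D] approaching t from the right, so a bound on |x p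
    - x q| for all q of [D] around u is inherited by |x p - y u|; this is [approx]. Small
    oscillation on the right of t then gives right-continuity of [y], and on the left the Cauchy
    property. *)
Lemma cadlag_regularization (R : realType) (x y : R -> R) (D : set R)
    (s : R -> nat -> R) :
  (forall t j, 0 <= t < 1 -> D (s t j)) ->
  (forall t j, 0 <= t < 1 -> t < s t j < t + j.+1%:R^-1) ->
  (forall t h, 0 < t <= 1 -> 0 < h -> exists2 p, D p & t - h < p < t) ->
  (forall t e, 0 <= t < 1 -> 0 < e -> exists2 h : R, 0 < h & forall p q, D p -> D q ->
    t < p < t + h -> t < q < t + h -> `|x p - x q| <= e) ->
  (forall t e, 0 < t <= 1 -> 0 < e -> exists2 h : R, 0 < h & forall p q, D p -> D q ->
    t - h < p < t -> t - h < q < t -> `|x p - x q| <= e) ->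
  (forall t, 0 <= t < 1 -> x (s t j) @[j --> \oo] --> y t) ->
  cadlag01 y.
Proof.
move=> Ds hs dl hR hL hy.
have approx u a b p e : 0 <= u < 1 -> a <= u -> u < b ->
    (forall q, D q -> a < q < b -> `|x p - x q| <= e) -> `|x p - y u| <= e.
  move=> u01 au ub hq; apply/ler_addgt0Pr => eta eta0.
  have bu : 0 < b - u by rewrite subr_gt0.
  have [N1 _ hN1] := near_infty_natSinv_lt (PosNum bu).
  have /cvgrPdist_lt /(_ eta eta0) [N2 _ hN2] := hy u u01.
  pose j := maxn N1 N2.
  have h1 : j.+1%:R^-1 < b - u := hN1 j (leq_maxl _ _); have h2 := hN2 j (leq_maxr _ _).
  have /andP[us su] := hs u j u01.
  have h3 : `|x p - x (s u j)| <= e.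
    apply: hq; first exact: Ds.
    apply/andP; split; first exact: le_lt_trans us.
    by apply: (lt_trans su); rewrite -ltrBrDl.
  have -> : x p - y u = (x p - x (s u j)) - (y u - x (s u j)) by ring.
  apply: (le_trans (ler_normB _ _)); apply: lerD => //; exact: ltW.
split=> t t01.
- apply/cvgrPdist_lt => e e0; have e4 : 0 < e / 4 by rewrite divr_gt0.
  have [h h0 hh] := hR t _ t01 e4.
  have /andP[t0 t1] := t01.
  have [N _ hN] := near_infty_natSinv_lt (PosNum h0).
  have hp : t < s t N < t + h.
    have /andP[-> h2] := hs t N t01; apply: (lt_trans h2).
    by rewrite ltrD2l; exact: (hN N (leqnn N)).
  have close u : 0 <= u < 1 -> t <= u -> u < t + h -> `|x (s t N) - y u| <= e / 4.
    move=> u01 tu uh; apply: (approx u t (t + h)) => // q Dq hq.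
    by apply: hh => //; exact: Ds.
  have ct : `|x (s t N) - y t| <= e / 4 by apply: close => //; lra.
  near=> u.
  have tu : t < u by near: u; exact: nbhs_right_gt.
  have u1 : u < 1 by near: u; exact: nbhs_right_lt.
  have uh : u < t + h by near: u; apply: nbhs_right_lt; lra.
  have cu : `|x (s t N) - y u| <= e / 4 by apply: close => //; lra.
  have -> : y t - y u = (x (s t N) - y u) - (x (s t N) - y t) by ring.
  have := ler_normB (x (s t N) - y u) (x (s t N) - y t); lra.
- apply/cauchy_cvgP/cauchy_exP => e e0; have e2 : 0 < e / 2 by rewrite divr_gt0.
  have [h h0 hh] := hL t _ t01 e2.
  have /andP[t0 t1] := t01.
  have [p Dp hp] := dl t h t01 h0.
  exists (x p).
  suff : \forall u \near t^'-, `|x p - y u| < e by [].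
  near=> u.
  have ut : u < t by near: u; exact: nbhs_left_lt.
  have u0 : 0 < u by near: u; exact: nbhs_left_gt.
  have uh : t - h < u by near: u; apply: nbhs_left_gt; lra.
  have : `|x p - y u| <= e / 2.
    apply: (approx u (t - h) t) => //; [lra|exact: ltW|].
    by move=> q Dq hq; exact: hh.
  lra.
Unshelve. all: by end_near. Qed.

(** * The time scale *)

(** [H] is F1 + F2 + id, normalised to run from 0 to 1. The identity makes it strictly increasing
    where F1 and F2 are constant and accounts for the 1 in [l], so that [l] is positive. [tau] is a
    right inverse given by the intermediate value theorem. *)
Lemma time_change (R : realType) (F1 F2 : R -> R) :
  {in `[0, 1] &, {homo F1 : x y / x <= y}} ->
  {within `[0, 1], continuous F1} ->
  {in `[0, 1] &, {homo F2 : x y / x <= y}} ->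
  {within `[0, 1], continuous F2} ->
  exists (l : R) (H tau : R -> R), [/\ 0 < l,
    {within `[0, 1], continuous H},
    forall s t, 0 <= s -> s < t -> t <= 1 -> H s < H t,
    forall s t, 0 <= s -> s <= t -> t <= 1 ->
      `|F1 t - F1 s| <= l * (H t - H s) /\ `|F2 t - F2 s| <= l * (H t - H s) &
    [/\ H 0 = 0, H 1 = 1 & forall u, 0 <= u <= 1 -> 0 <= tau u <= 1 /\ H (tau u) = u]].
Proof.
move=> m1 c1 m2 c2.
have in01 t : 0 <= t <= 1 -> t \in `[(0 : R), 1] by rewrite in_itv.
have M1 s t : 0 <= s -> s <= t -> t <= 1 -> F1 s <= F1 t.
  by move=> ? ? ?; apply: m1 => //; apply: in01; lra.
have M2 s t : 0 <= s -> s <= t -> t <= 1 -> F2 s <= F2 t.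
  by move=> ? ? ?; apply: m2 => //; apply: in01; lra.
pose l := F1 1 - F1 0 + (F2 1 - F2 0) + 1.
have l0 : 0 < l by have := M1 0 1 (lexx _) ler01 (lexx _); have := M2 0 1 (lexx _) ler01 (lexx _); rewrite /l; lra.
pose H t := (F1 t + F2 t + t - (F1 0 + F2 0)) / l.
have HB s t : l * (H t - H s) = (F1 t - F1 s) + (F2 t - F2 s) + (t - s).
  by rewrite /H; field; rewrite gt_eqF.
have cH : {within `[0, 1], continuous H}.
  move=> t; apply: cvgM; last exact: cvg_cst.
  apply: cvgB; last exact: cvg_cst.
  apply: cvgD; first by apply: cvgD; [exact: c1|exact: c2].
  by have : {within `[0, 1], continuous (@id R)} by [apply: continuous_subspaceT => u; exact: cvg_id]; exact.
have H0 : H 0 = 0 by rewrite /H addr0 subrr mul0r.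
have H1 : H 1 = 1 by rewrite /H -[RHS](mulfV (lt0r_neq0 l0)); congr (_ / _); rewrite /l; ring.
have ex u : exists v, 0 <= u <= 1 -> 0 <= v <= 1 /\ H v = u.
  have [u01|u01] := boolP (0 <= u <= 1); last by exists 0.
  have [|v] := @IVT R H 0 1 u ler01 cH.
    by rewrite H0 H1 (min_idPl ler01) (max_idPr ler01).
  by rewrite in_itv/= => v01 Hv; exists v.
exists l, H, (fun u => projT1 (cid (ex u))); split=> //.
- move=> s t s0 st t1; rewrite -subr_gt0 -(pmulr_rgt0 _ l0) HB.
  have := M1 s t s0 (ltW st) t1; have := M2 s t s0 (ltW st) t1; lra.
- move=> s t s0 st t1; rewrite HB; have h1 := M1 s t s0 st t1; have h2 := M2 s t s0 st t1.
  by rewrite !ger0_norm ?subr_ge0//; split; lra.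
- split=> // u u01; by case: (cid (ex u)) => v /= /(_ u01).
Qed.

(** * Borel-Cantelli with a truncation parameter *)

Lemma powRN_small (R : realType) (alpha c e : R) : 0 < alpha -> 0 <= c -> 0 < e ->
  exists2 K : R, 0 < K & c * K `^ (- alpha) <= e.
Proof.
move=> a0 c0 e0; pose z := 1 + c / e.
have z0 : 0 < z by rewrite /z ltr_pwDl// divr_ge0// ltW.
exists (z `^ alpha^-1); first exact: powR_gt0.
rewrite -powRrM mulrN mulVf ?gt_eqF// powRN powRr1 ?(ltW z0)//.
rewrite ler_pdivrMr// /z (_ : e * _ = e + c); first lra.
by field; rewrite gt_eqF.
Qed.

(** The bound on a finite union contains a term that does not decay with the starting level [n0], so
    summability of the individual probabilities is not at hand. K is fixed to make that term small,
    then [n0], and continuity from below passes to the infinite union. *)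
Lemma lim_sup_set_null (d : measure_display) (T : measurableType d)
    (R : realType) (P : probability T R) (U : nat -> set T) (alpha c0 : R) :
  (forall n, measurable (U n)) -> 0 < alpha -> 0 <= c0 ->
  (forall K : R, 0 < K -> exists2 C : R, 0 <= C & exists2 r : R, 0 <= r < 1 &
    forall n0 N : nat, (P (\bigcup_(i in `I_N) U (n0 + i)%N)
      <= (c0 * K `^ (- alpha) + C * r ^+ n0)%:E)%E) ->
  P (lim_sup_set U) = 0%E.
Proof.
move=> mU a0 c00 H; apply/eqP; rewrite eq_le measure_ge0 andbT.
apply/lee_addgt0Pr => e e0; rewrite add0e.
have [K K0 hz] := powRN_small a0 c00 (divr_gt0 e0 (ltr0Sn R 1)).
have [C C0 [r /andP[r0 r1] h]] := H K K0.
have [n0 hn0] : exists n0 : nat, C * r ^+ n0 <= e / 2.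
  have C1 : 0 < C + 1 by lra.
  have /cvgrPdist_lt /(_ (e / 2 / (C + 1))) : r ^+ n @[n --> \oo] --> (0 : R).
    by apply: cvg_expr; rewrite ger0_norm.
  rewrite !divr_gt0// => /(_ isT) [N _ hN]; exists N.
  have := hN N (leqnn N); rewrite /= sub0r normrN ger0_norm ?exprn_ge0//.
  rewrite ltr_pdivlMr// => hr; apply: le_trans (ltW hr).
  by rewrite mulrC ler_wpM2l ?exprn_ge0//; lra.
apply: (le_trans (lim_sup_set_ub P n0 mU)).
have -> : \bigcup_(k in [set k | (n0 <= k)%N]) U k =
    \bigcup_N \bigcup_(i in `I_N) U (n0 + i)%N.
  apply/seteqP; split=> w /=.
    move=> [k /= nk Uk]; exists (k - n0).+1 => //; exists (k - n0)%N => /=; first exact: ltnSn.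
    by rewrite subnKC.
  by move=> [N _ [i /= _ Ui]]; exists (n0 + i)%N => //=; exact: leq_addr.
have mB N : measurable (\bigcup_(i in `I_N) U (n0 + i)%N) by apply: bigcup_measurable.
have cv := @nondecreasing_cvg_mu _ _ _ P (fun N => \bigcup_(i in `I_N) U (n0 + i)%N) mB.
have {}cv := cv (bigcup_measurable (fun N _ => mB N)).
have nd : {homo (fun N => \bigcup_(i in `I_N) U (n0 + i)%N) : n m / (n <= m)%N >-> (n <= m)%O}.
  move=> N1 N2 N12; apply/subsetPset => w [i /= iN Ui]; exists i => //=; exact: leq_trans N12.
have {}cv := cv nd.
rewrite -(cvg_lim _ cv)//; apply: lime_le; first exact: cvgP cv.
near=> N => /=; apply: (le_trans (h n0 N)); rewrite lee_fin; lra.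
Unshelve. all: by end_near. Qed.

(** The contribution of level n: about 2^n pairs, threshold 2^(-kappa n), moment bound (L / 2^n)^(2
    beta). It is geometric, with exponent 2 p kappa from the threshold, 1 from the number of pairs
    and -2 beta from the moments. *)
Lemma level_term (R : realType) (p beta kappa L : R) (n : nat) : 0 < L ->
  2 ^+ n * ((((2 : R) `^ (- kappa)) ^+ n) `^ (- (2 * p)) * (L / 2 ^+ n) `^ (2 * beta))
  = L `^ (2 * beta) * ((2 : R) `^ (2 * p * kappa + 1 - 2 * beta)) ^+ n.
Proof.
move=> L0.
have p2 x : 0 <= (2 : R) `^ x by exact: powR_ge0.
have -> : (2 : R) ^+ n = 2 `^ n%:R by rewrite powR_mulrn.
rewrite -!powR_mulrn ?powR_ge0// -!powRrM powRM ?invr_ge0 ?powR_ge0 ?(ltW L0)//.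
rewrite -powRN -powRrM.
rewrite mulrCA mulrCA [X in _ * X]mulrCA [LHS]mulrCA.
rewrite -!powRD ?pnatr_eq0 ?implybT//; congr (_ * _ `^ _); ring.
Qed.

(** The grid bound is applied once to all adjacent pairs of the N levels starting at [n0]; what
    depends on the grid is then a geometric sum. *)
Lemma dyadic_oscillation_null (d d' : measure_display) (Omega : measurableType d)
    (S : measurableType d') (R : realType) (P : probability Omega R)
    (alpha p1 p2 : R) (m : {finite_measure set S -> \bar R})
    (M : set S -> {RV P >-> R}) (X : R -> {RV P >-> R}) (f : R -> S -> R)
    (beta1 beta2 L : R) (T : nat -> nat -> R) :
  1 < alpha < 2 -> alpha < p1 -> alpha / 2 < p2 ->
  is_sas_random_measure alpha m M ->
  (forall t : R, 0 <= t <= 1 -> f t \in Lfun m alpha%:E) ->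
  (forall t : R, 0 <= t <= 1 -> is_stable_integral alpha m M (f t) (X t)) ->
  2^-1 < beta1 -> 2^-1 < beta2 -> 0 < L ->
  (forall n k, (k <= 2 ^ n)%N -> 0 <= T n k <= 1) ->
  (forall n k, (k < 2 ^ n)%N ->
    \int[m]_s (`|f (T n k.+1) s - f (T n k) s| `^ p1)%:E
      <= ((L / 2 ^+ n) `^ beta1)%:E)%E ->
  (forall n k, (k.+2 <= 2 ^ n)%N ->
    \int[m]_s (`|(f (T n k.+1) s - f (T n k) s)
        * (f (T n k.+2) s - f (T n k.+1) s)| `^ p2)%:E
      <= ((L / 2 ^+ n) `^ (2 * beta2))%:E)%E ->
  exists2 theta : R, 0 <= theta < 1 &
    (forall n, measurable [set w | exists2 k, (k.+2 <= 2 ^ n)%N &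
      theta ^+ n < `|X (T n k.+1) w - X (T n k) w| /\
      theta ^+ n < `|X (T n k.+2) w - X (T n k.+1) w| ]) /\
    P (lim_sup_set (fun n => [set w | exists2 k, (k.+2 <= 2 ^ n)%N &
      theta ^+ n < `|X (T n k.+1) w - X (T n k) w| /\
      theta ^+ n < `|X (T n k.+2) w - X (T n k.+1) w| ])) = 0%E.
Proof.
move=> a12 ap1 ap2 hM hf hXf hb1 hb2 L0 T01 H1 H2.
have /andP[a1 a2] := a12.
have p10 : 0 < p1 by lra.
have p20 : 0 < p2 by lra.
(* theta = 2^-kappa is chosen so that 2 p kappa + 1 - 2 beta < 0 for both pairs. *)
pose kappa := Num.min ((2 * beta1 - 1) / (4 * p1)) ((2 * beta2 - 1) / (4 * p2)).
have kp1 : kappa * (4 * p1) <= 2 * beta1 - 1.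
  by rewrite -ler_pdivlMr ?mulr_gt0// ge_min lexx.
have kp2 : kappa * (4 * p2) <= 2 * beta2 - 1.
  by rewrite -ler_pdivlMr ?mulr_gt0// ge_min lexx orbT.
have k0 : 0 < kappa by rewrite lt_min !divr_gt0 ?mulr_gt0//; lra.
pose theta := (2 : R) `^ (- kappa).
have th0 : 0 < theta by exact: powR_gt0.
have th1 : theta < 1 by apply: powR2_lt1; lra.
have thn n : 0 < theta ^+ n by exact: exprn_gt0.
exists theta; first by rewrite (ltW th0).
pose V n k := [set w | theta ^+ n < `|X (T n k.+1) w - X (T n k) w| /\
      theta ^+ n < `|X (T n k.+2) w - X (T n k.+1) w| ].
have mV n k : measurable (V n k).
  by apply: measurableI; apply: measurable_norm_gt; apply: measurable_funB.
have mU n : measurable [set w | exists2 k, (k.+2 <= 2 ^ n)%N & V n k w].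
  have := @bigcup_measurable _ _ (V n) [set k | (k.+2 <= 2 ^ n)%N] (fun k _ => mV n k).
  by congr (measurable _).
split; first exact: mU.
have [c0 c00 hg] := grid_bound a12 ap1 ap2 hM hf hXf.
apply: (lim_sup_set_null mU (alpha := alpha) (c0 := c0)) => //; first lra.
move=> K K0; have [C C0 {}hg] := hg K K0.
pose r1 := (2 : R) `^ (2 * p1 * kappa + 1 - 2 * beta1).
pose r2 := (2 : R) `^ (2 * p2 * kappa + 1 - 2 * beta2).
have r10 : 0 <= r1 by exact: powR_ge0.
have r20 : 0 <= r2 by exact: powR_ge0.
have r11 : r1 < 1 by apply: powR2_lt1; have := mulr_gt0 k0 p10; lra.
have r21 : r2 < 1 by apply: powR2_lt1; have := mulr_gt0 k0 p20; lra.
pose r := Num.max r1 r2.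
have r0 : 0 <= r by rewrite le_max r10.
have rlt1 : r < 1 by rewrite gt_max r11.
have r1' : 0 < 1 - r by lra.
pose LL := L `^ (2 * beta1) + L `^ (2 * beta2).
have LL0 : 0 <= LL by rewrite addr_ge0 ?powR_ge0.
exists (C * LL / (1 - r)); first by rewrite divr_ge0 ?mulr_ge0 // ltW.
exists r; first by rewrite r0.
move=> n0 N.
(* The 2^n increments of level n form 2^n - 1 adjacent pairs; level 0 has none. *)
pose Q := {i : 'I_N & 'I_((2 ^ (n0 + i)).-1)}.
pose lev (q : Q) := (n0 + tag q)%N.
pose pos (q : Q) : nat := tagged q.
have posP q : ((pos q).+2 <= 2 ^ lev q)%N.
  have := ltn_ord (tagged q); rewrite -/(pos q) -/(lev q).
  by rewrite -ltnS prednK ?expn_gt0.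
have LE n : 0 < L / (2 : R) ^+ n by rewrite divr_gt0 ?exprn_gt0.
have := hg Q (fun q => T (lev q) (pos q)) (fun q => T (lev q) (pos q).+1)
  (fun q => T (lev q) (pos q).+2) (fun q => theta ^+ lev q)
  (fun q => (L / 2 ^+ lev q) `^ beta1) (fun q => (L / 2 ^+ lev q) `^ (2 * beta2)).
move=> /(_ _ _ _ _ _ _ _ _ _) hb.
have {}hb := hb (fun q => T01 _ _ (ltnW (ltnW (posP q)))) (fun q => T01 _ _ (ltnW (posP q)))
  (fun q => T01 _ _ (posP q)) (fun q => thn _) (fun q => powR_gt0 _ (LE _))
  (fun q => powR_gt0 _ (LE _)) (fun q => H1 _ _ (ltnW (posP q)))
  (fun q => H1 _ _ (posP q)) (fun q => H2 _ _ (posP q)).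
have -> : \bigcup_(i in `I_N) [set w | exists2 k, (k.+2 <= 2 ^ (n0 + i))%N & V (n0 + i)%N k w] =
    [set w | exists q : Q, V (lev q) (pos q) w].
  apply/seteqP; split=> w /=.
    move=> [i /= iN [k k2 Vk]].
    have kl : (k < (2 ^ (n0 + Ordinal iN)).-1)%N by rewrite /= -ltnS prednK ?expn_gt0.
    by exists (Tagged (fun i : 'I_N => 'I_((2 ^ (n0 + i)).-1)) (Ordinal kl)).
  by move=> [q Vq]; exists (tag q); [exact: ltn_ord|exists (pos q)].
apply: (le_trans hb); rewrite lee_fin lerD2l.
pose G n := C * ((theta ^+ n) `^ (- (2 * p1)) * ((L / 2 ^+ n) `^ beta1) ^+ 2
  + (theta ^+ n) `^ (- (2 * p2)) * (L / 2 ^+ n) `^ (2 * beta2)).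
have G0 n : 0 <= G n by rewrite mulr_ge0// addr_ge0 ?mulr_ge0 ?exprn_ge0 ?powR_ge0.
rewrite -[leLHS]/(\sum_(q : Q) G (lev q)).
have -> : \sum_(q : Q) G (lev q) = \sum_(i < N) \sum_(j < (2 ^ (n0 + i)).-1) G (n0 + i)%N.
  by rewrite sig_big_dep.
have Gle n : 2 ^+ n * G n <= C * LL * r ^+ n.
  rewrite /G mulrCA -mulrA; apply: ler_wpM2l => //.
  rewrite mulrDr -(powR_mulrn 2 (powR_ge0 (L / 2 ^+ n) beta1)) -powRrM (mulrC beta1).
  rewrite !level_term//.
  rewrite /LL [leRHS]mulrDl.
  apply: lerD; apply: ler_wpM2l; rewrite ?powR_ge0//.
    by apply: lerXn2r; rewrite ?nnegrE// le_max lexx.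
  by apply: lerXn2r; rewrite ?nnegrE// le_max lexx orbT.
apply: (@le_trans _ _ (\sum_(i < N) C * LL * r ^+ n0 * r ^+ i)).
  apply: ler_sum => i _; rewrite sumr_const card_ord -mulr_natl -mulrA -exprD.
  apply: le_trans (Gle _); apply: ler_wpM2r => //.
  by rewrite -natrX ler_nat leq_pred.
rewrite -mulr_sumr [leRHS]mulrAC; apply: ler_wpM2l.
  by rewrite !mulr_ge0// exprn_ge0.
rewrite -[leRHS]mul1r ler_pdivlMr//.
have := subrX1 r N; set Z := \sum_(i < N) _ => hG.
rewrite (_ : Z * (1 - r) = 1 - r ^+ N); last first.
  by rewrite (_ : Z * _ = - ((r - 1) * Z)); [rewrite -hG; ring|ring].
by have := exprn_ge0 N r0; lra.
Qed.

(** * Paths along the dyadic times *)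

Definition dyadic_time (R : realType) (tau : R -> R) : set R :=
  [set p | exists n k : nat, (k <= 2 ^ n)%N /\ p = tau (k%:R / 2 ^+ n)].

Lemma dyadic_itv (R : realType) (n k : nat) : (k <= 2 ^ n)%N ->
  0 <= (k%:R : R) / 2 ^+ n <= 1.
Proof.
move=> kn; rewrite divr_ge0//= ler_pdivrMr ?exprn_gt0// mul1r -natrX ler_nat.
exact: kn.
Qed.

Lemma dyadic_refine (R : realType) (n e k : nat) :
  ((k * 2 ^ e)%N%:R : R) / 2 ^+ (n + e) = k%:R / 2 ^+ n.
Proof. by rewrite natrM natrX exprD; field; rewrite !expf_neq0 ?pnatr_eq0. Qed.

Lemma dyadic_time_dense (R : realType) (H tau : R -> R) :
  (forall s t, 0 <= s -> s < t -> t <= 1 -> H s < H t) ->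
  (forall u, 0 <= u <= 1 -> 0 <= tau u <= 1 /\ H (tau u) = u) ->
  H 0 = 0 -> H 1 = 1 ->
  forall s t, 0 <= s -> s < t -> t <= 1 -> exists2 p, dyadic_time tau p & s < p < t.
Proof.
move=> HS Htau H0 H1 s t s0 st t1.
have st' : 0 < H t - H s by rewrite subr_gt0 HS.
have Hle u v : 0 <= u -> u <= v -> v <= 1 -> H u <= H v.
  by move=> u0; rewrite le_eqVlt => /orP[/eqP ->//|uv] v1; apply/ltW/HS.
have [n _ /(_ n (leqnn n)) /= hn] := near_infty_natSinv_expn_lt (PosNum st').
have E0 : 0 < (2 : R) ^+ n by exact: exprn_gt0.
have Hs0 : 0 <= H s by rewrite -H0; apply: Hle => //; lra.
have Ht1 : H t <= 1 by rewrite -H1; apply: Hle => //; lra.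
(* [k] is the integer part of 2^n H(s); as 2^-n < H(t) - H(s), the next dyadic point (k + 1) / 2^n
   lies strictly between H(s) and H(t). *)
have /andP[k1 k2] := truncn_itv (mulr_ge0 Hs0 (ltW E0)).
set k := Num.trunc _ in k1 k2.
have l1 : H s < k.+1%:R / 2 ^+ n by rewrite ltr_pdivlMr.
have l2 : k.+1%:R / 2 ^+ n < H t.
  rewrite -addn1 natrD mulrDl.
  have : k%:R / 2 ^+ n <= H s by rewrite ler_pdivrMr.
  lra.
have kn : (k.+1 <= 2 ^ n)%N.
  rewrite -(ler_nat R) natrX -[leRHS]mul1r -ler_pdivrMr//; lra.
have [p01 Hp] := Htau _ (dyadic_itv R kn); have /andP[p0 p1] := p01.
exists (tau (k.+1%:R / 2 ^+ n)); first by exists n, k.+1.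
apply/andP; split; rewrite ltNge; apply/negP => h.
  by have := Hle _ _ p0 h (le_trans (ltW st) t1); rewrite Hp; lra.
by have := Hle _ _ (le_trans s0 (ltW st)) h p1; rewrite Hp; lra.
Qed.

Lemma dyadic_path_modulus (R : realType) (H tau x : R -> R) (theta : R) (n0 : nat) :
  (forall s t, 0 <= s -> s < t -> t <= 1 -> H s < H t) ->
  (forall u, 0 <= u <= 1 -> 0 <= tau u <= 1 /\ H (tau u) = u) ->
  0 <= theta < 1 ->
  (forall n k, (n0 <= n)%N -> (k.+2 <= 2 ^ n)%N ->
    `|x (tau (k.+1%:R / 2 ^+ n)) - x (tau (k%:R / 2 ^+ n))| <= theta ^+ n \/
    `|x (tau (k.+2%:R / 2 ^+ n)) - x (tau (k.+1%:R / 2 ^+ n))| <= theta ^+ n) ->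
  forall e : R, 0 < e -> exists2 eta : R, 0 < eta & forall p q r,
    dyadic_time tau p -> dyadic_time tau q -> dyadic_time tau r ->
    p < q -> q < r -> H r - H p < eta -> `|x q - x p| <= e \/ `|x r - x q| <= e.
Proof.
move=> HS Htau th small e e0.
pose y n k := x (tau (k%:R / 2 ^+ n)).
have yE n k : y n.+1 k.*2 = y n k.
  by rewrite /y -(dyadic_refine R n 1 k) addn1 expn1 muln2.
have [n hn] := dyadic_modulus yE small th e0.
exists ((2 ^+ n)^-1); first by rewrite invr_gt0 exprn_gt0.
move=> p q r [n1 [k1 [k1n pE]]] [n2 [k2 [k2n qE]]] [n3 [k3 [k3n rE]]] pq qr Hrp.
(* Any [d] with n + d above the three levels would serve; all three times are rewritten at level n +
   d. *)
pose d := (n1 + n2 + n3)%N.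
have common ni ki : (ni <= n + d)%N -> (ki <= 2 ^ ni)%N -> exists2 k : nat,
    (k <= 2 ^ (n + d))%N & tau (ki%:R / 2 ^+ ni) = tau (k%:R / 2 ^+ (n + d)).
  move=> nid kin; exists (ki * 2 ^ (n + d - ni))%N.
    by rewrite -{2}(subnKC nid) expnD leq_mul2r kin orbT.
  by rewrite -{2}(subnKC nid) dyadic_refine.
have d1 : (n1 <= n + d)%N.
  by rewrite (leq_trans (leq_addr n2 n1))// (leq_trans (leq_addr n3 _))// leq_addl.
have d2 : (n2 <= n + d)%N.
  by rewrite (leq_trans (leq_addl n1 n2))// (leq_trans (leq_addr n3 _))// leq_addl.
have d3 : (n3 <= n + d)%N by rewrite /d addnA leq_addl.
have [j1 j1n e1] := common n1 k1 d1 k1n.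
have [j2 j2n e2] := common n2 k2 d2 k2n.
have [j3 j3n e3] := common n3 k3 d3 k3n.
have E0 : 0 < (2 : R) ^+ (n + d) by exact: exprn_gt0.
have [p01 Hp] := Htau _ (dyadic_itv R j1n).
have [q01 Hq] := Htau _ (dyadic_itv R j2n).
have [r01 Hr] := Htau _ (dyadic_itv R j3n).
rewrite -e1 -pE in p01 Hp; rewrite -e2 -qE in q01 Hq; rewrite -e3 -rE in r01 Hr.
have le u v i j : 0 <= u <= 1 -> 0 <= v <= 1 -> u < v -> H u = i%:R / 2 ^+ (n + d) ->
    H v = j%:R / 2 ^+ (n + d) -> (i <= j)%N.
  move=> /andP[u0 _] /andP[_ v1] uv Hu Hv; have := HS _ _ u0 uv v1.
  by rewrite Hu Hv ltr_pM2r ?invr_gt0// ltr_nat => /ltnW.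
have j31 : (j3 <= j1 + 2 ^ d)%N.
  move: Hrp; rewrite Hr Hp -mulrBl ltr_pdivrMr// exprD mulKf ?expf_neq0 ?pnatr_eq0//.
  by rewrite -natrX ltrBlDr -natrD ltr_nat addnC => /ltnW.
have := hn d j1 j2 j3 (le _ _ _ _ p01 q01 pq Hp Hq) (le _ _ _ _ q01 r01 qr Hq Hr) j3n j31.
by rewrite /y -e1 -e2 -e3 -pE -qE -rE.
Qed.

(** The modulus is uniform on the scale [H]; continuity of [H] at t turns it into a statement on a
    time interval around t. *)
Lemma dyadic_path_oscillation (R : realType) (H tau x : R -> R) (theta : R) (n0 : nat) :
  {within `[0, 1], continuous H} ->
  (forall s t, 0 <= s -> s < t -> t <= 1 -> H s < H t) ->
  (forall u, 0 <= u <= 1 -> 0 <= tau u <= 1 /\ H (tau u) = u) ->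
  0 <= theta < 1 ->
  (forall n k, (n0 <= n)%N -> (k.+2 <= 2 ^ n)%N ->
    `|x (tau (k.+1%:R / 2 ^+ n)) - x (tau (k%:R / 2 ^+ n))| <= theta ^+ n \/
    `|x (tau (k.+2%:R / 2 ^+ n)) - x (tau (k.+1%:R / 2 ^+ n))| <= theta ^+ n) ->
  (forall t e, 0 <= t <= 1 -> 0 < e -> exists2 h : R, 0 < h & forall p q,
    dyadic_time tau p -> dyadic_time tau q ->
    t < p < t + h -> t < q < t + h -> `|x p - x q| <= e) /\
  (forall t e, 0 <= t <= 1 -> 0 < e -> exists2 h : R, 0 < h & forall p q,
    dyadic_time tau p -> dyadic_time tau q ->
    t - h < p < t -> t - h < q < t -> `|x p - x q| <= e).
Proof.
move=> /within_continuousP01 cH HS Htau th small.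
have modulus := dyadic_path_modulus HS Htau th small.
have D01 p : dyadic_time tau p -> 0 <= p <= 1.
  by move=> [n [k [kn ->]]]; have [] := Htau _ (dyadic_itv R kn).
have local t e : 0 <= t <= 1 -> 0 < e -> exists2 h : R, 0 < h & forall p q r,
    dyadic_time tau p -> dyadic_time tau q -> dyadic_time tau r ->
    `|t - p| < h -> `|t - r| < h -> p < q -> q < r ->
    `|x q - x p| <= e \/ `|x r - x q| <= e.
  move=> t01 e0; have [eta eta0 mod_e] := modulus e e0.
  have [h h0 hh] := cH t _ t01 (divr_gt0 eta0 (ltr0Sn R 1)).
  exists h => // p q r Dp Dq Dr tp tr pq qr; apply: mod_e => //.
  have := hh p (D01 _ Dp) tp; have := hh r (D01 _ Dr) tr.
  by rewrite !ltr_norml => /andP[? ?] /andP[? ?]; lra.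
split=> t e t01 e0.
  apply: right_oscillation e0 => e' e'0; have [h h0 hh] := local t e' t01 e'0.
  exists h => // p q r Dp Dq Dr tp pq qr rt; apply: hh => //.
    by rewrite ltr_norml; lra.
  by rewrite ltr_norml; lra.
apply: left_oscillation e0 => e' e'0; have [h h0 hh] := local t e' t01 e'0.
exists h => // p q r Dp Dq Dr tp pq qr rt; apply: hh => //.
  by rewrite ltr_norml; lra.
by rewrite ltr_norml; lra.
Qed.

(** * Continuity in probability and identification of limits *)

(** The grid bound is used with the degenerate triple (t, s, t): both adjacent increments equal X(s)
    - X(t) up to sign, so their joint tail is a single tail. With p / 2 as second exponent, the
    moment of the product is the moment of order p of one increment. Since delta <= 1, delta^2 is at
    most delta. *)
Lemma increment_tail (d d' : measure_display) (Omega : measurableType d)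
    (S : measurableType d') (R : realType) (P : probability Omega R)
    (alpha p : R) (m : {finite_measure set S -> \bar R})
    (M : set S -> {RV P >-> R}) (X : R -> {RV P >-> R}) (f : R -> S -> R) :
  1 < alpha < 2 -> alpha < p -> is_sas_random_measure alpha m M ->
  (forall t : R, 0 <= t <= 1 -> f t \in Lfun m alpha%:E) ->
  (forall t : R, 0 <= t <= 1 -> is_stable_integral alpha m M (f t) (X t)) ->
  forall eps eta : R, 0 < eps -> 0 < eta -> exists2 delta : R, 0 < delta &
    forall s t : R, 0 <= s <= 1 -> 0 <= t <= 1 ->
    (\int[m]_u (`|f s u - f t u| `^ p)%:E <= delta%:E)%E ->
    (P [set w | (eps < `|X s w - X t w|)%R] <= eta%:E)%E.
Proof.
move=> a12 ap hM hf hXf eps eta eps0 eta0; have /andP[a1 a2] := a12.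
have ap2 : alpha / 2 < p / 2 by lra.
have [c0 c00 hg] := grid_bound a12 ap ap2 hM hf hXf.
have a0 : 0 < alpha by lra.
have [K K0 hz] := powRN_small a0 c00 (divr_gt0 eta0 (ltr0Sn R 1)).
have [C C0 {}hg] := hg K K0.
pose A := C * (eps `^ (- (2 * p)) + eps `^ (- (2 * (p / 2)))).
have A0 : 0 <= A by rewrite mulr_ge0 ?addr_ge0 ?powR_ge0.
pose delta := Num.min 1 (eta / 2 / (A + 1)).
have d0 : 0 < delta by rewrite lt_min ltr01/= !divr_gt0//; lra.
have d1 : delta <= 1 by rewrite ge_min lexx.
have dA : A * delta <= eta / 2.
  have : delta <= eta / 2 / (A + 1) by rewrite ge_min lexx orbT.
  by rewrite ler_pdivlMr; [nra|lra].
have key : eta / 2 + A * delta <= eta by lra.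
exists delta => // s t s01 t01 hst.
have := hg unit (fun=> t) (fun=> s) (fun=> t) (fun=> eps) (fun=> delta) (fun=> delta).
move=> /(_ (fun=> t01) (fun=> s01) (fun=> t01) (fun=> eps0) (fun=> d0) (fun=> d0)).
move=> /(_ (fun=> hst)) hb.
have {}hb := hb _ _.
have -> : [set w | (eps < `|X s w - X t w|)%R] = [set w | exists q : unit,
    (eps < `|X s w - X t w|)%R /\ (eps < `|X t w - X s w|)%R].
  by apply/seteqP; split=> w /=; [move=> h; exists tt; rewrite [in X in _ /\ X]distrC|case=> _ []].
apply: le_trans (hb _ _) _.
- by move=> _; under eq_integral do rewrite distrC.
- move=> _; apply: le_trans hst; rewrite le_eqVlt; apply/orP; left; apply/eqP.
  apply: eq_integral => u _; congr (_%:E).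
  rewrite normrM (distrC (f t u)) -expr2 -powR_mulrn// -powRrM; congr (_ `^ _); by field.
- rewrite lee_fin big_const card_unit/= addr0.
  have : delta ^+ 2 <= delta by rewrite expr2 ler_piMl// ltW.
  move=> d2; have := powR_ge0 eps (- (2 * p)) => e1.
  apply: le_trans key.
  apply: lerD => //; rewrite /A -mulrA; apply: ler_wpM2l => //; rewrite [leRHS]mulrDl; apply: lerD => //.
  exact: ler_wpM2l.
Qed.

(** Where the pointwise limit [Y] differs from [X], all late [Z j] stay further than some 1 / (i +
    1) from [X]. For fixed i and J this event [B i J] lies inside single tail events of arbitrarily
    small probability, hence is null, and there are countably many of them. *)
Lemma cvg_prob_eq1 (d : measure_display) (Omega : measurableType d) (R : realType)
    (P : probability Omega R) (A : set Omega) (Z : nat -> Omega -> R) (X Y : Omega -> R) :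
  measurable A -> P A = 0%E -> (forall j, measurable_fun setT (Z j)) ->
  measurable_fun setT X -> measurable_fun setT Y ->
  (forall w, ~ A w -> Z j w @[j --> \oo] --> Y w) ->
  (forall eps eta : R, 0 < eps -> 0 < eta -> exists J, forall j, (J <= j)%N ->
    (P [set w | (eps < `|Z j w - X w|)%R] <= eta%:E)%E) ->
  P [set w | Y w = X w] = 1%E.
Proof.
move=> mA A0 mZ mX mY cv tail.
have mZX eps j : measurable [set w | (eps < `|Z j w - X w|)%R].
  by apply: measurable_norm_gt; apply: measurable_funB.
pose B i J := \bigcap_(j in [set j | (J <= j)%N]) [set w | (i.+1%:R^-1 < `|Z j w - X w|)%R].
have mB i J : measurable (B i J) by apply: bigcap_measurable; [exists J => /=|move=> j _; exact: mZX].
have B0 i J : P.-negligible (B i J).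
  exists (B i J); split=> //; apply/eqP; rewrite eq_le measure_ge0 andbT.
  apply/lee_addgt0Pr => eta eta0; rewrite add0e.
  have i0 : 0 < (i.+1%:R : R)^-1 by rewrite invr_gt0.
  have [J' hJ] := tail _ eta i0 eta0.
  apply: le_trans (hJ (maxn J J') (leq_maxr _ _)).
  apply: le_measure; [exact: mem_set|exact/mem_set/mZX|].
  by move=> w; apply; exact: leq_maxl.
have mE : measurable [set w | Y w = X w].
  rewrite (_ : [set w | _] = ~` [set w | 0 < `|Y w - X w|]); last first.
    apply/seteqP; split=> w /=; first by move=> ->; rewrite subrr normr0 ltxx.
    by move=> /negP; rewrite normr_gt0 negbK subr_eq0 => /eqP.
  by apply: measurableC; apply: measurable_norm_gt; apply: measurable_funB.
have N0 : P.-negligible (~` [set w | Y w = X w]).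
  apply: (@negligibleS _ _ _ _ (A `|` \bigcup_i \bigcup_J B i J)); last first.
    have nA : P.-negligible A by exists A; split.
    by apply: (negligibleU nA); apply: negligible_bigcup => i; exact: negligible_bigcup.
  move=> w /= neq; have [Aw|nAw] := pselect (A w); [by left|right].
  have d0 : 0 < `|Y w - X w| / 2 by rewrite divr_gt0// normr_gt0 subr_eq0; exact/eqP.
  have [i _ /(_ i (leqnn i)) /= hi] := near_infty_natSinv_lt (PosNum d0).
  have /cvgrPdist_lt /(_ _ d0) [J _ hJ] := cv w nAw.
  exists i => //; exists J => // j /= Jj; have := hJ j Jj => /= h.
  apply: (lt_trans hi).
  have := ler_normD (Y w - Z j w) (Z j w - X w); rewrite addrA subrK; lra.
have Nc : P (~` [set w | Y w = X w]) = 0%E := measure_negligible (measurableC mE) N0.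
by rewrite -(setCK [set w | Y w = X w]) (probability_setC P (measurableC mE)) Nc sube0.
Qed.

(** * Construction of the modification *)

Theorem theorem4p3 (R : realType) (d d' : measure_display)
    (Omega : measurableType d) (S : measurableType d')
    (P : probability Omega R) (m : {finite_measure set S -> \bar R})
    (alpha : R) (M : set S -> {RV P >-> R})
    (X : R -> {RV P >-> R}) (f : R -> S -> R)
    (beta1 beta2 p1 p2 : R) (F1 F2 : R -> R)
    (halpha : 1 < alpha < 2)
    (hM : is_sas_random_measure alpha m M)
    (hX : is_sas_process alpha `[0, 1] X)
    (hf : forall t : R, 0 <= t <= 1 -> f t \in Lfun m alpha%:E)
    (hXf : forall t : R, 0 <= t <= 1 ->
      is_stable_integral alpha m M (f t) (X t))
    (hbeta1 : 2^-1 < beta1) (hbeta2 : 2^-1 < beta2)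
    (hp1 : alpha < p1) (hp2 : alpha / 2 < p2)
    (hF1 : {in `[0, 1] &, {homo F1 : x y / x <= y}})
    (hF1c : {within `[0, 1], continuous F1})
    (hF2 : {in `[0, 1] &, {homo F2 : x y / x <= y}})
    (hF2c : {within `[0, 1], continuous F2})
    (hinc1 : forall t1 t t2 : R, 0 <= t1 -> t1 <= t -> t <= t2 -> t2 <= 1 ->
      (\int[m]_s (`|f t2 s - f t1 s| `^ p1)%:E
        <= (`|F1 t2 - F1 t1| `^ beta1)%:E)%E)
    (hinc2 : forall t1 t t2 : R, 0 <= t1 -> t1 <= t -> t <= t2 -> t2 <= 1 ->
      (\int[m]_s (`|(f t s - f t1 s) * (f t2 s - f t s)| `^ p2)%:E
        <= (`|F2 t2 - F2 t1| `^ (2 * beta2))%:E)%E) :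
  exists Y : R -> {RV P >-> R},
    is_modification `[0, 1] X Y /\
    (forall w : Omega, cadlag01 (fun t : R => Y t w)).
Proof.
have /andP[a1 a2] := halpha.
have [l [H [tau [l0 cH HS HF [H0 H1 Htau]]]]] := time_change hF1 hF1c hF2 hF2c.
pose T n k := tau (k%:R / 2 ^+ n).
have T01 n k : (k <= 2 ^ n)%N -> 0 <= T n k <= 1.
  by move=> kn; have [] := Htau _ (dyadic_itv R kn).
have HT n k : (k <= 2 ^ n)%N -> H (T n k) = k%:R / 2 ^+ n.
  by move=> kn; have [] := Htau _ (dyadic_itv R kn).
have Tle n i j : (i <= j)%N -> (j <= 2 ^ n)%N -> T n i <= T n j.
  move=> ij jn; have iln := leq_trans ij jn; rewrite leNgt; apply/negP => h.
  have /andP[j0 _] := T01 _ _ jn; have /andP[_ i1] := T01 _ _ iln.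
  have := HS _ _ j0 h i1; rewrite !HT// ltr_pM2r ?invr_gt0 ?exprn_gt0// ltr_nat.
  by rewrite ltnNge ij.
(* The factor 2 is there because a pair of adjacent increments spans two dyadic steps. *)
pose L := 2 * l.
have L0 : 0 < L by rewrite mulr_gt0.
have E0 n : 0 < ((2 : R) ^+ n)^-1 by rewrite invr_gt0 exprn_gt0.
have inc1 n k : (k < 2 ^ n)%N ->
    (\int[m]_s (`|f (T n k.+1) s - f (T n k) s| `^ p1)%:E <= ((L / 2 ^+ n) `^ beta1)%:E)%E.
  move=> kn; have /andP[t0 _] := T01 _ _ (ltnW kn); have /andP[_ t1] := T01 _ _ kn.
  have tt := Tle _ _ _ (leqnSn k) kn.
  apply: (le_trans (hinc1 _ _ _ t0 (lexx _) tt t1)); rewrite lee_fin.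
  apply: ge0_ler_powR; rewrite ?nnegrE ?divr_ge0 ?exprn_ge0 ?(ltW L0)//; first lra.
  have [h _] := HF _ _ t0 tt t1; apply: (le_trans h).
  rewrite !HT ?(ltnW kn)// -mulrBl -natrB// subSnn mul1r ler_wpM2r ?ltW//.
  by rewrite /L; lra.
have inc2 n k : (k.+2 <= 2 ^ n)%N ->
    (\int[m]_s (`|(f (T n k.+1) s - f (T n k) s)
      * (f (T n k.+2) s - f (T n k.+1) s)| `^ p2)%:E <= ((L / 2 ^+ n) `^ (2 * beta2))%:E)%E.
  move=> kn; have /andP[t0 _] := T01 _ _ (ltnW (ltnW kn)); have /andP[_ t1] := T01 _ _ kn.
  have tt1 := Tle _ _ _ (leqnSn k) (ltnW kn).
  have tt2 := Tle _ _ _ (leqnSn k.+1) kn.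
  apply: (le_trans (hinc2 _ _ _ t0 tt1 tt2 t1)); rewrite lee_fin.
  apply: ge0_ler_powR; rewrite ?nnegrE ?divr_ge0 ?exprn_ge0 ?(ltW L0)//; first lra.
  have [_ h] := HF _ _ t0 (le_trans tt1 tt2) t1; apply: (le_trans h).
  rewrite !HT ?(ltnW (ltnW kn))// -mulrBl -natrB; last by rewrite leqW.
  by rewrite -addn2 addKn mulrA (mulrC l).
have [theta th [mU nU]] := dyadic_oscillation_null halpha hp1 hp2 hM hf hXf
  hbeta1 hbeta2 L0 T01 inc1 inc2.
set U := fun n : nat => _ in nU.
have {}mU n : measurable (U n) by exact: mU.
pose bad := lim_sup_set U.
have mbad : measurable bad.
  by apply: bigcap_measurable; [exists 0|move=> n _; by apply: bigcup_measurable => k _; exact: mU].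
(* On the null event [bad] the path is set to 0, so that the regularity below holds for every
   [w]. *)
pose x w t := X t w * \1_(~` bad) w.
have xbad w t : bad w -> x w t = 0.
  by move=> bw; rewrite /x indicE memNset ?mulr0//= => /(_ bw).
have xgood w t : ~ bad w -> x w t = X t w.
  by move=> bw; rewrite /x indicE mem_set ?mulr1.
have small w : exists n0, forall n k, (n0 <= n)%N -> (k.+2 <= 2 ^ n)%N ->
    `|x w (T n k.+1) - x w (T n k)| <= theta ^+ n \/
    `|x w (T n k.+2) - x w (T n k.+1)| <= theta ^+ n.
  have /andP[th0 _] := th.
  have [bw|bw] := pselect (bad w).
    by exists 0%N => n k _ _; left; rewrite !xbad// subrr normr0 exprn_ge0.
  have [n0 hn0] : exists n0, forall n, (n0 <= n)%N -> ~ U n w.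
    apply: contrapT => no; apply: bw => n0 _; apply: contrapT => no0.
    by apply: no; exists n0 => n nn Un; apply: no0; exists n.
  exists n0 => n k nn kn; rewrite !xgood//.
  have [h1|h1] := lerP `|X (T n k.+1) w - X (T n k) w| (theta ^+ n); first by left.
  have [h2|h2] := lerP `|X (T n k.+2) w - X (T n k.+1) w| (theta ^+ n); first by right.
  by case: (hn0 n nn); exists k.
have osc w : _ := let: ex_intro n0 h := small w in
  dyadic_path_oscillation cH HS Htau th h.
have dense := dyadic_time_dense HS Htau H0 H1.
have D01 p : dyadic_time tau p -> 0 <= p <= 1.
  by move=> [n [k [kn ->]]]; exact: T01.
(* The sequence of dyadic times depends on [t] alone, not on [w]; limits along it are therefore
   measurable in [w]. *)
have /choice[s hs] : forall t, exists u : nat -> R, forall j, 0 <= t < 1 ->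
    dyadic_time tau (u j) /\ t < u j < t + j.+1%:R^-1.
  move=> t; suff /choice[u hu] : forall j : nat, exists v : R, 0 <= t < 1 ->
      dyadic_time tau v /\ t < v < t + j.+1%:R^-1 by exists u.
  move=> j; have [/andP[t0 t1]|t01] := boolP (0 <= t < 1); last by exists 0.
  have j0 : 0 < (j.+1%:R : R)^-1 by rewrite invr_gt0.
  have [||v Dv /andP[tv vt]] := dense t (Num.min 1 (t + j.+1%:R^-1)) t0.
  - by rewrite lt_min t1 ltrDl.
  - by rewrite ge_min lexx.
  exists v => _; split=> //; rewrite tv/=; apply: (lt_le_trans vt).
  by rewrite ge_min lexx orbT.
(* At t = 1 there is no time to the right and the value of the path is kept; only a left limit is
   required there. *)
pose y t w := if 0 <= t < 1 then limn (fun j => x w (s t j)) else x w t.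
have mx t : measurable_fun setT (fun w => x w t).
  by apply: measurable_funM => //; exact/measurable_indic/measurableC.
have cv t w : 0 <= t < 1 -> x w (s t j) @[j --> \oo] --> y t w.
  move=> t01; rewrite /y t01; have /andP[t0 t1] := t01.
  have t01' : 0 <= t <= 1 by rewrite t0 ltW.
  apply: (@right_limit_cvg R (x w) (dyadic_time tau) t (s t)).
  - by move=> e e0; exact: (osc w).1.
  - by move=> j; exact: (hs t j t01).1.
  - by move=> j; exact: (hs t j t01).2.
have my t : measurable_fun setT (y t).
  have [t01|t01] := boolP (0 <= t < 1).
    by apply: (measurable_fun_cvg (h := fun j w => x w (s t j))) => // w _; exact: cv.
  by rewrite /y (negbTE t01); exact: mx.
exists (fun t => mfun_Sub (mem_set (my t)) : {RV P >-> R}).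
split=> [t|w]; last first.
  apply: (@cadlag_regularization R (x w) (fun t => y t w) (dyadic_time tau) s).
  - by move=> t j t01; exact: (hs t j t01).1.
  - by move=> t j t01; exact: (hs t j t01).2.
  - move=> t h /andP[t0 t1] h0.
    have [|||p Dp /andP[hp pt]] := dense (Num.max 0 (t - h)) t.
    + by rewrite le_max lexx.
    + by rewrite gt_max t0/=; lra.
    + exact: t1.
    by exists p => //; rewrite pt andbT; apply: le_lt_trans hp; rewrite le_max lexx orbT.
  - by move=> t e /andP[t0 t1] e0; apply: (osc w).1 => //; rewrite t0 ltW.
  - by move=> t e /andP[t0 t1] e0; apply: (osc w).2 => //; rewrite t1 ltW.
  - by move=> t t01; exact: cv.
rewrite /= in_itv/= => t01; have /andP[t0 t1] := t01.
have [tlt|] := boolP (0 <= t < 1); last first.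
  rewrite t0/= -leNgt => t1'; apply: (@cvg_prob_eq1 _ _ _ _ bad (fun=> X t)) => //.
  - by move=> w bw; rewrite /= /y t0/= ltNge t1'/= xgood//; exact: cvg_cst.
  - move=> eps eta e0 eta0; exists 0%N => j _.
    rewrite (_ : [set w | _] = set0) ?measure0 ?lee_fin ?ltW//.
    by apply/seteqP; split=> w //=; rewrite subrr normr0 ltNge ltW.
apply: (@cvg_prob_eq1 _ _ _ _ bad (fun j => X (s t j))) => //.
- by move=> w bw; have := cv t w tlt; under eq_fun do rewrite xgood//.
move=> eps eta eps0 eta0.
have [delta d0 hd] := increment_tail halpha hp1 hM hf hXf eps0 eta0.
have b10 : 0 < beta1 by apply: lt_trans hbeta1; rewrite invr_gt0.
(* Right-continuity in probability at t: increments of F1 are at most l times those of H, so the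
   moment bound of an increment falls below delta once H increases by less than delta^(1 / beta1) /
   l, and H is continuous. *)
have z0 : 0 < delta `^ beta1^-1 / l by rewrite divr_gt0// powR_gt0.
have [h h0 hh] := within_continuousP01 cH t01 z0.
have [J _ hJ] := near_infty_natSinv_lt (PosNum h0).
exists J => j Jj; have [Ds /andP[ts st]] := hs t j tlt.
have s01 := D01 _ Ds; have /andP[s0 s1] := s01.
apply: hd => //; apply: (le_trans (hinc1 _ _ _ t0 (ltW ts) (lexx _) s1)).
have [h1 _] := HF _ _ t0 (ltW ts) s1.
rewrite lee_fin.
have -> : delta = (delta `^ beta1^-1) `^ beta1.
  by rewrite -powRrM mulVf ?gt_eqF// powRr1// ltW.
apply: ge0_ler_powR; rewrite ?nnegrE ?powR_ge0// ?ltW//.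
apply: (le_lt_trans h1); rewrite mulrC -ltr_pdivlMr//.
have := hh _ s01; have := hJ j Jj => /= hj.
rewrite distrC ger0_norm ?subr_ge0 ?ltW// => /(_ _) hlt.
have hst : s t j - t < h.
  by rewrite ltrBlDl; apply: (lt_trans st); rewrite ltrD2l.
by apply: le_lt_trans (hlt hst); rewrite distrC; exact: ler_norm.
Qed.
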